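(* There exists a polynomial-time algorithm which, given a tree $T=(V,E,w)$ with a down-monotonic cost function $w$, computes an adaptive search strategy (equivalently, a decision tree $D$ for $T$) whose worst-case cost is at most $2\cdot\mathrm{OPT}(T)$.
   Context: $T=(V,E,w)$ is a finite tree with query cost function $w\colon V\to\mathbb{R}_+$. Search model: an unknown target $t\in V$ is to be found; querying a vertex $q$ costs $w(q)$ and reveals either that $q=t$ or which neighbor of $q$ is closer to $t$ (equivalently, which connected component of $T-q$ contains $t$). An adaptive search strategy is encoded by a decision tree, defined recursively: if $|V|=1$ it consists of that single vertex; otherwise one chooses a vertex $q$ (the first query), and the decision tree is the rooted tree with root $q$ whose children are the roots of decision trees for the connected components of $T-q$. For a decision tree $D$, $\mathrm{COST}(D)$ is the maximum over root-to-leaf paths $P$ of $D$ of $\sum_{v\in P}w(v)$ (the worst-case total query cost), and $\mathrm{OPT}(T)$ is the minimum of $\mathrm{COST}(D)$ over all decision trees $D$ for $T$. The cost function $w$ is down-monotonic if there is a vertex $r$ such that for all $u,v\in V$, whenever $v$ lies on the path between $r$ and $u$, we have $w(v)\le w(u)$. *)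

(* Defs.v *)
From HB Require Import structures.
From mathcomp Require Import all_boot all_order all_algebra.
From mathcomp Require Import reals.
Set Implicit Arguments. Unset Strict Implicit. Unset Printing Implicit Defensive.
Import Order.TTheory GRing.Theory Num.Theory.
Local Open Scope ring_scope.

Definition acyclic (V : finType) (e : rel V) : Prop :=
  forall s : seq V, uniq s -> (3 <= size s)%N -> ~~ cycle e s.

Definition is_tree (V : finType) (e : rel V) : Prop :=
  [/\ (0 < #|V|)%N, symmetric e, irreflexive e,
      (forall x y, connect e x y) & acyclic e].

Definition on_path (V : finType) (e : rel V) (r u v : V) : Prop :=
  exists p : seq V, [/\ path e r p, last r p = u, uniq (r :: p) & v \in r :: p].

Definition down_monotonic (R : realType) (V : finType) (e : rel V)
    (w : V -> R) : Prop :=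
  exists r : V, forall u v, on_path e r u v -> w v <= w u.

Definition restrict (V : finType) (e : rel V) (S : {set V}) : rel V :=
  [rel x y | [&& x \in S, y \in S & e x y]].

Definition comps (V : finType) (e : rel V) (S : {set V}) : {set {set V}} :=
  [set [set y in S | connect (restrict e S) x y] | x in S].

Inductive dtree (V : Type) := DNode of V & seq (dtree V).

Definition droot (V : Type) (D : dtree V) : V := let: DNode q _ := D in q.

Inductive is_dtree (V : finType) (e : rel V) : {set V} -> dtree V -> Prop :=
| IsDT (S : {set V}) (q : V) (ch : seq (dtree V)) (Cs : seq {set V}) :
    q \in S ->
    size ch = size Cs ->
    perm_eq Cs (enum (comps e (S :\ q))) ->
    (forall i, (i < size ch)%N ->
       is_dtree e (nth set0 Cs i) (nth (DNode q [::]) ch i)) ->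
    is_dtree e S (DNode q ch).

Fixpoint dcost (R : realType) (V : Type) (w : V -> R) (D : dtree V) : R :=
  match D with
  | DNode q ch =>
      w q + (fix mx (l : seq (dtree V)) : R :=
               match l with
               | [::] => 0
               | c :: l' => Num.max (dcost w c) (mx l')
               end) ch
  end.

Definition OPT (R : realType) (V : finType) (e : rel V) (w : V -> R) : R :=
  inf (fun x : R => exists D, is_dtree e setT D /\ x = dcost w D).

Fixpoint dedges (V : Type) (D : dtree V) : seq (V * V) :=
  match D with
  | DNode q ch =>
      (fix go (l : seq (dtree V)) : seq (V * V) :=
         match l with
         | [::] => [::]
         | c :: l' => (q, droot c) :: dedges c ++ go l'
         end) ch
  end.

(* Model of computation: a Real RAM (unit cost) with a nat memory      *)
(* (indices/integers) and a real memory, direct and indirect addressing*)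

Inductive instr :=
| NConst (d k : nat)
| NAdd (d a b : nat)
| NSub (d a b : nat)        (* N[d] := N[a] - N[b] (truncated) *)
| NLoad (d a : nat)
| NStore (a s : nat)
| RZero (d : nat)
| ROne (d : nat)
| RAdd (d a b : nat)
| RSub (d a b : nat)
| RMul (d a b : nat)
| RLoad (d a : nat)
| RStore (a s : nat)
| JmpZ (a l : nat)
| JmpLe (a b l : nat)
| Halt.

Definition program := seq instr.

Record rstate (R : realType) := RState {
  pc : nat; nmem : nat -> nat; rmem : nat -> R }.

Definition upd (T : Type) (m : nat -> T) (d : nat) (v : T) : nat -> T :=
  fun x => if x == d then v else m x.

Definition halted (R : realType) (P : program) (s : rstate R) : bool :=
  if nth Halt P (pc s) is Halt then true else false.

Definition step (R : realType) (P : program) (s : rstate R) : rstate R :=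
  let N := nmem s in let X := rmem s in let p := pc s in
  match nth Halt P p with
  | NConst d k => RState p.+1 (upd N d k) X
  | NAdd d a b => RState p.+1 (upd N d (N a + N b)%N) X
  | NSub d a b => RState p.+1 (upd N d (N a - N b)%N) X
  | NLoad d a => RState p.+1 (upd N d (N (N a))) X
  | NStore a t => RState p.+1 (upd N (N a) (N t)) X
  | RZero d => RState p.+1 N (upd X d 0)
  | ROne d => RState p.+1 N (upd X d 1)
  | RAdd d a b => RState p.+1 N (upd X d (X a + X b))
  | RSub d a b => RState p.+1 N (upd X d (X a - X b))
  | RMul d a b => RState p.+1 N (upd X d (X a * X b))
  | RLoad d a => RState p.+1 N (upd X d (X (N a)))
  | RStore a t => RState p.+1 N (upd X (N a) (X t))
  | JmpZ a l => RState (if N a == 0%N then l else p.+1) N X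
  | JmpLe a b l => RState (if X a <= X b then l else p.+1) N X
  | Halt => s
  end.

Fixpoint exec (R : realType) (P : program) (fuel : nat) (s : rstate R)
    : option (rstate R) :=
  if halted P s then Some s else
  match fuel with
  | 0 => None
  | k.+1 => exec P k (step P s)
  end.

(* Input encoding of (T, w) with V = {0,...,n-1}:
   N[0] = n, N[1] = m (number of edges), N[2+2i], N[3+2i] = endpoints of
   the i-th edge (i < j, lexicographic order), X[v] = w(v) for v < n,
   everything else 0; the program counter starts at 0. *)
Definition edge_list (n : nat) (e : rel 'I_n) : seq (nat * nat) :=
  [seq (val p.1, val p.2) | p <- enum [pred p : 'I_n * 'I_n |
                                        (p.1 < p.2)%N && e p.1 p.2]].

Definition init_state (R : realType) (n : nat) (e : rel 'I_n) (w : 'I_n -> R)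
    : rstate R :=
  let E := edge_list e in
  RState 0
    (fun a => if a == 0%N then n else if a == 1%N then size E else
              let i := (a - 2)%N in
              if (i < 2 * size E)%N then
                (if odd i then (nth (0, 0) E i./2).2 else (nth (0, 0) E i./2).1)%N
              else 0%N)
    (fun a => match @insub nat (fun x => x < n)%N 'I_n a with
              | Some v => w v | None => 0 end).

(* Output encoding of a decision tree D on V = {0,...,n-1} in the nat memory:
   N[0] = root of D, N[1+root] = 0 and N[1+c] = q+1 whenever c is a child
   of q in D (parent array, shifted by one). *)
Definition encodes (n : nat) (M : nat -> nat) (D : dtree 'I_n) : Prop :=
  [/\ M 0%N = val (droot D), M (val (droot D)).+1 = 0%N &
      forall q c, (q, c) \in dedges D -> M (val c).+1 = (val q).+1].

(* Main.v *)
(* Prim's algorithm from a lightest vertex, always taking a lightest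
   frontier vertex, lists the vertices by ascending cost when w is
   down-monotonic, and this order roots the tree. Along it each cost w is
   rounded to a surrogate x in [w, 2w] that is the least multiple of its
   predecessor above w, so surrogates form a divisibility chain; a ratio above
   n + 1 is replaced by a fresh start x = w, and by exactly n + 1 in the integer
   sizes Y that stand for x. A set of at most n vertices cannot make up for
   such a ratio, so comparing Y-sums still compares x-sums (surrogate_le).
   It remains to solve the problem exactly for Y. A decision tree is a ranking:
   v occupies the slots [f v - Y v, f v), and on the path between two vertices
   with overlapping slots a third one lies above both. Going through the
   vertices in reverse Prim order, put each one into the lowest slot compatible
   with the slots visible below it. Divisibility makes this optimal: sampled at
   multiples of Y v, the visible set of v is lexicographically at most that of
   any ranking (lexle_vis). Joining components in ascending greedy rank
   produces the decision tree. The algorithm is written in a small structured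
   language compiled to the RAM. *)
Require Import Defs.
From HB Require Import structures.
From mathcomp Require Import all_boot all_order all_algebra.
From mathcomp Require Import boolp reals.
From mathcomp Require Import zify lra ring.
Set Implicit Arguments. Unset Strict Implicit. Unset Printing Implicit Defensive.
Import Order.TTheory GRing.Theory Num.Theory.

(** * A structured language and its compilation *)

(** The factor 2 is lost only between [w] and [x], but trees cannot be compared through their
    [x]-costs: the greedy step minimises the [Y]-cost, and the ratio of [x] to [Y] may change at
    every fresh start. The comparison is made on paths instead. A heaviest path of the output for
    [w] and a heaviest path of a rival for [Y] are two vertex sets ordered by their [Y]-sums;
    [surrogate_le] orders their [x]-sums, and [w <= x <= 2w] does the rest. Minimising the top slot
    alone is not an inductive goal, since children with equal tops may leave different gaps. The
    lexicographic order on all visible slots is the strengthening that passes from children to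
    parent. It relies on costs growing away from the root: [Y v] divides every [Y u] below [v], so
    greedy slots below [v] are aligned at multiples of [Y v]. The slots of a rival need not be, and
    [lexle_refine] deals with this misalignment. Ratios of costs are unbounded, so the running time
    must not depend on them: each surrogate takes at most [n] additions, and every loop of the
    language has [n] rounds. *)

Definition seg (P : program) (pc : nat) (l : program) : Prop :=
  forall i, i < size l -> nth Halt P (pc + i) = nth Halt l i.

Lemma seg_cat P pc l1 l2 :
  seg P pc (l1 ++ l2) -> seg P pc l1 /\ seg P (pc + size l1) l2.
Proof.
move=> h; split=> i hi.
  by rewrite h ?nth_cat ?hi // size_cat; lia.
rewrite -addnA h ?nth_cat ?size_cat; last by lia.
by rewrite ltnNge leq_addr /= addKn.
Qed.

Lemma seg_cons P pc i l :
  seg P pc (i :: l) -> nth Halt P pc = i /\ seg P pc.+1 l.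
Proof.
move=> h; split; first by move: (h 0 isT); rewrite addn0.
by move=> j hj; rewrite addSnnS h.
Qed.

(** A bound on the number of steps instead of the exact number, because the two branches of a
    conditional take different times. *)
Definition runs (R : realType) (P : program) (b : nat) (s s' : rstate R) : Prop :=
  exists2 k, k <= b & iter k (step P) s = s'.

Section Runs.
Variables (R : realType) (P : program).
Implicit Types s : rstate R.

Lemma runs0 s : runs P 0 s s.
Proof. by exists 0. Qed.

Lemma runs_pc p q N (X : nat -> R) : p = q -> runs P 0 (RState p N X) (RState q N X).
Proof. by move=> ->; apply: runs0. Qed.

Lemma runs_trans b1 b2 s1 s2 s3 :
  runs P b1 s1 s2 -> runs P b2 s2 s3 -> runs P (b1 + b2) s1 s3.
Proof.
move=> [k hk <-] [l hl <-]; exists (l + k); first by lia.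
by rewrite iterD.
Qed.

Lemma runs_le b1 b2 s1 s2 : runs P b1 s1 s2 -> b1 <= b2 -> runs P b2 s1 s2.
Proof. by move=> [k hk h] le; exists k => //; lia. Qed.

Lemma runs_step s : runs P 1 s (step P s).
Proof. by exists 1. Qed.

Lemma runsS b s s' : runs P b (step P s) s' -> runs P b.+1 s s'.
Proof. by move=> h; rewrite -add1n; apply: runs_trans h; apply: runs_step. Qed.

(** [exec] may stop before [k] steps. A halted state is a fixed point of [step], so the state
    reached is then already [s'], and spare fuel does no harm. *)
Lemma exec_runs b s s' fuel :
  runs P b s s' -> halted P s' -> b <= fuel -> exec P fuel s = Some s'.
Proof.
move=> [k hk hs] hh hb; have {hk hb} : k <= fuel by lia.
elim: fuel k s hs => [|f IH] k s hs hk.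
  by move: hk hs; rewrite leqn0 => /eqP-> /= e; subst s'; rewrite hh.
rewrite /=; case: ifPn => hs0.
  have eS : step P s = s.
    by move: hs0; rewrite /halted /step; case: nth.
  have it j : iter j (step P) s = s by elim: j => //= j ->.
  by rewrite -hs it.
case: k hs hk => [|k] hs hk; first by move: hs0; rewrite (hs : s = s') hh.
by apply: (IH k) => //; rewrite -iterSr.
Qed.

End Runs.

Inductive expr :=
| Var of nat
| Cst of nat
| EAdd of expr & expr
| ESub of expr & expr
| EArr of nat & expr.

(** There is no unbounded loop: every command terminates, and its time is polynomial in variable 0
    by structural induction ([steps_poly]). The tape carries input and output, the arrays are
    scratch memory. *)
Inductive cmd :=
| Skip
| Seq of cmd & cmd
| Assign of nat & expr
| StoreArr of nat & expr & expr
| LoadTape of nat & expr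
| StoreTape of expr & expr
| LoadReal of nat & expr
| ZeroReal of nat
| AddReal of nat & nat & nat
| IfZero of expr & cmd & cmd
| IfLe of nat & nat & cmd & cmd
| For of nat & cmd.

Record astate (R : realType) := AState {
  vars : nat -> nat; arrs : nat -> nat -> nat; tape : nat -> nat; xregs : nat -> R }.

Definition upd_arr (T : Type) (m : nat -> nat -> T) k i v : nat -> nat -> T :=
  fun x y => if (x == k) && (y == i) then v else m x y.

Definition setv (R : realType) d v (s : astate R) :=
  AState (upd (vars s) d v) (arrs s) (tape s) (xregs s).

(* Memory layout: cell 0 holds a base b, variable r is in cell r + 1, cells T0
   to KR - 1 are expression temporaries, input cell x is kept in place, or at
   b + x when x < KR, and entry i of array k is in b + KR + 16 i + k. Loops run
   up to variable 0. LoadTape and StoreTape clamp the address below lim = b so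
   that they cannot touch the arrays. *)
Definition NV := 24.
Definition KR := 32.
Definition T0 := NV.+1.

Section Sem.
Variables (R : realType) (lim : nat) (W : nat -> R).

Fixpoint eval (s : astate R) (e : expr) : nat :=
  match e with
  | Var r => vars s r
  | Cst k => k
  | EAdd a b => eval s a + eval s b
  | ESub a b => eval s a - eval s b
  | EArr k a => arrs s k (eval s a)
  end.

(** The counter is set before each pass and once more after the loop, because the compiled loop
    leaves it equal to its bound. *)
Fixpoint den (c : cmd) (s : astate R) : astate R :=
  match c with
  | Skip => s
  | Seq a b => den b (den a s)
  | Assign d e => setv d (eval s e) s
  | StoreArr k a b => AState (vars s) (upd_arr (arrs s) k (eval s a) (eval s b)) (tape s) (xregs s)
  | LoadTape d e => setv d (tape s (minn (eval s e) lim.-1)) s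
  | StoreTape a b => AState (vars s) (arrs s) (upd (tape s) (minn (eval s a) lim.-1) (eval s b)) (xregs s)
  | LoadReal d e => AState (vars s) (arrs s) (tape s) (upd (xregs s) d (W (eval s e)))
  | ZeroReal d => AState (vars s) (arrs s) (tape s) (upd (xregs s) d 0%R)
  | AddReal d a b => AState (vars s) (arrs s) (tape s) (upd (xregs s) d (xregs s a + xregs s b)%R)
  | IfZero e a b => if eval s e == 0 then den a s else den b s
  | IfLe x y a b => if (xregs s x <= xregs s y)%R then den a s else den b s
  | For i a =>
      setv i (vars s 0) (iteri (vars s 0) (fun j s' => den a (setv i j s')) s)
  end.
End Sem.

Fixpoint writes_var (c : cmd) (r : nat) : bool :=
  match c with
  | Seq a b | IfZero _ a b | IfLe _ _ a b => writes_var a r || writes_var b r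
  | Assign d _ | LoadTape d _ => d == r
  | For i a => (i == r) || writes_var a r
  | _ => false
  end.

Fixpoint writes_arr (c : cmd) (k : nat) : bool :=
  match c with
  | Seq a b | IfZero _ a b | IfLe _ _ a b => writes_arr a k || writes_arr b k
  | StoreArr d _ _ => d == k
  | For i a => writes_arr a k
  | _ => false
  end.

Fixpoint writes_tape (c : cmd) : bool :=
  match c with
  | Seq a b | IfZero _ a b | IfLe _ _ a b => writes_tape a || writes_tape b
  | StoreTape _ _ => true
  | For i a => writes_tape a
  | _ => false
  end.

Fixpoint writes_xreg (c : cmd) (r : nat) : bool :=
  match c with
  | Seq a b | IfZero _ a b | IfLe _ _ a b => writes_xreg a r || writes_xreg b r
  | LoadReal d _ | ZeroReal d | AddReal d _ _ => d == r
  | For i a => writes_xreg a r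
  | _ => false
  end.

Section Frame.
Variables (R : realType) (lim : nat) (W : nat -> R).
Notation den := (den lim W).
Implicit Types s : astate R.

Ltac frame c s :=
  let IHa := fresh "IHa" in let IHb := fresh "IHb" in let h := fresh "h" in
  let ha := fresh "ha" in let hb := fresh "hb" in let j := fresh "j" in let IH := fresh "IH" in
  elim: c s => /= [|? IHa ? IHb|? ?|? ? ?|? ?|? ?|? ?|?|? ? ?|? ? IHa ? IHb|? ? ? IHa ? IHb|? ? IHa] s //=;
  rewrite ?negb_or => h;
  try first
    [ by case/andP: h => ha hb; rewrite IHb // IHa
    | by case/andP: h => ha hb; case: ifP; rewrite ?IHb ?IHa
    | by rewrite /upd ?/upd_arr eq_sym (negbTE h)
    | by elim: (vars s 0) => //= j IH; rewrite IHa ].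

Lemma frame_v c r s : ~~ writes_var c r -> vars (den c s) r = vars s r.
Proof.
frame c s.
case/andP: h => hi ha; rewrite /upd eq_sym (negbTE hi).
by elim: (vars s 0) => //= j IH; rewrite IHa //= /upd eq_sym (negbTE hi).
Qed.

Lemma frame_a c k s i : ~~ writes_arr c k -> arrs (den c s) k i = arrs s k i.
Proof. frame c s. Qed.

Lemma frame_t c s i : ~~ writes_tape c -> tape (den c s) i = tape s i.
Proof. frame c s. Qed.

Lemma frame_x c r s : ~~ writes_xreg c r -> xregs (den c s) r = xregs s r.
Proof. frame c s. Qed.

Lemma For_inv (Inv : nat -> astate R -> Prop) i c s n :
  vars s 0 = n ->
  Inv 0 s ->
  (forall j s', j < n -> Inv j s' -> Inv j.+1 (den c (setv i j s'))) ->
  (forall s', Inv n s' -> Inv n (setv i n s')) ->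
  Inv n (den (For i c) s).
Proof.
move=> /= -> h0 hS he; apply: he.
have : forall k, k <= n ->
  Inv k (iteri k (fun j s' => den c (setv i j s')) s).
  elim=> [|k IH] hk //=.
  by apply: hS => //; apply: IH; apply: ltnW.
by apply.
Qed.

End Frame.

(** The machine has no move and no index multiplication: a variable is copied by adding it to 0, and
    four doublings give the factor 16 of [arr_cell]. The value ends in cell [t], and cells from [t]
    on are temporaries. *)
Fixpoint compile_e (e : expr) (t : nat) : program :=
  match e with
  | Var r => [:: NConst t 0; NAdd t t r.+1]
  | Cst k => [:: NConst t k]
  | EAdd a b => compile_e a t ++ compile_e b t.+1 ++ [:: NAdd t t t.+1]
  | ESub a b => compile_e a t ++ compile_e b t.+1 ++ [:: NSub t t t.+1]
  | EArr k a => compile_e a t ++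
      [:: NAdd t t t; NAdd t t t; NAdd t t t; NAdd t t t; NAdd t t 0;
          NConst t.+1 (KR + k); NAdd t t t.+1; NLoad t t]
  end.

Fixpoint wf_expr (e : expr) (t : nat) : bool :=
  match e with
  | Var r => (r < NV) && (t < KR)
  | Cst k => t < KR
  | EAdd a b | ESub a b => wf_expr a t && wf_expr b t.+1
  | EArr k a => [&& k < 16, t.+1 < KR & wf_expr a t]
  end.

Lemma wf_expr_lt e t : wf_expr e t -> t < KR.
Proof.
elim: e t => [r|k|a IH b _|a IH b _|k a IH] t //=.
- by case/andP.
- by case/andP => /IH.
- by case/andP => /IH.
- by case/and3P => _ _ /IH.
Qed.

Definition tape_cell (b x : nat) := if x < KR then b + x else x.
Definition arr_cell (b k i : nat) := b + KR + 16 * i + k.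

(** Real memory is laid out like the tape: registers 0 to 3 are in place, and the costs that they
    displace are at [b + x]. [W] never changes, since commands write to registers only. *)
Definition represents (R : realType) (b : nat) (W : nat -> R) (s : astate R) (N : nat -> nat) (X : nat -> R) : Prop :=
  [/\ N 0 = b /\ KR <= b,
      (forall r, r < NV -> N r.+1 = vars s r),
      (forall x, x < b -> N (tape_cell b x) = tape s x),
      (forall k i, k < 16 -> N (arr_cell b k i) = arrs s k i) &
      (forall r, r < 4 -> X r = xregs s r) /\
      (forall x, X (if x < 4 then b + x else x) = W x)].

Definition same_out (t : nat) (N N' : nat -> nat) :=
  forall x, (x < t) || (KR <= x) -> N' x = N x.

Lemma same_out_trans t t' N1 N2 N3 :
  t <= t' -> same_out t N1 N2 -> same_out t' N2 N3 -> same_out t N1 N3.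
Proof. by move=> h h1 h2 x hx; rewrite h2 ?h1 //; lia. Qed.

Lemma represents_same (R : realType) b W (s : astate R) N N' X :
  represents b W s N X -> same_out T0 N N' -> represents b W s N' X.
Proof.
move=> [[h1 h1'] h2 h3 h4 h5] h; split=> //.
- by rewrite h //.
- by move=> r hr; rewrite h ?h2 // /T0; lia.
- by move=> x hx; rewrite h ?h3 // /tape_cell; case: ifP => ?; lia.
- by move=> k i hk; rewrite h ?h4 // /arr_cell; lia.
Qed.

Ltac upds := rewrite /upd /=; repeat case: eqP => //=.

Arguments upd : simpl never.
Lemma step_at (R : realType) (P : program) (s : rstate R) i (N := nmem s) (X := rmem s) (p := pc s) :
  nth Halt P p = i ->
  step P s = match i with
  | NConst d k => RState p.+1 (upd N d k) X
  | NAdd d a b => RState p.+1 (upd N d (N a + N b)%N) X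
  | NSub d a b => RState p.+1 (upd N d (N a - N b)%N) X
  | NLoad d a => RState p.+1 (upd N d (N (N a))) X
  | NStore a t => RState p.+1 (upd N (N a) (N t)) X
  | RZero d => RState p.+1 N (upd X d 0%R)
  | ROne d => RState p.+1 N (upd X d 1%R)
  | RAdd d a b => RState p.+1 N (upd X d (X a + X b)%R)
  | RSub d a b => RState p.+1 N (upd X d (X a - X b)%R)
  | RMul d a b => RState p.+1 N (upd X d (X a * X b)%R)
  | RLoad d a => RState p.+1 N (upd X d (X (N a)))
  | RStore a t => RState p.+1 N (upd X (N a) (X t))
  | JmpZ a l => RState (if N a == 0%N then l else p.+1) N X
  | JmpLe a b l => RState (if (X a <= X b)%R then l else p.+1) N X
  | Halt => s
  end.
Proof. by rewrite /step => ->. Qed.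

Ltac stp h := let e := fresh in
  move: (seg_cons h) => {h} [e h];
  apply: runsS; rewrite (step_at (i := _) (s := RState _ _ _) e) {e} /=.

Section Compile.
Variables (R : realType) (P : program).
Notation runs := (runs P).

Lemma compile_e_runs b W (s : astate R) e t pc N X :
  wf_expr e t -> T0 <= t -> represents b W s N X -> seg P pc (compile_e e t) ->
  exists N', [/\ runs (size (compile_e e t)) (RState pc N X) (RState (pc + size (compile_e e t)) N' X),
    N' t = eval s e & same_out t N N'].
Proof.
elim: e t pc N => /=.
- move=> r t pc N /andP[hr ht] hT [_ hv _ _ _] sg.
  eexists; split; first (stp sg; stp sg; apply: runs_pc; lia).
    by rewrite /upd eqxx /= add0n hv //; case: eqP => //; rewrite /T0 in hT; lia.
  by move=> x hx; upds; lia.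
- move=> k t pc N ht hT _ sg.
  eexists; split; first (stp sg; apply: runs_pc; lia).
    by rewrite /upd eqxx.
  by move=> x hx; upds; lia.
- move=> e1 IH1 e2 IH2 t pc N /andP[w1 w2] hT rel.
  case/seg_cat => s1 /seg_cat[s2 s3].
  have [N1 [r1 v1 o1]] := IH1 _ _ _ w1 hT rel s1.
  have rel1 : represents b W s N1 X by apply: represents_same rel _ => x hx; apply: o1; lia.
  have [N2 [r2 v2 o2]] := IH2 _ _ _ w2 (leqW hT) rel1 s2.
  eexists; split.
    rewrite !size_cat; apply: runs_trans r1 _; apply: runs_trans r2 _.
    by stp s3; apply: runs_pc; rewrite /=; lia.
    by rewrite /upd eqxx v2 o2 ?v1 //; lia.
  move=> x hx; rewrite /upd; case: eqP => [?|_].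
    by have := wf_expr_lt w1; lia.
  by rewrite o2 ?o1 //; lia.
- move=> e1 IH1 e2 IH2 t pc N /andP[w1 w2] hT rel.
  case/seg_cat => s1 /seg_cat[s2 s3].
  have [N1 [r1 v1 o1]] := IH1 _ _ _ w1 hT rel s1.
  have rel1 : represents b W s N1 X by apply: represents_same rel _ => x hx; apply: o1; lia.
  have [N2 [r2 v2 o2]] := IH2 _ _ _ w2 (leqW hT) rel1 s2.
  eexists; split.
    rewrite !size_cat; apply: runs_trans r1 _; apply: runs_trans r2 _.
    by stp s3; apply: runs_pc; rewrite /=; lia.
    by rewrite /upd eqxx v2 o2 ?v1 //; lia.
  move=> x hx; rewrite /upd; case: eqP => [?|_].
    by have := wf_expr_lt w1; lia.
  by rewrite o2 ?o1 //; lia.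
- move=> k e1 IH1 t pc N /and3P[hk ht w1] hT rel.
  case/seg_cat => s1 s3.
  have [N1 [r1 v1 o1]] := IH1 _ _ _ w1 hT rel s1.
  have rel1 : represents b W s N1 X by apply: represents_same rel _ => x hx; apply: o1; lia.
  eexists; split.
    rewrite !size_cat; apply: runs_trans r1 _.
    by do 8!stp s3; apply: runs_pc; rewrite /=; lia.
    have [[h0 _] _ _ h4 _] := rel1.
    have t0 : (0 == t) = false by rewrite /T0 in hT; lia.
    have t1 : (t == t.+1) = false by lia.
    have t2 : (t.+1 == t) = false by lia.
    have t3 : (0 == t.+1) = false by lia.
    rewrite /upd !eqxx ?t0 ?t1 ?t2 ?t3 /= ?eqxx ?t0 ?t1 ?t2 ?t3 /= v1 h0 -h4 //.
    have -> : eval s e1 + eval s e1 + (eval s e1 + eval s e1) +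
      (eval s e1 + eval s e1 + (eval s e1 + eval s e1)) +
      (eval s e1 + eval s e1 + (eval s e1 + eval s e1) +
      (eval s e1 + eval s e1 + (eval s e1 + eval s e1))) + b + (KR + k) = arr_cell b k (eval s e1).
      by rewrite /arr_cell; lia.
    have -> : (arr_cell b k (eval s e1) == t) = false by rewrite /arr_cell; apply/eqP; lia.
    by have -> : (arr_cell b k (eval s e1) == t.+1) = false by rewrite /arr_cell; apply/eqP; lia.
  move=> x hx; rewrite /upd; case: eqP => [?|_]; first lia.
  case: eqP => [?|_]; first lia.
  by rewrite o1 //; lia.
Qed.

(** Realises the case distinction of [tape_cell]: the address in [t] is raised by the base when it
    is below [c], with truncated subtraction as the comparison. *)
Definition fixup (t c pc : nat) : program :=
  [:: NConst t.+1 c; NSub t.+1 t.+1 t; JmpZ t.+1 (pc + 4); NAdd t t 0].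

(** With truncated subtraction, [t - (t - (b - 1))] is the minimum of [t] and [b - 1], the clamp in
    [den]. *)
Definition tape_addr (t pc : nat) : program :=
  [:: NConst t.+1 1; NSub t.+1 0 t.+1; NSub t.+1 t t.+1; NSub t t t.+1]
  ++ fixup t KR (pc + 4).

Lemma fixup_runs t c pc N (X : nat -> R) :
  T0 <= t -> t.+1 < KR -> seg P pc (fixup t c pc) ->
  exists N', [/\ runs 4 (RState pc N X) (RState (pc + 4) N' X),
    N' t = (if N t < c then N 0 + N t else N t) & same_out t N N'].
Proof.
move=> hT ht sg.
have t1 : (t == t.+1) = false by lia.
have out v1 v2 : same_out t N (upd (upd N t.+1 v1) t.+1 v2).
  by move=> z hz; rewrite /upd; do ?(case: eqP => [?|_]; first lia).
case: (ltnP (N t) c) => hle.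
- eexists; split.
  + do 3!stp sg.
    have -> : (upd (upd N t.+1 c) t.+1
       (upd N t.+1 c t.+1 - upd N t.+1 c t) t.+1 == 0) = false.
      by rewrite /upd !eqxx t1; lia.
    by stp sg; apply: runs_pc; lia.
  + rewrite /upd eqxx t1; case: eqP => [|_]; last by lia.
    by rewrite /T0 in hT; lia.
  + by move=> z hz; rewrite /upd; do ?(case: eqP => [?|_]; first lia).
- eexists; split.
  + do 3!stp sg.
    have -> : (upd (upd N t.+1 c) t.+1
       (upd N t.+1 c t.+1 - upd N t.+1 c t) t.+1 == 0) = true.
      by rewrite /upd !eqxx t1; lia.
    by apply: runs_le; first exact: runs0.
  + by rewrite /upd t1.
  + exact: out.
Qed.

Lemma tape_addr_runs b W (s : astate R) t pc N X :
  T0 <= t -> t.+1 < KR -> represents b W s N X -> seg P pc (tape_addr t pc) ->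
  exists N', [/\ runs 8 (RState pc N X) (RState (pc + 8) N' X),
    N' t = tape_cell b (minn (N t) b.-1) & same_out t N N'].
Proof.
move=> hT ht [[h0 hb] _ _ _ _] /seg_cat[sg sg2].
have [N1 [r1 [v1 z1] o1]] : exists N1, [/\ runs 4 (RState pc N X) (RState (pc + 4) N1 X),
    N1 t = minn (N t) b.-1 /\ N1 0 = b & same_out t N N1].
  have t0 : (0 == t) = false by rewrite /T0 in hT; lia.
  have t1 : (t == t.+1) = false by lia.
  eexists; split; first by do 4!stp sg; apply: runs_pc; lia.
    by rewrite /upd ?eqxx ?t0 ?t1 /= ?eqxx ?t0 ?t1 /= h0; split => //; lia.
  by move=> z hz; rewrite /upd; do ?(case: eqP => [?|_]; first lia).
have [N2 [r2 v2 o2]] := fixup_runs N1 X hT ht sg2.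
exists N2; split; last by apply: same_out_trans o1 o2.
  by rewrite (_ : pc + 8 = pc + 4 + 4); [apply: (runs_trans r1 r2) | lia].
by rewrite v2 v1 z1 /tape_cell.
Qed.

(** An unconditional jump is a [JmpZ] on a cell just set to 0. The else branch is placed first, so
    it alone needs such a jump at its end. A loop tests its counter against cell 1, which is
    variable 0, at address [pc + 1]. *)
Fixpoint compile (c : cmd) (pc : nat) : program :=
  match c with
  | Skip => [::]
  | Seq a b => let A := compile a pc in A ++ compile b (pc + size A)
  | Assign d e => compile_e e T0 ++ [:: NConst d.+1 0; NAdd d.+1 d.+1 T0]
  | StoreArr k a b =>
      compile_e a T0 ++ [:: NAdd T0 T0 T0; NAdd T0 T0 T0; NAdd T0 T0 T0; NAdd T0 T0 T0;
        NAdd T0 T0 0; NConst T0.+1 (KR + k); NAdd T0 T0 T0.+1] ++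
      compile_e b T0.+1 ++ [:: NStore T0 T0.+1]
  | LoadTape d e =>
      let A := compile_e e T0 in
      A ++ tape_addr T0 (pc + size A) ++ [:: NLoad d.+1 T0]
  | StoreTape a b =>
      let A := compile_e a T0 in
      A ++ tape_addr T0 (pc + size A) ++ compile_e b T0.+1 ++ [:: NStore T0 T0.+1]
  | LoadReal d e =>
      let A := compile_e e T0 in
      A ++ fixup T0 4 (pc + size A) ++ [:: RLoad d T0]
  | ZeroReal d => [:: RZero d]
  | AddReal d a b => [:: RAdd d a b]
  | IfZero e a b =>
      let E := compile_e e T0 in
      let B := compile b (pc + size E + 1) in
      let p1 := pc + size E + 1 + size B + 2 in
      let A := compile a p1 in
      E ++ [:: JmpZ T0 p1] ++ B ++ [:: NConst T0 0; JmpZ T0 (p1 + size A)] ++ A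
  | IfLe x y a b =>
      let B := compile b (pc + 1) in
      let p1 := pc + 1 + size B + 2 in
      let A := compile a p1 in
      [:: JmpLe x y p1] ++ B ++ [:: NConst T0 0; JmpZ T0 (p1 + size A)] ++ A
  | For i a =>
      let A := compile a (pc + 3) in
      [:: NConst i.+1 0; NSub T0 1 i.+1; JmpZ T0 (pc + 3 + size A + 4)] ++ A ++
      [:: NConst T0 1; NAdd i.+1 i.+1 T0; NConst T0 0; JmpZ T0 (pc + 1)]
  end.

Fixpoint wf_cmd (c : cmd) : bool :=
  match c with
  | Skip => true
  | Seq a b => wf_cmd a && wf_cmd b
  | Assign d e | LoadTape d e => (d < NV) && wf_expr e T0
  | StoreArr k a b => [&& k < 16, wf_expr a T0 & wf_expr b T0.+1]
  | StoreTape a b => wf_expr a T0 && wf_expr b T0.+1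
  | LoadReal d e => (d < 4) && wf_expr e T0
  | ZeroReal d => d < 4
  | AddReal d a b => [&& d < 4, a < 4 & b < 4]
  | IfZero e a b => [&& wf_expr e T0, wf_cmd a & wf_cmd b]
  | IfLe x y a b => [&& x < 4, y < 4, wf_cmd a & wf_cmd b]
  | For i a => [&& i < NV, 0 < i, ~~ writes_var a i, ~~ writes_var a 0 & wf_cmd a]
  end.

(** Both branches of a conditional are charged. The 6 per pass of a loop are two instructions of
    test and four of increment and jump back. *)
Fixpoint steps (c : cmd) (n : nat) : nat :=
  match c with
  | Skip => 0
  | Seq a b => steps a n + steps b n
  | Assign d e => size (compile_e e T0) + 2
  | StoreArr k a b => size (compile_e a T0) + size (compile_e b T0.+1) + 8
  | LoadTape d e => size (compile_e e T0) + 9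
  | StoreTape a b => size (compile_e a T0) + size (compile_e b T0.+1) + 9
  | LoadReal d e => size (compile_e e T0) + 5
  | ZeroReal d => 1
  | AddReal d a b => 1
  | IfZero e a b => size (compile_e e T0) + 3 + steps a n + steps b n
  | IfLe x y a b => 3 + steps a n + steps b n
  | For i a => 3 + n * (steps a n + 6)
  end.

Lemma represents_set b W (s : astate R) d v N N' X :
  represents b W s N X -> N' d.+1 = v -> d < NV ->
  (forall x, x != d.+1 -> (x < T0) || (KR <= x) -> N' x = N x) ->
  represents b W (setv d v s) N' X.
Proof.
move=> [[h1 h1'] h2 h3 h4 h5] e hd h; split=> //.
- by rewrite h.
- move=> r hr /=; rewrite /upd; case: eqP => [->//|ne].
  by rewrite h ?h2 // /T0; lia.
- by move=> x hx; rewrite h ?h3 // /tape_cell; rewrite /NV /KR /T0 in hd h1' *; case: ifP => ?; lia.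
- by move=> k i hk; rewrite h ?h4 // /arr_cell; rewrite /NV /KR /T0 in hd h1' *; lia.
Qed.

Definition simulates lim (W : nat -> R) (c : cmd) : Prop := forall b pc s N X,
  b = lim -> represents b W s N X -> seg P pc (compile c pc) ->
  exists N' X', runs (steps c (vars s 0)) (RState pc N X) (RState (pc + size (compile c pc)) N' X')
    /\ represents b W (den lim W c s) N' X'.

Lemma compile_Assign lim W d e : wf_cmd (Assign d e) -> simulates lim W (Assign d e).
Proof.
move=> /= /andP[hd he] b pc s N X -> rel /=.
case/seg_cat => s1 s2.
have [N1 [r1 v1 o1]] := compile_e_runs he (leqnn _) rel s1.
eexists; eexists; split.
  apply: runs_trans r1 _; do 2!stp s2; apply: runs_pc.
  by rewrite size_cat /=; lia.
have rel1 := represents_same rel o1.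
apply: (represents_set rel1) => //.
  by rewrite /upd !eqxx v1; case: eqP => //; rewrite /T0; lia.
by move=> x hx _; rewrite /upd (negbTE hx).
Qed.

Lemma compile_StoreArr lim W k e f : wf_cmd (StoreArr k e f) -> simulates lim W (StoreArr k e f).
Proof.
move=> /= /and3P[hk he hf] b pc s N X -> rel /=.
case/seg_cat => s1 /(@seg_cat _ _ [:: _; _; _; _; _; _; _]) [s2] /seg_cat [s3 s4].
have [N1 [r1 v1 o1]] := compile_e_runs he (leqnn _) rel s1.
have rel1 := represents_same rel o1.
have [N2 [r2 v2 o2]] : exists N2, [/\ runs 7 (RState (pc + size (compile_e e T0)) N1 X)
   (RState (pc + size (compile_e e T0) + 7) N2 X),
   N2 T0 = arr_cell lim k (eval s e) & same_out T0 N1 N2].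
  have [[h0 _] _ _ _ _] := rel1.
  have hTK : T0.+1 < KR by [].
  eexists; split; first by do 7!stp s2; apply: runs_pc; lia.
    by rewrite /upd /= v1 h0 /arr_cell; lia.
  by move=> z hz; rewrite /upd; do ?(case: eqP => [?|_]; first lia).
have rel2 := represents_same rel1 o2.
have [N3 [r3 v3 o3]] := compile_e_runs hf (leqnSn _) rel2 s3.
have rel3 : represents lim W s N3 X.
  by apply: represents_same rel2 _ => x hx; apply: o3; rewrite /T0 in hx *; lia.
exists (upd N3 (arr_cell lim k (eval s e)) (eval s f)), X; split.
  rewrite (_ : size (compile_e e T0) + size (compile_e f T0.+1) + 8 = size (compile_e e T0) + (7 + (size (compile_e f T0.+1) + 1))); last lia.
  apply: runs_trans r1 _; apply: runs_trans r2 _; apply: runs_trans r3 _.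
  stp s4; rewrite v3 (_ : N3 T0 = arr_cell lim k (eval s e)); last first.
    by rewrite o3 ?v2 // /KR /T0; lia.
  by apply: runs_pc; rewrite !size_cat /= size_cat /=; lia.
have [[h0 hb] h2 h3 h4 h5] := rel3.
split=> //=.
- by rewrite /upd; case: eqP => //; rewrite /arr_cell /KR in hb *; lia.
- by move=> r hr; rewrite /upd; case: eqP => [|_]; rewrite ?h2 //; rewrite /arr_cell /KR /NV in hb hr *; lia.
- move=> x hx; rewrite /upd; case: eqP => [|_]; rewrite ?h3 //.
  by rewrite /tape_cell /arr_cell; case: ifP => ?; lia.
- move=> k' i hk'; rewrite /upd /upd_arr -h4 //.
  case: eqP => [ea|na].
    (* As [k] and [k'] are below 16, the address determines both the array and the index. *)
    have [-> ->] : k' = k /\ i = eval s e by rewrite /arr_cell in ea; lia.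
    by rewrite !eqxx.
  by case: andP => // -[/eqP ? /eqP ?]; subst.
Qed.

Lemma tape_cell_inj b x y : x < b -> y < b -> KR <= b -> tape_cell b x = tape_cell b y -> x = y.
Proof. by rewrite /tape_cell; do 2!case: ifP => ?; lia. Qed.

Lemma compile_LoadTape lim W d e : wf_cmd (LoadTape d e) -> simulates lim W (LoadTape d e).
Proof.
move=> /= /andP[hd he] b pc s N X -> rel /=.
case/seg_cat => s1 /(@seg_cat _ _ (tape_addr _ _)) [s2 s3].
have [N1 [r1 v1 o1]] := compile_e_runs he (leqnn _) rel s1.
have rel1 := represents_same rel o1.
have [N2 [r2 v2 o2]] := tape_addr_runs (leqnn _) isT rel1 s2.
have rel2 := represents_same rel1 o2.
eexists; eexists; split.
  apply: (runs_le (b1 := size (compile_e e T0) + (8 + 1))); last lia.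
  apply: runs_trans r1 _; apply: runs_trans r2 _.
  by stp s3; apply: runs_pc; rewrite size_cat /=; lia.
have [[_ hb] _ h3 _ _] := rel2.
apply: (represents_set rel2) => //.
  by rewrite /upd eqxx v2 v1 h3 //; rewrite /KR in hb; lia.
by move=> x hx _; rewrite /upd (negbTE hx).
Qed.

Lemma compile_StoreTape lim W e f : wf_cmd (StoreTape e f) -> simulates lim W (StoreTape e f).
Proof.
move=> /= /andP[he hf] b pc s N X -> rel /=.
case/seg_cat => s1 /(@seg_cat _ _ (tape_addr _ _)) [s2] /seg_cat [s3 s4].
have [N1 [r1 v1 o1]] := compile_e_runs he (leqnn _) rel s1.
have rel1 := represents_same rel o1.
have [N2 [r2 v2 o2]] := tape_addr_runs (leqnn _) isT rel1 s2.
have rel2 := represents_same rel1 o2.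
have [N3 [r3 v3 o3]] := compile_e_runs hf (leqnSn _) rel2 s3.
have rel3 : represents lim W s N3 X.
  by apply: represents_same rel2 _ => x hx; apply: o3; rewrite /T0 in hx *; lia.
exists (upd N3 (tape_cell lim (minn (eval s e) lim.-1)) (eval s f)), X; split.
  rewrite (_ : size (compile_e e T0) + size (compile_e f T0.+1) + 9 = size (compile_e e T0) + (8 + (size (compile_e f T0.+1) + 1))); last lia.
  apply: runs_trans r1 _; apply: runs_trans r2 _; apply: runs_trans r3 _.
  stp s4; rewrite v3 (_ : N3 T0 = tape_cell lim (minn (eval s e) lim.-1)); last first.
    by rewrite o3 ?v2 ?v1 // /KR /T0; lia.
  by apply: runs_pc; rewrite size_cat /= size_cat /=; lia.
have [[h0 hb] h2 h3 h4 h5] := rel3.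
set q := minn _ _; have hq : q < lim by rewrite /q /KR in hb *; lia.
have hl : KR <= tape_cell lim q by rewrite /tape_cell; case: ifP => ?; lia.
have hl2 : tape_cell lim q < lim + KR by rewrite /tape_cell; case: ifP => ?; lia.
split=> //=.
- by rewrite /upd; case: eqP => //; rewrite /KR in hl *; lia.
- by move=> r hr; rewrite /upd; case: eqP => [|_]; rewrite ?h2 //; rewrite /KR /NV in hl hr *; lia.
- move=> x hx; rewrite /upd; case: eqP => [ea|ne]; last first.
    by rewrite h3 //; case: eqP => // ex; rewrite ex in ne.
  by rewrite (tape_cell_inj hx hq hb ea) eqxx.
- by move=> k' i hk'; rewrite /upd h4 //; case: eqP => // ea; rewrite /arr_cell in ea; lia.
Qed.

Lemma compile_LoadReal lim W d e : wf_cmd (LoadReal d e) -> simulates lim W (LoadReal d e).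
Proof.
move=> /= /andP[hd he] b pc s N X -> rel /=.
case/seg_cat => s1 /(@seg_cat _ _ (fixup _ _ _)) [s2 s3].
have [N1 [r1 v1 o1]] := compile_e_runs he (leqnn _) rel s1.
have rel1 := represents_same rel o1.
have [N2 [r2 v2 o2]] := fixup_runs N1 X (leqnn _) isT s2.
have rel2 := represents_same rel1 o2.
exists N2, (upd X d (W (eval s e))); split.
  apply: (runs_le (b1 := size (compile_e e T0) + (4 + 1))); last lia.
  apply: runs_trans r1 _; apply: runs_trans r2 _.
  stp s3; have [[h0 hb] _ _ _ [_ h5]] := rel1.
  by rewrite v2 v1 h0 h5; apply: runs_pc; rewrite size_cat /=; lia.
have [[h0 hb] h2 h3 h4 [h5 h6]] := rel2.
split=> //=; split.
- by move=> r hr; rewrite /upd; case: eqP => // _; apply: h5.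
- move=> x; rewrite /upd; case: eqP => // ea; exfalso; move: ea.
  by case: ifP => ? ?; rewrite /KR in hb; lia.
Qed.

Lemma represents_xreg b W (s : astate R) d v N X :
  d < 4 -> represents b W s N X -> represents b W (AState (vars s) (arrs s) (tape s) (upd (xregs s) d v)) N (upd X d v).
Proof.
move=> hd [[h0 hb] h2 h3 h4 [h5 h6]]; split=> //; split.
- by move=> r hr; rewrite /= /upd; case: eqP => // _; apply: h5.
- move=> x; rewrite /upd; case: eqP => // ea; exfalso; move: ea.
  by case: ifP => ? ?; rewrite /KR in hb; lia.
Qed.

Lemma var0_frame lim W c (s : astate R) : ~~ writes_var c 0 -> vars (den lim W c s) 0 = vars s 0.
Proof. exact: frame_v. Qed.

Lemma compile_runs lim (W : nat -> R) c : wf_cmd c -> ~~ writes_var c 0 -> simulates lim W c.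
Proof.
elim: c.
- by move=> _ _ b pc s N X -> rel _; exists N, X; split=> //; apply: runs_pc; rewrite /=; lia.
- move=> a IHa c IHc /= /andP[oa oc]; rewrite negb_or => /andP[va vc] b pc s N X eb rel /= /seg_cat[s1 s2].
  have [N1 [X1 [r1 rel1]]] := IHa oa va _ _ _ _ _ eb rel s1.
  have [N2 [X2 [r2 rel2]]] := IHc oc vc _ _ _ _ _ eb rel1 s2.
  exists N2, X2; split=> //.
  by rewrite size_cat addnA -{2}(var0_frame lim W s va); apply: runs_trans r1 r2.
- by move=> d e h _; apply: compile_Assign.
- by move=> k e f h _; apply: compile_StoreArr.
- by move=> d e h _; apply: compile_LoadTape.
- by move=> e f h _; apply: compile_StoreTape.
- by move=> d e h _; apply: compile_LoadReal.
- move=> d /= hd _ b pc s N X eb rel /= sg; eexists; eexists; split; last by apply: represents_xreg rel.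
  by stp sg; apply: runs_pc; lia.
- move=> d a a' /= /and3P[hd ha ha'] _ b pc s N X eb rel /= sg; eexists; eexists; split; last by apply: represents_xreg rel.
  have [_ _ _ _ [h5 _]] := rel.
  by stp sg; rewrite !h5 //; apply: runs_pc; lia.
- move=> e a IHa c IHc /= /and3P[we oa oc]; rewrite negb_or => /andP[va vc] b pc s N X eb rel.
  rewrite /=; set E := compile_e e T0; set B := compile c _; set p1 := _ + 2; set A := compile a _.
  case/seg_cat => s1 /(@seg_cat _ _ [:: _]) [s2] /seg_cat[s3] /(@seg_cat _ _ [:: _; _]) [s4 s5].
  have [N1 [r1 v1 o1]] := compile_e_runs we (leqnn _) rel s1.
  have rel1 := represents_same rel o1.
  case: ifP => hz.
  + have [N2 [X2 [r2 rel2]]] := IHa oa va _ _ _ _ _ eb rel1 s5.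
    exists N2, X2; split=> //.
    apply: (runs_le (b1 := size E + (steps a (vars s 0)).+1)); last lia.
    apply: runs_trans r1 _; stp s2; rewrite v1 hz.
    have <- : p1 + size A = pc + size (E ++ [:: JmpZ T0 p1] ++ B ++ [:: NConst T0 0; JmpZ T0 (p1 + size A)] ++ A).
      by rewrite !size_cat /= /p1; lia.
    have <- : pc + size E + 1 + size B + 2 = p1 by [].
    exact: r2.
  + have [N2 [X2 [r2 rel2]]] := IHc oc vc _ _ _ _ _ eb rel1 s3.
    exists (upd N2 T0 0), X2; split; last first.
      by apply: represents_same rel2 _ => x hx; rewrite /upd; case: eqP => // ex; rewrite ex in hx.
    apply: (runs_le (b1 := size E + (steps c (vars s 0) + 2).+1)); last lia.
    apply: runs_trans r1 _; stp s2; rewrite v1 hz -(addn1 (pc + size E)).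
    apply: runs_trans r2 _; do 2!stp s4.
    by apply: runs_pc; rewrite size_cat /= size_cat /= /upd ?eqxx /= /p1; lia.
- move=> x y a IHa c IHc /= /and4P[ox oy oa oc]; rewrite negb_or => /andP[va vc] b pc s N X eb rel.
  rewrite /=; set B := compile c _; set p1 := _ + 2; set A := compile a _.
  case/(@seg_cat _ _ [:: _]) => s2 /seg_cat[s3] /(@seg_cat _ _ [:: _; _]) [s4 s5].
  have [_ _ _ _ [hx _]] := rel.
  case: ifP => hz.
  + have [N2 [X2 [r2 rel2]]] := IHa oa va _ _ _ _ _ eb rel s5.
    exists N2, X2; split=> //.
    apply: (runs_le (b1 := (steps a (vars s 0)).+1)); last lia.
    stp s2; rewrite !hx // hz.
    have <- : p1 + size A = pc + size ([:: JmpLe x y p1] ++ B ++ [:: NConst T0 0; JmpZ T0 (p1 + size A)] ++ A).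
      by rewrite !size_cat /= /p1; lia.
    exact: r2.
  + have [N2 [X2 [r2 rel2]]] := IHc oc vc _ _ _ _ _ eb rel s3.
    exists (upd N2 T0 0), X2; split; last first.
      by apply: represents_same rel2 _ => z hz'; rewrite /upd; case: eqP => // ex; rewrite ex in hz'.
    apply: (runs_le (b1 := (steps c (vars s 0) + 2).+1)); last lia.
    stp s2; rewrite !hx // hz -(addn1 pc).
    apply: runs_trans r2 _; do 2!stp s4.
    by apply: runs_pc; rewrite size_cat /= /upd ?eqxx /= /p1; lia.
- move=> i a IHa /= /and5P[hi i0 vi v0 oa] _ b pc s N X eb rel.
  rewrite /=; set A := compile a _.
  case/(@seg_cat _ _ [:: _; _; _]) => s1 /seg_cat[s2 s3].
  case: (seg_cons s1) => e1 {}s1.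
  set n := vars s 0.
  pose S j := iteri j (fun j s' => den lim W a (setv i j s')) s.
  have S0 j : vars (S j) 0 = n.
    by elim: j => //= j IH; rewrite var0_frame //= /upd; case: eqP => // E; rewrite -E in i0.
  have Si j v : vars (setv i v (S j)) i = v by rewrite /= /upd eqxx.
  have n1 s' N' X' : represents b W s' N' X' -> N' 1 = vars s' 0 by case=> _ h _ _ _; apply: h.
  (* After [j] passes the machine is again at the test, address [pc + 1], with [j] in the counter
     cell. *)
  have loop j : j <= n -> exists N' X',
    runs (j * (steps a n + 6)) (RState (pc + 1) (upd N i.+1 0) X) (RState (pc + 1) N' X')
    /\ represents b W (setv i j (S j)) N' X'.
    elim: j => [|j IH] hj.
      exists (upd N i.+1 0), X; split; first exact: runs0.
      apply: (represents_set rel) => //; first by rewrite /upd eqxx.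
      by move=> x hx _; rewrite /upd (negbTE hx).
    have [N1 [X1 [r1 rel1]]] := IH (ltnW hj).
    have [_ hv _ _ _] := rel1.
    have c1 : N1 i.+1 = j by rewrite hv // Si.
    have c0 : N1 1 = n by rewrite (n1 _ _ _ rel1) /= /upd; case: eqP => [E|_]; [rewrite -E in i0|rewrite S0].
    pose N2 := upd N1 T0 (N1 1 - N1 i.+1).
    have rel2 : represents b W (setv i j (S j)) N2 X1.
      by apply: represents_same rel1 _ => x hx; rewrite /N2 /upd; case: eqP => // E; rewrite E in hx.
    have [N3 [X3 [r3 rel3]]] := IHa oa v0 _ _ _ _ _ eb rel2 s2.
    have t0 : vars (setv i j (S j)) 0 = n.
      by rewrite /= /upd; case: eqP => [E|_]; [rewrite -E in i0|rewrite S0].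
    rewrite t0 in r3.
    have [_ hv3 _ _ _] := rel3.
    have c3 : N3 i.+1 = j by rewrite hv3 // frame_v // Si.
    eexists; exists X3; split.
      apply: (runs_le (b1 := j * (steps a n + 6) + (steps a n + 4).+2)); last lia.
      apply: runs_trans r1 _.
      move: (s1); rewrite -addn1 => s1'; do 2!stp s1'.
      have -> : (upd N1 T0 (N1 1 - N1 i.+1) T0 == 0) = false.
        by rewrite /upd eqxx c0 c1; lia.
      rewrite (_ : (pc + 1).+2 = pc + 3); last lia.
      apply: runs_trans r3 _; do 4!stp s3.
      by rewrite {1}/upd ?eqxx; apply: runs0.
    have -> : setv i j.+1 (S j.+1) = setv i j.+1 (den lim W a (setv i j (S j))) by [].
    apply: (represents_set rel3) => //.
      rewrite /upd; do ?case: eqP => //; rewrite ?c3 ?addn1 //; rewrite /T0 /NV in hi *; lia.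
    move=> x hx hT; rewrite /upd.
    do 2?(case: eqP => [E|_]; first by rewrite E in hT).
    by case: eqP => [E|//]; rewrite E eqxx in hx.
  have [N1 [X1 [r1 rel1]]] := loop n (leqnn n).
  have [_ hv _ _ _] := rel1.
  exists (upd N1 T0 0), X1; split; last first.
    by apply: represents_same rel1 _ => z hz'; rewrite /upd; case: eqP => // ex; rewrite ex in hz'.
  apply: (runs_le (b1 := (n * (steps a n + 6) + 2).+1)); last by rewrite /= -/n; lia.
  apply: runsS; rewrite (step_at (i := _) (s := RState _ _ _) e1) /= -(addn1 pc).
  apply: runs_trans r1 _.
  move: (s1); rewrite -addn1 => s1'; do 2!stp s1'.
  have -> : N1 1 - N1 i.+1 = 0.
    rewrite (n1 _ _ _ rel1) hv // Si /= /upd; case: eqP => [E|_]; first by rewrite -E in i0.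
    by rewrite S0 subnn.
  by rewrite {1}/upd eqxx /=; apply: runs_pc; rewrite size_cat /=; lia.
Qed.
End Compile.

(** Adding exponents instead of taking their maximum lets one inequality serve all branching
    commands; a loop raises the exponent by one. *)
Lemma steps_poly c : exists K d, forall n, steps c n <= K * n.+1 ^ d.
Proof.
have add K1 d1 K2 d2 n : K1 * n.+1 ^ d1 + K2 * n.+1 ^ d2 <= (K1 + K2) * n.+1 ^ (d1 + d2).
  by rewrite mulnDl !expnD leq_add // leq_mul // ?leq_pmulr ?leq_pmull // expn_gt0.
have cst K : exists K' d, forall n, K <= K' * n.+1 ^ d.
  by exists K, 0 => n; rewrite expn0 muln1.
elim: c => /=; try by move=> *; apply: cst.
- move=> a [K1 [d1 h1]] c [K2 [d2 h2]]; exists (K1 + K2), (d1 + d2) => n.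
  exact: leq_trans (leq_add (h1 n) (h2 n)) (add _ _ _ _ _).
- move=> e a [K1 [d1 h1]] c [K2 [d2 h2]]; exists (size (compile_e e T0) + 3 + (K1 + K2)), (d1 + d2) => n.
  have := leq_trans (leq_add (h1 n) (h2 n)) (add _ _ _ _ _).
  have : 0 < n.+1 ^ (d1 + d2) by rewrite expn_gt0.
  move: (n.+1 ^ _) (size _) => M z; nia.
- move=> _ _ a [K1 [d1 h1]] c [K2 [d2 h2]]; exists (3 + (K1 + K2)), (d1 + d2) => n.
  have := leq_trans (leq_add (h1 n) (h2 n)) (add _ _ _ _ _).
  have : 0 < n.+1 ^ (d1 + d2) by rewrite expn_gt0.
  move: (n.+1 ^ _) => M; nia.
- move=> _ a [K1 [d1 h1]]; exists (K1 + 9), d1.+1 => n.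
  have := h1 n; have : 0 < n.+1 ^ d1 by rewrite expn_gt0.
  rewrite expnS; move: (n.+1 ^ _) => M; nia.
Qed.

(* Initially no memory cell is free: the input may fill everything below 2m + 2.
   boot1 turns cell 1 into the pointer 2m + 2n, beyond the input, and then into
   the write pointer of the cells saved at b + x, where b = 2m + 2n + KR - 2.
   After boot, variables 0 and 1 hold n and 2m. *)
Section Boot.
Variables (R : realType) (P : program).
Notation runs := (runs P).

Definition save_code p k : program :=
  flatten [seq [:: NAdd 1 1 2; NStore 1 j] | j <- iota p k].
Definition boot1 : program :=
  [:: NAdd 1 1 1; NAdd 1 1 0; NAdd 1 1 0; NStore 1 2; NConst 2 KR; NAdd 1 1 2;
      NSub 2 1 2; NLoad 2 2; NStore 1 2; NConst 2 1].
Definition boot3 : program :=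
  [:: NConst 3 (KR - 1); NSub 3 1 3; RStore 3 0; NAdd 3 3 2; RStore 3 1; NAdd 3 3 2;
      RStore 3 2; NAdd 3 3 2; RStore 3 3; NConst 4 (KR - 1); NSub 4 1 4; NConst 5 0;
      NAdd 1 0 5; NConst 2 (KR - 2); NSub 2 4 2; NSub 2 2 0; NSub 2 2 0; NAdd 0 4 5].
Definition boot : program := boot1 ++ save_code 3 (KR - 3) ++ boot3.
(** Cell [j] is reloaded from [b + j]. Cell 0 holds [b] itself and is therefore restored last, in
    [prog_of]. *)
Definition rest_code p k : program :=
  flatten [seq [:: NConst j j; NAdd j j 0; NLoad j j] | j <- iota p k].

Lemma save_runs k p pc N (X : nat -> R) :
  N 2 = 1 -> 3 <= p -> p + k <= N 1 -> seg P pc (save_code p k) ->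
  exists N', [/\ runs (2 * k) (RState pc N X) (RState (pc + 2 * k) N' X),
    N' 1 = N 1 + k, (forall i, i < k -> N' (N 1 + i.+1) = N (p + i)) &
    forall x, x != 1 -> ~~ (N 1 < x <= N 1 + k) -> N' x = N x].
Proof.
elim: k p pc N => [|k IH] p pc N h2 hp hN sg.
  by exists N; split=> //; [apply: runs_pc; lia | rewrite addn0].
move: sg => /(@seg_cat _ _ [:: _; _]) [s1 s2].
set N1 := upd N 1 (N 1 + N 2).
set N2 := upd N1 (N1 1) (N1 p).
have e1 : N1 1 = (N 1).+1 by rewrite /N1 /upd eqxx h2 addn1.
have e2 x : x != 1 -> x != (N 1).+1 -> N2 x = N x.
  by move=> h h'; rewrite /N2 e1 /upd (negbTE h') /N1 /upd (negbTE h).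
have e21 : N2 1 = (N 1).+1.
  by rewrite /N2 e1 /upd; case: eqP => [|_]; [lia | rewrite e1].
have [|||| N' [r v o o']] := IH p.+1 (pc + 2) N2.
- by rewrite e2 //; lia.
- lia.
- by rewrite e21; lia.
- exact: s2.
exists N'; split.
- rewrite mulnS (_ : pc + (2 + 2 * k) = pc + 2 + 2 * k); last lia.
  move: r; rewrite -[2 + _]/((2 * k).+2) addn2 => r; do 2!stp s1; exact: r.
- by rewrite v e21; lia.
- case=> [_|i hi].
    rewrite addn1 o' ?e21; [|lia|lia].
    by rewrite /N2 e1 /upd eqxx addn0 /N1 /upd; case: eqP => //; lia.
  by have := o i; rewrite e21 addSnnS => -> //; rewrite addSnnS e2 //; lia.
- move=> x h1 hx; move: (o' x h1); rewrite e21 => -> ; first by rewrite e2 //; lia.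
  by lia.
Qed.

Lemma rest_runs k p pc N (X : nat -> R) :
  KR <= N 0 -> 0 < p -> p + k <= KR -> seg P pc (rest_code p k) ->
  exists N', [/\ runs (3 * k) (RState pc N X) (RState (pc + 3 * k) N' X),
    (forall j, p <= j < p + k -> N' j = N (N 0 + j)) &
    forall x, ~~ (p <= x < p + k) -> N' x = N x].
Proof.
elim: k p pc N => [|k IH] p pc N h0 hp hk sg.
  by exists N; split=> //; [apply: runs_pc; lia | move=> j; lia].
move: sg => /(@seg_cat _ _ [:: _; _; _]) [s1 s2].
set N1 := upd N p p.
set N2 := upd N1 p (N1 p + N1 0).
set N3 := upd N2 p (N2 (N2 p)).
have e x : x != p -> N3 x = N x.
  by move=> h; rewrite /N3 /N2 /N1 /upd (negbTE h).
have ep : N3 p = N (N 0 + p).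
  have a1 : N2 p = N 0 + p.
    by rewrite /N2 /N1 /upd !eqxx; case: eqP => [|_]; lia.
  rewrite /N3 {1}/upd eqxx a1 /N2 /N1 /upd; case: eqP => //; lia.
have [|||| N' [r v o]] := IH p.+1 (pc + 3) N3.
- by rewrite e //; lia.
- lia.
- lia.
- exact: s2.
have e0 : N3 0 = N 0 by rewrite e //; lia.
exists N'; split.
- rewrite mulnS (_ : pc + (3 + 3 * k) = pc + 3 + 3 * k); last lia.
  move: r; rewrite -[3 + _]/((3 * k).+3) addn3 => r; do 3!stp s1; exact: r.
- move=> j hj; case: (eqVneq j p) => [->|ne]; first by rewrite o ?ep //; lia.
  by rewrite v ?e0 ?e //; lia.
- by move=> x hx; rewrite o ?e //; lia.
Qed.

(** The pointer contains [2 * n] because [n] is positive: [2 * m + 2 * n] is then at least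
    [2 * m + 2], outside the input, which [2 * m + n] would not be for [n = 1]. *)
Lemma boot_runs n m N (X : nat -> R) :
  N 0 = n -> N 1 = m -> 0 < n -> (forall x, 2 * m + 2 <= x -> N x = 0) -> seg P 0 boot ->
  let b := 2 * m + 2 * n + KR - 2 in
  exists N' X', [/\ runs (size boot) (RState 0 N X) (RState (size boot) N' X'),
   [/\ N' 0 = b, N' 1 = n & N' 2 = 2 * m],
   (forall x, 2 <= x < 2 * m + 2 -> N' (tape_cell b x) = N x),
   (forall k i, N' (arr_cell b k i) = 0) &
   (forall x, x < n -> X' (if x < 4 then b + x else x) = X x)].
Proof.
move=> h0 h1 hn hz sg b.
have hKR : KR = 32 by [].
move: sg => /seg_cat[s1 /seg_cat[s2 s3]].
set a := 2 * m + 2 * n.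
have [N1 [r1 v10 v11 o1]] : exists N1, [/\ runs 4 (RState 0 N X) (RState 4 N1 X),
   N1 0 = n, N1 1 = a & forall x, 1 < x -> N1 x = if x == a then N 2 else N x].
  set A1 := upd (upd (upd N 1 (N 1 + N 1)) 1 (N 1 + N 1 + N 0)) 1 (N 1 + N 1 + N 0 + N 0).
  have e1 : A1 1 = a by rewrite /A1 /upd /= h0 h1 /a; lia.
  exists (upd A1 (A1 1) (A1 2)); split.
  - by do 4!stp s1; apply: runs0.
  - by rewrite e1 /upd /=; case: eqP => [|_]; [rewrite /a; lia | exact: h0].
  - by rewrite e1 /upd /=; case: eqP => [|_]; [rewrite /a; lia | exact: e1].
  - by move=> [|[|x]] // _; rewrite e1 /upd.
have {}s1 : seg P 4 (drop 4 boot1).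
  by move: s1 => /(@seg_cat _ _ (take 4 boot1) (drop 4 boot1)) [].
(* For [m = 0] and [n = 1] the cell [a] is cell 2 itself and its content is overwritten, but then
   cell 2 is not an input cell; hence the premise [0 < m]. *)
have [N2 [r2 [v20 v21 v22] v2b o2]] : exists N2, [/\ runs 6 (RState 4 N1 X) (RState 10 N2 X),
   [/\ N2 0 = n, N2 1 = b + 2 & N2 2 = 1], (0 < m -> N2 (b + 2) = N1 a) &
   forall x, 2 < x -> x != b + 2 -> N2 x = N1 x].
  set A1 := upd (upd N1 2 KR) 1 (N1 1 + KR).
  set A2 := upd A1 2 (A1 1 - A1 2).
  set A3 := upd A2 2 (A2 (A2 2)).
  set A4 := upd A3 (A3 1) (A3 2).
  have e1 : A1 1 = b + 2 by rewrite /A1 /upd /= v11 /b /a; lia.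
  have e2 : A2 2 = a by rewrite /A2 /upd /= -/(upd _ _ _) e1 /A1 /upd /= /b /a; lia.
  have e3 : A3 1 = b + 2 by [].
  have e4 : 0 < m -> A3 2 = N1 a.
    move=> hm; rewrite /A3 /upd /= e2 /A2 /upd /A1 /upd /=.
    by do 2!(case: eqP => [|_]; first by rewrite /a; lia).
  exists (upd A4 2 1); split.
  - by do 6!stp s1; apply: runs0.
  - split=> //; first by rewrite /A4 e3 /upd /=; case: eqP => [|_] //; rewrite /b; lia.
    by rewrite /A4 e3 /upd /=; case: eqP => [|_] //; rewrite /b; lia.
  - move=> hm; rewrite /A4 e3 /upd eqxx; case: eqP => [|_]; first by rewrite /b; lia.
    exact: e4.
  - move=> [|[|[|x]]] // _ hx; rewrite /A4 e3 /upd (negbTE hx) /=.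
    by rewrite /A3 /upd /= /A2 /upd /= /A1 /upd /=.
have [||N3 [r3 v31 v3 o3]] := @save_runs (KR - 3) 3 10 N2 X v22 _ _ s2.
- by [].
- by rewrite v21 /b; lia.
rewrite v21 in v31 v3 o3.
have v30 : N3 0 = n by rewrite o3 //; lia.
have v32 : N3 2 = 1 by rewrite o3 // /b; lia.
have {}s3 : seg P (10 + 2 * (KR - 3)) boot3 by exact: s3.
have ptr : N3 1 = b + KR - 1 by rewrite v31; lia.
set p3 := 10 + 2 * (KR - 3) in s3 r3.
have [N4 [X4 [r4 [v40 v41 v42] o4 x4]]] : exists N4 X4,
   [/\ runs 18 (RState p3 N3 X) (RState (p3 + 18) N4 X4),
   [/\ N4 0 = b, N4 1 = n & N4 2 = 2 * m],
   (forall x, KR <= x -> N4 x = N3 x) &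
   (forall x, x < n -> X4 (if x < 4 then b + x else x) = X x)].
  set B1 := upd N3 3 (KR - 1).
  set B2 := upd B1 3 (B1 1 - B1 3).
  set B3 := upd B2 3 (B2 3 + B2 2).
  set B4 := upd B3 3 (B3 3 + B3 2).
  set B5 := upd B4 3 (B4 3 + B4 2).
  have e2 : B2 3 = b by rewrite /B2 /upd /= /B1 /upd /= ptr; lia.
  have e3 : B3 3 = b + 1 by rewrite /B3 /upd /= e2 /B2 /upd /= /B1 /upd /= v32.
  have e4 : B4 3 = b + 2 by rewrite /B4 /upd /= e3 /B3 /B2 /upd /= /B1 /upd /= v32; lia.
  have e5 : B5 3 = b + 3 by rewrite /B5 /upd /= e4 /B4 /B3 /B2 /upd /= /B1 /upd /= v32; lia.
  set Y1 := upd X (B2 3) (X 0). set Y2 := upd Y1 (B3 3) (Y1 1).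
  set Y3 := upd Y2 (B4 3) (Y2 2). set Y4 := upd Y3 (B5 3) (Y3 3).
  set C1 := upd B5 4 (KR - 1). set C2 := upd C1 4 (C1 1 - C1 4).
  set C3 := upd C2 5 0. set C4 := upd C3 1 (C3 0 + C3 5).
  set C5 := upd C4 2 (KR - 2). set C6 := upd C5 2 (C5 4 - C5 2).
  set C7 := upd C6 2 (C6 2 - C6 0). set C8 := upd C7 2 (C7 2 - C7 0).
  have c0 x : x != 3 -> B5 x = N3 x.
    by move=> h; rewrite /B5 /B4 /B3 /B2 /B1 /upd (negbTE h).
  have c24 : C2 4 = b by rewrite /C2 /upd /= /C1 /upd /= c0 // ptr; lia.
  have c70 : C7 0 = n by rewrite /C7 /C6 /C5 /C4 /C3 /C2 /C1 /upd /= c0.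
  have c41 : C4 1 = n by rewrite /C4 /C3 /C2 /C1 /upd /= c0 // v30 addn0.
  have c62 : C6 2 = b - (KR - 2).
    by rewrite /C6 /C5 /upd /= /C4 /C3 /upd /= c24.
  have c72 : C7 2 = b - (KR - 2) - n.
    by rewrite /C7 {1}/upd /= c62 -c70 /C7 /upd.
  have c82 : C8 2 = 2 * m.
    by rewrite /C8 {1}/upd /= c72 c70 /b; lia.
  exists (upd C8 0 (C8 4 + C8 5)), Y4; split.
  - apply: (runs_trans (b1 := 9) (b2 := 9) (s2 := RState (p3 + 9) B5 Y4)).
      by do 9!stp s3; apply: runs_pc; lia.
    have {s3} : seg P (p3 + 9) (drop 9 boot3).
      by move: s3 => /(@seg_cat _ _ (take 9 boot3) (drop 9 boot3)) [].
    rewrite /C8 /C7 /C6 /C5 /C4 /C3 /C2 /C1; clearbody B5 Y4 => s3.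
    by do 9!stp s3; apply: runs_pc; lia.
  - split; rewrite /upd //=.
    by rewrite /C8 /C7 /C6 /C5 /C4 /C3 /upd /= -/(upd _ _ _) c24 addn0.
  - move=> x hx.
    have [x0 x1 x2 x3 [x4 x5]] : [/\ (x == 0) = false, (x == 1) = false, (x == 2) = false,
      (x == 3) = false & (x == 4) = false /\ (x == 5) = false] by split; lia.
    by rewrite /C8 /C7 /C6 /C5 /C4 /C3 /C2 /C1 /upd x0 x1 x2 x4 x5 c0 ?x3.
  - have y1 x : x < b -> Y4 x = X x.
      move=> hx; rewrite /Y4 /Y3 /Y2 /Y1 e2 e3 e4 e5 /upd.
      by do 4!(case: eqP => [|_]; first lia).
    have y2 x : x < b -> Y3 x = X x.
      move=> hx; rewrite /Y3 /Y2 /Y1 e2 e3 e4 /upd.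
      by do 3!(case: eqP => [|_]; first lia).
    have y3 x : x < b -> Y2 x = X x.
      move=> hx; rewrite /Y2 /Y1 e2 e3 /upd.
      by do 2!(case: eqP => [|_]; first lia).
    have y4 x : x < b -> Y1 x = X x.
      move=> hx; rewrite /Y1 e2 /upd.
      by case: eqP => [|_]; first lia.
    have hb : 30 + n <= b by rewrite /b; lia.
    move=> x hx; case: ltnP => h4; last by apply: y1; lia.
    rewrite /Y4 e5 y2; last lia.
    rewrite /Y3 e4 y3; last lia.
    rewrite /Y2 e3 y4; last lia.
    rewrite /Y1 e2 /upd.
    do 4?(case: eqP => [E|?]); first by congr X; lia.
    + by congr X; lia.
    + by congr X; lia.
    + by congr X; lia.
    + lia.
exists N4, X4; split.
- have -> : size boot = p3 + 18 by [].
  apply: (runs_le (b1 := 4 + (6 + (2 * (KR - 3) + 18)))) => //.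
  by apply: runs_trans r1 _; apply: runs_trans r2 _; apply: runs_trans r3 _.
- by [].
- move=> x hx; have hb : KR <= tape_cell b x by rewrite /tape_cell; case: ifP => ?; rewrite /b; lia.
  rewrite o4 //.
  case: (eqVneq x 2) => [->|x2].
    rewrite /tape_cell /= o3; [|rewrite /b; lia|lia].
    rewrite v2b; last lia.
    by rewrite o1 ?eqxx // /a; lia.
  rewrite /tape_cell; case: ltnP => hK.
    have := v3 (x - 3); rewrite (_ : b + 2 + (x - 3).+1 = b + x); last lia.
    rewrite (_ : 3 + (x - 3) = x); last lia.
    move=> -> //; last lia.
    rewrite o2 ?o1; [|lia|lia|rewrite /b; lia].
    by case: eqP => // E; rewrite /a in E; lia.
  rewrite o3 ?o2 ?o1; [|lia|lia|rewrite /b; lia|lia|rewrite /b; lia].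
  by case: eqP => // E; rewrite /a in E; lia.
- move=> k i; rewrite o4; last by rewrite /arr_cell; lia.
  rewrite o3; [|rewrite /arr_cell; lia|rewrite /arr_cell; lia].
  rewrite o2 ?o1; [|rewrite /arr_cell; lia|rewrite /arr_cell; lia|rewrite /arr_cell /b; lia].
  by case: eqP => [E|_]; [rewrite /a /arr_cell /b in E; lia|apply: hz; rewrite /arr_cell /b; lia].
- exact: x4.
Qed.
End Boot.

Definition prog_of (c : cmd) : program :=
  let C := compile c (size boot) in
  boot ++ C ++ rest_code 1 (KR - 1) ++ [:: NLoad 0 0; Halt].

Lemma seg_self P1 P2 P3 : seg (P1 ++ P2 ++ P3) (size P1) P2.
Proof.
move=> i hi; rewrite nth_cat ltnNge leq_addr /= addKn nth_cat hi //.
Qed.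

(** The abstract tape is specified on the edge cells only; elsewhere it may hold leftovers of the
    start-up code. *)
Lemma prog_of_correct c : wf_cmd c -> ~~ writes_var c 0 ->
  exists K d, forall (R : realType) n m N (X : nat -> R),
    N 0 = n -> N 1 = m -> 0 < n -> (forall x, 2 * m + 2 <= x -> N x = 0) ->
    exists b W s, [/\ n + 2 * m + 2 <= b,
      [/\ vars s 0 = n, vars s 1 = 2 * m, (forall k i, k < 16 -> arrs s k i = 0) &
          forall x, 2 <= x < 2 * m + 2 -> tape s x = N x],
      (forall x, x < n -> W x = X x) &
      exists s', exec (prog_of c) (K * n.+1 ^ d) (RState 0 N X) = Some s' /\
       forall x, x < b -> nmem s' x = tape (den b W c s) x].
Proof.
move=> wc vc; have [K [d hK]] := steps_poly c.
exists (size boot + 3 * KR + K), d => R n m N X hn hm n0 hz.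
set P := prog_of c.
have s1 : seg P 0 boot by apply: (@seg_self [::]).
have s2 : seg P (size boot) (compile c (size boot)) by apply: seg_self.
set p3 := size boot + size (compile c (size boot)).
have /seg_cat[s3 s4] : seg P p3 (rest_code 1 (KR - 1) ++ [:: NLoad 0 0; Halt]).
  rewrite /P /prog_of catA -[X in seg X]cats0 -!catA catA /p3 -size_cat.
  by rewrite -catA; apply: seg_self.
have [N1 [X1 [r1 [h0 h1 h2] ht ha hx]]] := boot_runs X hn hm n0 hz s1.
set b := 2 * m + 2 * n + KR - 2 in h0 ht hx.
have hKR : KR = 32 by [].
pose W x := X1 (if x < 4 then b + x else x).
pose s := AState (fun r => N1 r.+1) (fun k i => N1 (arr_cell b k i)) (fun x => N1 (tape_cell b x)) X1.
have hb : KR <= b by rewrite /b; lia.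
have rel : represents b W s N1 X1 by split.
have [N2 [X2 [r2 rel2]]] := compile_runs wc vc (erefl b) rel s2.
have [[g0 _] _ g3 _ _] := rel2.
have g0' : KR <= N2 0 by rewrite g0.
have [N3 [r3 v3 o3]] := @rest_runs _ _ (KR - 1) 1 p3 N2 X2 g0' isT isT s3.
exists b, W, s; split.
- by rewrite /b; lia.
- split=> //; first by move=> k i hk; rewrite /s /= ha.
- exact: hx.
have [e5 s5] := seg_cons s4; have [e6 _] := seg_cons s5.
set p4 := p3 + size (rest_code 1 (KR - 1)) in e5 e6.
exists (RState p4.+1 (upd N3 0 (N3 (N3 0))) X2); split.
  apply: (@exec_runs _ _ (size boot + (steps c (vars s 0) + (3 * (KR - 1) + 1)))).
  - apply: runs_trans r1 _; apply: runs_trans r2 _; apply: runs_trans r3 _.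
    apply: runsS; rewrite (step_at (i := _) (s := RState _ _ _) e5) /=; exact: runs0.
  - by move: e6; rewrite /halted [pc _]/= => ->.
  - have /= -> : vars s 0 = n by [].
    have := hK n; have : 0 < n.+1 ^ d by rewrite expn_gt0.
    move: (n.+1 ^ d) (size boot) => M z hM; nia.
move=> x hxb /=; rewrite -g3 // /tape_cell /upd; case: eqP => [->|/eqP x0].
  have e0 : N3 0 = b by rewrite o3.
  by rewrite e0 /= addn0 o3 //; lia.
case: ltnP => hK'; first by rewrite v3 ?g0 //; lia.
by rewrite o3 //; lia.
Qed.

(** * Optimality of greedy placement for a divisibility chain *)

(* A is at most B as a binary number whose digits are read at the points of D. *)
Definition lexle (D A B : nat -> bool) : Prop :=
  (forall t, D t -> A t = B t) \/
  exists s, [/\ D s, ~~ A s, B s & forall t, s < t -> D t -> A t = B t].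

Lemma last_point (P : pred nat) n :
  (forall t, t < n -> ~~ P t) \/
  exists s, [/\ s < n, P s & forall t, s < t < n -> ~~ P t].
Proof.
elim: n => [|n [h|[s [hs Ps h]]]]; first by left.
- case Pn: (P n).
    by right; exists n; split=> // t; lia.
  left=> t; rewrite ltnS leq_eqVlt => /predU1P[->|]; [by rewrite Pn | exact: h].
- case Pn: (P n).
    by right; exists n; split=> // t; lia.
  right; exists s; split=> //; first by lia.
  move=> t /andP[h1]; rewrite ltnS leq_eqVlt => /predU1P[->|h2]; [by rewrite Pn | apply: h; lia].
Qed.

Lemma lexle_low (D A B : nat -> bool) k :
  (forall t, k <= t -> D t -> A t = B t) -> (forall t, t < k -> D t -> ~~ A t) -> lexle D A B.
Proof.
move=> h1 h2; have [h|[s [hs /andP[Ds Bs] h]]] := last_point (fun t => D t && B t) k.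
- left=> t Dt; case: (leqP k t) => ht; first exact: h1.
  by have := h _ ht; rewrite Dt /= => /negbTE ->; apply/negbTE/h2.
- right; exists s; split=> //; first exact: h2.
  move=> t st Dt; case: (leqP k t) => ht; first exact: h1.
  have := h t; rewrite st ht Dt /= => /(_ isT)/negbTE ->.
  by apply/negbTE/h2.
Qed.

Section Merge.
Variables (I : finType) (P : pred I) (D : nat -> bool) (G O : I -> nat -> bool).

(** The sampled form of [fits] below: where the parent of the vertices in [P] may be put. *)
Definition feas k :=
  (forall c, P c -> ~~ G c k) /\
  forall t, k < t -> D t -> forall c c', P c -> P c' -> G c t -> G c' t -> c = c'.

(** Take the highest point [s >= ks] at which some child is set in [O] and not in [G]. If there is
    none, the children agree from [ks] up, so [ks] is feasible for [G]. If there is one, no other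
    child of [O] is set at [s], hence [s] is free in every child of [G] and feasible as well.
    Minimality then puts [kp] at or below that point, where [Ov] is set; below [kp] the set [Gv] is
    empty. *)
Lemma lexle_merge (Gv Ov : nat -> bool) kp ks :
  (forall c, P c -> lexle D (G c) (O c)) ->
  D ks -> (forall c, P c -> ~~ O c ks) ->
  (forall t, ks < t -> D t -> forall c c', P c -> P c' -> O c t -> O c' t -> c = c') ->
  feas kp -> (forall k, D k -> feas k -> kp <= k) ->
  Gv kp -> (forall t, t < kp -> D t -> ~~ Gv t) ->
  (forall t, kp < t -> D t -> Gv t = [exists c, P c && G c t]) ->
  Ov ks -> (forall t, ks < t -> D t -> Ov t = [exists c, P c && O c t]) ->
  lexle D Gv Ov.
Proof.
move=> hlex Dks hO0 hO1 hf hmin gkp glow ghi oks ohi.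
pose B c s := [/\ P c, ks <= s, D s, ~~ G c s & O c s] /\ forall t, s < t -> D t -> G c t = O c t.
have [agree|[c [s [[[Pc hs Ds Gs Os] Bs] Bmax]]]] :
  (forall c, P c -> forall t, ks <= t -> D t -> G c t = O c t) \/
  exists c s, B c s /\ forall c' , P c' -> forall t, s < t -> D t -> G c' t = O c' t.
- suff : forall l : seq I,
    (forall c, c \in l -> P c -> forall t, ks <= t -> D t -> G c t = O c t) \/
    exists c s, B c s /\ forall c', c' \in l -> P c' -> forall t, s < t -> D t -> G c' t = O c' t.
    move=> /(_ (enum I)) [h|[c [s [h1 h2]]]].
      by left=> c; apply: h; rewrite mem_enum.
    by right; exists c, s; split=> // c'; apply: h2; rewrite mem_enum.
  elim=> [|c l IH]; first by left.
  case Pc: (P c); last first.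
    case: IH => [h|[c1 [s [h1 h2]]]].
      by left=> c'; rewrite inE => /predU1P[->|]; [rewrite Pc | apply: h].
    right; exists c1, s; split=> // c'; rewrite inE => /predU1P[->|]; [by rewrite Pc | exact: h2].
  have Bc : (forall t, ks <= t -> D t -> G c t = O c t) \/ exists s, B c s.
    case: (hlex _ Pc) => [h|[s [h1 h2 h3 h4]]]; first by left=> t _; apply: h.
    case: (leqP ks s) => hs; first by right; exists s.
    by left=> t ht; apply: h4; lia.
  case: Bc IH => [hc|[s hs]] [h|[c1 [s1 [h1 h2]]]].
  + by left=> c'; rewrite inE => /predU1P[->|]; [move=> _; apply: hc | apply: h].
  + right; exists c1, s1; split=> // c'; rewrite inE => /predU1P[-> _ t ht|]; last exact: h2.
    by apply: hc; case: h1 => -[]; lia.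
  + right; exists c, s; split=> // c'; rewrite inE => /predU1P[-> _|/h hl Pc' t ht].
      by case: hs.
    by apply: hl => //; case: hs => -[]; lia.
  + case: (leqP s s1) => le.
      right; exists c1, s1; split=> // c'; rewrite inE => /predU1P[-> _ t ht|]; last exact: h2.
      by case: hs => _; apply; lia.
    right; exists c, s; split=> // c'; rewrite inE => /predU1P[-> _|cl Pc' t ht]; first by case: hs.
    by apply: h2 => //; lia.
- have fk : feas ks.
    split=> [c Pc|t ht Dt c c' Pc Pc']; first by rewrite agree ?hO0.
    by rewrite (agree _ Pc _ (ltnW ht) Dt) (agree _ Pc' _ (ltnW ht) Dt); apply: (hO1 t).
  have le := hmin _ Dks fk.
  move: le; rewrite leq_eqVlt => /predU1P[e|lt].
    apply: (@lexle_low _ _ _ ks) => [t|]; last by rewrite -e.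
    rewrite leq_eqVlt => /predU1P[<- _|ht Dt]; first by rewrite oks -e gkp.
    rewrite ghi ?e // ohi //; apply: eq_existsb => c.
    by case Pc: (P c) => //=; rewrite agree // ltnW.
  right; exists ks; split=> //.
    by rewrite ghi //; apply/existsP => -[c /andP[Pc]]; rewrite agree // (negbTE (hO0 _ Pc)).
  move=> t ht Dt; rewrite ghi //; last by lia.
  rewrite ohi //; apply: eq_existsb => c.
  by case Pc: (P c) => //=; rewrite agree // ltnW.
have hks : ks < s.
  by rewrite ltn_neqAle hs andbT; apply: contraTneq Os => <-; apply: hO0.
have Gfree c' : P c' -> ~~ G c' s.
  move=> Pc'; case: (eqVneq c' c) => [->//|ne].
  have Oc' : ~~ O c' s by apply: contra ne => h; apply/eqP; apply: (hO1 s).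
  case: (hlex _ Pc') => [h|[s' [Ds' h2 h3 h4]]]; first by rewrite h.
  case: (ltngtP s' s) => ss'.
  - by rewrite h4.
  - by have := Bmax _ Pc' _ ss' Ds'; rewrite h3 (negbTE h2).
  - by move: Oc'; rewrite -ss' h3.
have fs : feas s.
  split=> // t ht Dt c1 c2 P1 P2; rewrite (Bmax _ P1 _ ht Dt) (Bmax _ P2 _ ht Dt).
  by apply: (hO1 t) => //; lia.
have le := hmin _ Ds fs.
have Ovs : Ov s by rewrite ohi //; apply/existsP; exists c; rewrite Pc.
have above t : s < t -> D t -> Gv t = Ov t.
  move=> ht Dt; rewrite ghi ?ohi //; [|lia|lia].
  by apply: eq_existsb => c'; case Pc': (P c') => //=; rewrite Bmax.
move: le; rewrite leq_eqVlt => /predU1P[e|lt].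
  apply: (@lexle_low _ _ _ s) => [t|]; last by rewrite -e.
  rewrite leq_eqVlt => /predU1P[<- _|]; last exact: above.
  by rewrite Ovs -e gkp.
right; exists s; split=> //.
by rewrite ghi //; apply/existsP => -[c' /andP[Pc' h]]; have := Gfree _ Pc'; rewrite h.
Qed.
End Merge.

(* The intervals have lengths divisible by Yc but arbitrary offsets, whereas A is
   a union of aligned blocks, so a point of A missed by O at resolution y would
   force one more block of O above it, then another, without end. *)
Section Refine.
Variables (I : Type) (J : I -> Prop) (st en : I -> nat) (A O : nat -> bool) (Yc y M : nat).
Hypotheses (y0 : 0 < y) (Yc0 : 0 < Yc) (ydv : y %| Yc).
Hypothesis Oin : forall t, O t -> exists u, J u /\ st u <= t < en u.
Hypothesis inO : forall t u, J u -> st u <= t < en u -> O t.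
Hypothesis Jdisj : forall u u' t, J u -> J u' -> st u <= t < en u -> st u' <= t < en u' -> st u = st u' /\ en u = en u'.
Hypothesis Jlen : forall u, J u -> exists2 l, en u = st u + l * Yc & 0 < l.
Hypothesis Oub : forall t, M <= t -> ~~ O t.
Hypothesis Aub : forall t, M <= t -> ~~ A t.
Hypothesis Aal : forall t t', t %/ Yc = t' %/ Yc -> A t = A t'.
Let D z t := z %| t.+1.

Lemma lexle_refine : lexle (D Yc) A O -> lexle (D y) A O.
Proof.
move=> coarse.
have [h|[s [sM /andP[Ds /eqP ne] smax]]] := last_point (fun t => D y t && (A t != O t)) M.
  left=> t Dt; case: (ltnP t M) => ht; last by rewrite (negbTE (Oub ht)) (negbTE (Aub ht)).
  by have := h _ ht; rewrite Dt /= negbK => /eqP.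
have above t : s < t -> D y t -> A t = O t.
  move=> ht Dt; case: (ltnP t M) => hM; last by rewrite (negbTE (Oub hM)) (negbTE (Aub hM)).
  by have := smax t; rewrite ht hM Dt /= negbK => /(_ isT)/eqP.
case As: (A s) ne => ne; last first.
  by right; exists s; split; rewrite ?As //; case: (O s) ne.
have {ne} Os : ~~ O s by case: (O s) ne.
exfalso.
(* [b] is the last point of the block of [s]; the points [b + j * Yc] are sampled at the coarse
   resolution, and [A] and [O] agree there. *)
set q := s %/ Yc; pose b := q * Yc + Yc.-1.
have sdef := divn_eq s Yc; have smod : s %% Yc < Yc by rewrite ltn_mod.
have hb : s <= b < q * Yc + Yc by rewrite /b /q; lia.
have Db j : D Yc (b + j * Yc).
  have -> : b + j * Yc = ((q + j.+1) * Yc).-1 by rewrite /b; nia.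
  by rewrite /D prednK ?dvdn_mull // muln_gt0 Yc0 addnS.
have Dyb j : D y (b + j * Yc) by apply: dvdn_trans ydv (Db j).
have divb j : (b + j * Yc) %/ Yc = q + j.
  have -> : b + j * Yc = (q + j) * Yc + Yc.-1 by rewrite /b; lia.
  by rewrite divnMDl // divn_small ?addn0 //; lia.
have cagree j : A (b + j * Yc) = O (b + j * Yc).
  case: (ltngtP s (b + j * Yc)) => hs; [exact: above | lia | ].
  case: coarse => [h|[S [DS AS OS hS]]]; first by apply: h.
  apply: hS => //; rewrite -hs ltn_neqAle; apply/andP; split.
    by apply: contraNneq AS => ->.
  rewrite leqNgt; apply/negP => lt.
  have := above _ lt (dvdn_trans ydv DS); by rewrite OS (negbTE AS).
have aj j : A (s + j * Yc) = A (b + j * Yc).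
  by apply: Aal; rewrite divb /q addnC divnMDl // addnC.
have Ds' j : D y (s + j * Yc).
  by rewrite /D -addSn dvdn_addl // dvdn_mull.
(* Modulo [Yc], the interval of [O] over [b + j * Yc] starts strictly after [s]. Its length is a
   multiple of [Yc], so it reaches past [s + j.+1 * Yc]; from there the aligned block of [A] leads
   to [b + j.+1 * Yc]. For [j = M] this exceeds the bound on [O]. *)
suff claim : forall j, exists u i, [/\ J u, s + i * Yc < st u <= b + i * Yc & st u <= b + j * Yc < en u].
  have [u [i [Ju _ hu]]] := claim M.
  have := inO Ju hu; apply/negP/Oub.
  by apply: leq_trans (leq_addl _ _); apply: leq_pmulr.
elim=> [|j [u [i [Ju hi hj]]]].
  have Ob : O b by have := cagree 0; rewrite mul0n addn0 => <-; have := aj 0; rewrite !mul0n !addn0 As => <-.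
  have [u [Ju hu]] := Oin Ob.
  exists u, 0; rewrite mul0n !addn0; split=> //.
  rewrite andbC; case/andP: hu => -> hu /=.
  rewrite ltnNge; apply/negP => h.
  have : O s by apply: (inO Ju); rewrite h; lia.
  by rewrite (negbTE Os).
have [l el l0] := Jlen Ju.
have hil : j.+1 <= i + l.
  have : b + j * Yc < b + (i + l) * Yc by lia.
  by rewrite ltn_add2l ltn_mul2r Yc0.
have hsu : st u <= s + j.+1 * Yc < en u.
  apply/andP; split.
    by rewrite mulSn; lia.
  have : j.+1 * Yc <= (i + l) * Yc by rewrite leq_mul2r hil orbT.
  by lia.
have Osj : O (s + j.+1 * Yc) by apply: inO hsu.
have Obj : O (b + j.+1 * Yc).
  by rewrite -cagree -aj above // mulSn; lia.
have [u' [Ju' hu']] := Oin Obj.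
case: (leqP (st u') (s + j.+1 * Yc)) => le.
  have [e1 e2] : st u = st u' /\ en u = en u'.
    by apply: (Jdisj Ju Ju' hsu); rewrite le; lia.
  by exists u, i; split=> //; rewrite e1 e2.
by exists u', j.+1; split=> //; lia.
Qed.
End Refine.

(** * Rankings, visible vertices and greedy placement *)

Section Ranking.
Variables (V : finType) (e : rel V) (Y : V -> nat).

(** The slots of [u1] and [u2] do not meet. The additive form stays meaningful when a rank is
    smaller than its size, where subtraction would truncate. *)
Definition disj (f : V -> nat) u1 u2 := (f u1 + Y u2 <= f u2) || (f u2 + Y u1 <= f u1).

(* The third vertex of the classical vertex ranking, with sizes: some z on the
   walk lies above both ends by a full slot unless it is itself an end. *)
Definition ranking (S : pred V) (f : V -> nat) : Prop :=
  forall u p, path e u p -> all S (u :: p) -> u != last u p ->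
  exists z, [/\ z \in u :: p, z = u \/ f u + Y z <= f z
                & z = last u p \/ f (last u p) + Y z <= f z].

Variable idx : V -> nat.
(** With [idx] the position in a Prim order, [v] is the parent of [c] in the tree rooted at the
    first vertex. *)
Definition child c v := e c v && (idx v < idx c).

(** [vis f v u]: [u] lies in the subtree of [v] and strictly outranks every other vertex on the path
    from [u] up to [v]. These are the visible labels of the vertex ranking literature. *)
Inductive vis (f : V -> nat) : V -> V -> Prop :=
| vis0 v : vis f v v
| visS c v u : vis f c u -> child c v -> f v < f u -> vis f v u.

Inductive desc : V -> V -> Prop :=
| desc0 v : desc v v
| descS c v u : desc c u -> child c v -> desc v u.

Lemma vis_desc f v u : vis f v u -> desc v u.
Proof.
elim=> [w|c w u' _ h ch _]; first exact: desc0.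
exact: descS h ch.
Qed.

Definition visible_below f v u := exists2 c, child c v & vis f c u.

Lemma vis_inv f v u : vis f v u -> u = v \/ (visible_below f v u /\ f v < f u).
Proof. by case=> [w|c w u' a b lt]; [left | right; split=> //; exists c]. Qed.

Lemma desc_idx v u : desc v u -> idx v <= idx u.
Proof. by elim=> // c w u' _ h /andP[_ h']; lia. Qed.

(** [q] is the bottom of the slot of [v]. Visible vertices of rank at most [q] become hidden. Those
    above must clear the slot and also each other, since [v], lying lower, does not separate
    them. *)
Definition fits (h : V -> nat) v q :=
  forall u, visible_below h v u -> q < h u ->
    q + Y v <= h u - Y u /\
    forall u2, visible_below h v u2 -> u2 != u -> disj h u u2.

Definition greedy_at (h : V -> nat) v :=
  [/\ Y v <= h v, Y v %| h v, fits h v (h v - Y v) & forall q, fits h v q -> h v - Y v <= q].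

Definition greedy (h : V -> nat) := forall v, greedy_at h v.

Lemma vis_ext h h' v u : (forall z, idx v <= idx z -> h z = h' z) -> vis h v u -> vis h' v u.
Proof.
move=> E H; elim: H E => [w _|c w u' vu IH ch lt E]; first exact: vis0.
have /andP[_ lt'] := ch; have := desc_idx (vis_desc vu) => lu.
apply: visS ch _; first by apply: IH => z hz; apply: E; lia.
by rewrite -!E //; lia.
Qed.

Lemma visible_ext h h' v u : (forall z, idx v < idx z -> h z = h' z) ->
  visible_below h v u -> visible_below h' v u.
Proof.
move=> E [c ch vu]; exists c => //; apply: vis_ext vu => z hz; apply: E.
by case/andP: ch; lia.
Qed.

Lemma visible_idx h v u : visible_below h v u -> idx v < idx u.
Proof. by move=> [c /andP[_ lt] /vis_desc/desc_idx]; lia. Qed.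

Lemma fits_ext h h' v p : (forall z, idx v < idx z -> h z = h' z) -> fits h v p -> fits h' v p.
Proof.
move=> E f u hu lt.
have hu0 : visible_below h v u by apply: visible_ext hu => z hz; rewrite E.
have lu := visible_idx hu0; have [|h1 h2] := f u hu0; first by rewrite E.
rewrite -E //; split=> // u2 hu2 ne.
have hu20 : visible_below h v u2 by apply: visible_ext hu2 => z hz; rewrite E.
by have := h2 _ hu20 ne; rewrite /disj -!E //; apply: visible_idx hu20.
Qed.

Definition occ f v t := `[< exists2 u, vis f v u & f u - Y u <= t < f u >].

Lemma occP f v t : reflect (exists2 u, vis f v u & f u - Y u <= t < f u) (occ f v t).
Proof. exact: asboolP. Qed.

Lemma block_eq d a b t t' : d %| a -> d %| b -> t %/ d = t' %/ d ->
  a <= t < b -> a <= t' < b.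
Proof.
case: (posnP d) => [->|d0]; first by rewrite !dvd0n => /eqP-> /eqP->; rewrite ltn0 andbF.
move=> /dvdnP[a' ->] /dvdnP[b' ->] e1.
by rewrite -!leq_divRL // -!ltn_divLR // e1.
Qed.

Hypothesis e_sym : symmetric e.
Hypothesis par_uniq : forall c z1 z2, child c z1 -> child c z2 -> z1 = z2.
Hypothesis Y_gt0 : forall v, 0 < Y v.
Hypothesis Y_dvd : forall c v, child c v -> Y v %| Y c.

Lemma desc_up b c a : desc b c -> child c a -> b = c \/ desc b a.
Proof.
elim=> {b c} [v|c v u _ IH ch] ha; first by left.
right; case: (IH ha) => [eq|h]; last exact: descS h ch.
by rewrite -eq in ha; rewrite (par_uniq ch ha); apply: desc0.
Qed.

Lemma desc_cmp a b u : desc a u -> desc b u -> desc a b \/ desc b a.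
Proof.
move=> h; elim: h b => {a u} [v|c v u hc IH ch] b hb; first by right.
case: (IH _ hb) => h; first by left; apply: descS h ch.
case: (desc_up h ch) => [->|h']; last by right.
by left; apply: descS ch; apply: desc0.
Qed.

Lemma child_uniq v c1 c2 u : child c1 v -> child c2 v -> desc c1 u -> desc c2 u -> c1 = c2.
Proof.
move=> h1 h2 d1 d2; case: (desc_cmp d1 d2) => d.
  case: (desc_up d h2) => // /desc_idx; case/andP: h1; lia.
case: (desc_up d h1) => // /desc_idx; case/andP: h2; lia.
Qed.

Lemma desc_dvd v u : desc v u -> Y v %| Y u.
Proof. by elim=> // c w u' _ h /Y_dvd h'; apply: dvdn_trans h' h. Qed.

Lemma disjN f u1 u2 t : f u1 - Y u1 <= t < f u1 -> f u2 - Y u2 <= t < f u2 ->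
  disj f u1 u2 -> False.
Proof. rewrite /disj; lia. Qed.

Lemma desc_ext a v u : desc a v -> child u v -> desc a u.
Proof.
move=> d; elim: d u => [w|c w v' _ IH ch] u cu; first by apply: descS cu; apply: desc0.
by apply: descS ch; apply: IH.
Qed.

Lemma rev_walk x p : path e x p ->
  exists p', [/\ path e (last x p) p', last (last x p) p' = x & last x p :: p' =i x :: p].
Proof.
move=> hp; exists (rev (belast x p)); split.
- by rewrite rev_path (@eq_path _ _ e) // => y z; rewrite e_sym.
- by case: (p) => // y p'; rewrite /= rev_cons last_rcons.
- by move=> z; rewrite -rev_rcons -lastI mem_rev.
Qed.

Lemma walk_to x v p : path e x p -> v \in p -> x != v ->
  exists p1, [/\ path e x p1, e (last x p1) v, v \notin x :: p1 & {subset p1 <= p}].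
Proof.
elim: p x => [//|y p IH] x /= /andP[exy hp] vp ne.
case: (eqVneq y v) => [eyv|nyv].
  by subst v; exists [::]; split=> //; rewrite inE eq_sym.
move: vp; rewrite inE eq_sym (negbTE nyv) /= => vp.
have [p1 [h1 h2 h3 h4]] := IH y hp vp nyv.
exists (y :: p1); split=> //=; first by rewrite exy.
  by rewrite inE negb_or h3 eq_sym ne.
by move=> z; rewrite !inE => /predU1P[->|/h4 ->]; rewrite ?eqxx ?orbT.
Qed.

Lemma sub_walk x z p : path e x p -> z \in x :: p ->
  exists p1, [/\ path e x p1, last x p1 = z & {subset p1 <= p}].
Proof.
elim: p x => [|y p IH] x /=; first by rewrite inE => _ /eqP->; exists [::].
move=> /andP[exy hp]; rewrite inE => /predU1P[->|zp]; first by exists [::].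
have [p1 [h1 h2 h4]] := IH y hp zp.
exists (y :: p1); split=> //=; first by rewrite exy.
by move=> w; rewrite !inE => /predU1P[->|/h4 ->]; rewrite ?eqxx ?orbT.
Qed.

Section Ranked.
Variable g : V -> nat.
Hypothesis g_rank : ranking predT g.

Lemma vis_walk v u : vis g v u ->
  exists p, [/\ path e u p, last u p = v & all (fun z => g z < g u) p].
Proof.
elim=> [w|c w u' _ [p [h1 h2 h3]] /andP[ch _] lt]; first by exists [::].
exists (rcons p w); rewrite rcons_path last_rcons h1 h2 ch; split=> //.
by rewrite all_rcons lt.
Qed.

(** No inner vertex is above both ends, so the vertex promised by [ranking] must be one of the
    ends. *)
Lemma rank_disj u p : path e u p -> u != last u p ->
  (forall z, z \in p -> z != last u p -> (g z < g u) || (g z < g (last u p))) ->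
  disj g u (last u p).
Proof.
move=> hp ne h; have [//|z [zp h1 h2]] := g_rank hp _ ne.
  exact: all_predT.
case: (eqVneq z (last u p)) => [zl|zl].
  by case: h1 => [zu|h1]; [rewrite -zl zu eqxx in ne | rewrite zl in h1; rewrite /disj h1].
case: h2 => // [zl'|h2]; first by rewrite zl' eqxx in zl.
case: h1 => [zu|h1]; first by rewrite zu in h2; rewrite /disj h2 orbT.
have : z \in p.
  move: zp; rewrite inE => /predU1P[zu|//].
  by move: h1; rewrite zu; have := Y_gt0 u; lia.
move=> /h /(_ zl); have := Y_gt0 z; lia.
Qed.

Lemma vis_rank_disj v u1 u2 : vis g v u1 -> vis g v u2 -> u1 != u2 -> disj g u1 u2.
Proof.
move=> /vis_walk[p1 [h1 l1 a1]] /vis_walk[p2 [h2 l2 a2]] ne.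
have [p [h l m]] := rev_walk h2; rewrite l2 in h l m.
have a : all (fun z => (z == u2) || (g z < g u2)) (v :: p).
  by apply/allP => z; rewrite m inE => /predU1P[->|/(allP a2)->]; rewrite ?eqxx ?orbT.
have := @rank_disj u1 (p1 ++ p); rewrite cat_path h1 l1 h last_cat l1 l; apply=> // z.
rewrite mem_cat => /orP[/(allP a1)->//|zp] zu.
by have /allP/(_ z) := a; rewrite inE zp orbT (negbTE zu) /= => /(_ isT) ->; rewrite orbT.
Qed.

Lemma vis_child_disj c v u : child c v -> vis g c u -> disj g u v.
Proof.
move=> ch vu; have du := desc_idx (vis_desc vu).
case/andP: ch => ecv lt.
have [p [h l a]] := vis_walk vu.
have := @rank_disj u (rcons p v); rewrite rcons_path h l ecv last_rcons; apply=> //.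
  by apply: contraTneq lt => uv; rewrite -leqNgt -uv.
move=> z; rewrite mem_rcons inE => /predU1P[->|/(allP a)->//]; by rewrite eqxx.
Qed.
End Ranked.

Section Optimal.
Variables (h g : V -> nat).
Hypothesis h_greedy : greedy h.
Hypothesis g_rank : ranking predT g.
Hypothesis g_ge : forall v, Y v <= g v.

Lemma greedy_disj v u1 u2 : vis h v u1 -> vis h v u2 -> u1 != u2 -> disj h u1 u2.
Proof.
have [hY _ hf _] := h_greedy v.
have Yv := Y_gt0 v.
move=> /vis_inv[->|[b1 l1]] /vis_inv[->|[b2 l2]] ne; first by rewrite eqxx in ne.
- have [|hB _] := hf u2 b2; rewrite /disj; lia.
- have [|hB _] := hf u1 b1; rewrite /disj; lia.
- have [|_ hB] := hf u1 b1; first lia.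
  by apply: hB; rewrite // eq_sym.
Qed.

Lemma vis_dvd v u : vis h v u -> [/\ Y v %| h u, Y v %| Y u & Y v %| h u - Y u].
Proof.
move=> /vis_desc/desc_dvd d; have [_ d' _ _] := h_greedy u.
have d2 := dvdn_trans d d'; split=> //; exact: dvdn_sub.
Qed.

(** Induction from the leaves: each child [c] is compared at resolution [Y c], [lexle_refine] passes
    to the finer [Y v], and [lexle_merge] adds [v], with greediness supplying the minimality of its
    point. *)
Lemma lexle_vis v : lexle (fun t => Y v %| t.+1) (occ h v) (occ g v).
Proof.
pose N := (\max_u idx u).+1; have idxN u : idx u < N by rewrite ltnS leq_bigmax.
have [k] := ubnP (N - idx v); elim: k v => // k IH v hk.
set y := Y v; have y0 : 0 < y := Y_gt0 v.
have [hY hd hfit hmin] := h_greedy v.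
pose D t := y %| t.+1.
pose M := \max_u maxn (h u) (g u).
have hM u : h u <= M by apply: leq_trans (leq_maxl _ (g u)) _; apply: (leq_bigmax (F := fun u => maxn (h u) (g u))).
have gM u : g u <= M by apply: leq_trans (leq_maxr (h u) _) _; apply: (leq_bigmax (F := fun u => maxn (h u) (g u))).
pose P := [pred c | child c v].
have fine c : P c -> lexle D (occ h c) (occ g c).
  move=> Pc.
  apply: (@lexle_refine V (vis g c) (fun u => g u - Y u) g _ _ (Y c) y M) => //.
  - exact: Y_dvd.
  - by move=> t /occP[u]; exists u.
  - by move=> t u Ju hu; apply/occP; exists u.
  - move=> u u' t Ju Ju' hu hu'; case: (eqVneq u u') => [->//|ne].
    by case: (disjN hu hu'); apply: vis_rank_disj Ju Ju' ne.
  - move=> u /vis_desc/desc_dvd/dvdnP[l el]; exists l.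
      by rewrite -el subnK.
    by have := Y_gt0 u; rewrite el muln_gt0 => /andP[].
  - by move=> t ht; apply/occP => -[u _]; have := gM u; lia.
  - by move=> t ht; apply/occP => -[u _]; have := hM u; lia.
  - move=> t t' ett; apply/occP/occP => -[u vu hu]; exists u => //;
      have [d1 _ d2] := vis_dvd vu; apply: block_eq d2 d1 _ hu => //.
  - apply: IH; case/andP: Pc => _ lt; have := idxN c; lia.
(* The slot of [v] in [g] has length [y], so it contains exactly one sampled point, namely this
   one. *)
pose ks := (g v %/ y * y).-1.
have gy := g_ge v; rewrite -/y in gy.
have q0 : 0 < g v %/ y * y by rewrite muln_gt0 y0 divn_gt0 // gy.
have ksS : ks.+1 = g v %/ y * y by rewrite /ks prednK.
have gdef := divn_eq (g v) y; have gmod : g v %% y < y by rewrite ltn_mod.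
have ksin : g v - y <= ks < g v by lia.
have Dks : D ks by rewrite /D ksS dvdn_mull.
clear gdef gmod ksS q0; clearbody ks.
have Dgt t t' : D t -> D t' -> t < t' -> t + y <= t'.
  rewrite /D => /dvdnP[a ea] /dvdnP[b eb] lt.
  have lt' : a * y < b * y by rewrite -ea -eb.
  move: lt'; rewrite ltn_mul2r y0 /= => ab.
  have : a.+1 * y <= b * y by rewrite leq_mul2r ab orbT.
  by rewrite mulSn -ea -eb; lia.
have gabove c u t : P c -> vis g c u -> g u - Y u <= t < g u -> ks < t -> g v < g u.
  move=> Pc vu hu ht; have := vis_child_disj g_rank Pc vu; rewrite /disj.
  by have := Y_gt0 u; rewrite -/y; lia.
have Dkp : D (h v).-1 by rewrite /D prednK // ; lia.
(* Overlapping slots aligned at multiples of [y] share a whole block, hence its last point, which is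
   sampled. Thus failures of [disj] show up as collisions in [feas]. *)
have overlap c c' u u' : P c -> P c' -> vis h c u -> vis h c' u' -> ~~ disj h u u' ->
   exists t, [/\ D t, h u - Y u <= t < h u & h u' - Y u' <= t < h u'].
  move=> Pc Pc' vu vu' nd.
  have yu : y %| h u /\ y %| h u - Y u.
    by have [d1 _ d3] := vis_dvd vu; have dc := Y_dvd Pc; split; apply: dvdn_trans dc _.
  have yu' : y %| h u' /\ y %| h u' - Y u'.
    by have [d1 _ d3] := vis_dvd vu'; have dc := Y_dvd Pc'; split; apply: dvdn_trans dc _.
  pose x := maxn (h u - Y u) (h u' - Y u').
  have [hu _ _ _] := h_greedy u; have [hu' _ _ _] := h_greedy u'.
  have Yu := Y_gt0 u; have Yu' := Y_gt0 u'.
  have [hx1 hx2] : h u - Y u <= x < h u /\ h u' - Y u' <= x < h u'.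
    by move: nd; rewrite /disj /x; clear -hu hu' Yu Yu'; lia.
  exists (x %/ y * y + y.-1); split.
  - by rewrite /D -addnS prednK // -mulSnr dvdn_mull.
  - case: yu => d1 d2; apply: (block_eq d2 d1 (t := x)); last exact: hx1.
    by rewrite divnMDl // [y.-1 %/ y]divn_small ?addn0 // prednK.
  - case: yu' => d1 d2; apply: (block_eq d2 d1 (t := x)); last exact: hx2.
    by rewrite divnMDl // [y.-1 %/ y]divn_small ?addn0 // prednK.
apply: (@lexle_merge V P D (occ h) (occ g) _ _ (h v).-1 ks) => //.
- move=> c Pc; apply/occP => -[u vu hu].
  exact: (disjN hu ksin (vis_child_disj g_rank Pc vu)).
- move=> t ht Dt c c' Pc Pc' /occP[u vu hu] /occP[u' vu' hu'].
  have gu := gabove _ _ _ Pc vu hu ht; have gu' := gabove _ _ _ Pc' vu' hu' ht.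
  case: (eqVneq u u') => [eu|ne].
    by apply: (child_uniq (u := u)) Pc Pc' (vis_desc vu) _; rewrite eu; apply: vis_desc vu'.
  case: (disjN hu hu'); apply: (vis_rank_disj g_rank (v := v)) ne.
    exact: visS vu Pc gu.
  exact: visS vu' Pc' gu'.
- split=> [c Pc|t ht Dt c c' Pc Pc' /occP[u vu hu] /occP[u' vu' hu']].
    apply/occP => -[u vu hu]; have [||hB _] := hfit u; [by exists c|lia|lia].
  case: (eqVneq u u') => [eu|ne].
    by apply: (child_uniq (u := u)) Pc Pc' (vis_desc vu) _; rewrite eu; apply: vis_desc vu'.
  have [||_ /(_ u')] := hfit u; [by exists c|lia|].
  rewrite eq_sym ne => hdj; case: (disjN hu hu'); apply: hdj => //; by exists c'.
(* A feasible sampled point [t] is the last point of the slot that starts at [t.+1 - y]; if that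
   slot fits, minimality of [h v] applies. *)
- move=> t Dt [f1 f2].
  have yt : y <= t.+1 by apply: dvdn_leq.
  suff /hmin : fits h v (t.+1 - y) by clear -yt y0 hY; rewrite -/y; lia.
  move=> u [c Pc vu] lt.
  have [d1 _ d3] := vis_dvd vu; have dc := Y_dvd Pc.
  have tu : t.+1 - y + y <= h u - Y u.
    rewrite leqNgt; apply/negP => lt2; have /negP := f1 _ Pc; apply.
    apply/occP; exists u => //; apply/andP; split; first by clear -lt2 yt; lia.
    have yh : y %| h u by apply: dvdn_trans dc d1.
    have yq : y %| t.+1 - y by rewrite dvdn_sub.
    case/dvdnP: yh lt => a ->; case/dvdnP: yq => b eb; rewrite eb ltn_mul2r y0 /= => ab.
    have : b.+1 * y <= a * y by rewrite leq_mul2r ab orbT.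
    by rewrite mulSn -eb; clear -yt; lia.
  split=> // u2 [c2 Pc2 vu2] ne.
  apply: contraT => nd.
  have [t' [Dt' h1 h2]] := overlap _ _ _ _ Pc Pc2 vu vu2 nd.
  have ec : c = c2.
    apply: (f2 t') => //; first by clear -tu yt h1; lia.
      by apply/occP; exists u.
    by apply/occP; exists u2.
  by rewrite -ec in vu2; rewrite (greedy_disj vu vu2) // eq_sym in nd.
- by apply/occP; exists v; [exact: vis0 | rewrite -/y; lia].
- move=> t ht Dt; apply/occP => -[u /vis_inv[->|[bu lt]] hu].
    by have := Dgt _ _ Dt Dkp ht; rewrite -/y in hu; lia.
  by have [|hB _] := hfit u bu; [clear -lt | clear -lt hu hY ht hB]; lia.
- move=> t ht Dt; apply/occP/existsP => [[u /vis_inv[->|[[c Pc vu] lt]] hu]|[c /andP[Pc /occP[u vu hu]]]].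
  + by lia.
  + by exists c; rewrite [P c]Pc; apply/occP; exists u.
  + by exists u => //; apply: visS vu Pc _; lia.
- by apply/occP; exists v => //; exact: vis0.
- move=> t ht Dt; apply/occP/existsP => [[u /vis_inv[->|[[c Pc vu] lt]] hu]|[c /andP[Pc /occP[u vu hu]]]].
  + by have := Dgt _ _ Dks Dt ht; rewrite -/y in hu; lia.
  + by exists c; rewrite [P c]Pc; apply/occP; exists u.
  + by exists u => //; exact: (visS vu Pc (gabove _ _ _ Pc vu hu ht)).
Qed.

Lemma vis_top v u : desc v u -> exists2 u', vis h v u' & h u <= h u'.
Proof.
elim=> [w|c w u0 _ [u' vu' le] ch]; first by exists w => //; exact: vis0.
case: (ltnP (h w) (h u')) => lt; first by exists u' => //; apply: visS ch lt.
by exists w; [exact: vis0 | exact: leq_trans le lt].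
Qed.

(** A vertex of rank at least [h u] is visible from the root. The last point of its slot is sampled,
    so by the lexicographic comparison [g] occupies some point at least as high. *)
Lemma greedy_opt r C : (forall c, c != r -> exists v, child c v) ->
  (forall v, g v <= C) -> forall u, h u <= C.
Proof.
move=> par gC u.
have du : desc r u.
  have [k] := ubnP (idx u); elim: k u => // k IH u hk.
  case: (eqVneq u r) => [->|ne]; first exact: desc0.
  have [v cv] := par _ ne.
  have : desc r v by apply: IH; case/andP: cv; lia.
  by move=> d; apply: desc_ext d cv.
have [u' vu le] := vis_top du.
apply: leq_trans le _.
have [hY hd _ _] := h_greedy u'; have Y0 := Y_gt0 u'.
have occh : occ h r (h u').-1 by apply/occP; exists u' => //; lia.
have Dh : Y r %| (h u').-1.+1 by rewrite prednK; [have [] := vis_dvd vu | lia].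
have [t ht /occP[u2 _ hu2]] : exists2 t, (h u').-1 <= t & occ g r t.
  case: (lexle_vis r) => [eq|[s [Ds hs gs above]]].
    by exists (h u').-1 => //; rewrite -eq.
  case: (leqP (h u').-1 s) => le2; first by exists s.
  by exists (h u').-1 => //; rewrite -above.
have := gC u2; lia.
Qed.

Hypothesis idx_inj : injective idx.

Lemma walk_vis x c v p : child c v -> path e x p -> last x p = c ->
  idx v < idx x -> (forall z, z \in p -> h z < h x /\ idx v < idx z) -> vis h c x.
Proof.
move=> cv hp lp hx.
(* [a] is the vertex nearest to the root that the walk has met so far. As [x] outranks the whole
   walk, [x] stays visible from [a] when [a] moves up to its parent. *)
suff main cur : path e cur p -> (exists a, [/\ vis h a x, desc a cur & idx v < idx a]) ->
    (forall z, z \in p -> h z < h x /\ idx v < idx z) ->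
    exists a, [/\ vis h a x, desc a (last cur p) & idx v < idx a].
  move=> hz; have [|a [va da lt]] := main x hp _ hz.
    by exists x; split=> //; [exact: vis0 | exact: desc0].
  rewrite lp in da; case: (desc_up da cv) => [<-//|/desc_idx]; lia.
elim: p cur {hp lp} => [|z p IH] cur /=; first by move=> _ [a ?] _; exists a.
move=> /andP[ecz hp] [a [va da lt]] hz; apply: IH => //; last first.
  by move=> w wp; apply: hz; rewrite inE wp orbT.
have [hzx lz] := hz z (mem_head _ _).
case: (ltngtP (idx z) (idx cur)) => [lt2|lt2|/idx_inj eq].
- have ch : child cur z by rewrite /child ecz.
  case: (desc_up da ch) => [eq|d]; last by exists a.
  by exists z; split=> //; [apply: visS va _ hzx; rewrite eq | exact: desc0].
- by exists a; split=> //; apply: desc_ext da _; rewrite /child e_sym ecz.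
- by exists a; rewrite eq.
Qed.

Lemma walk_top x c v p : child c v -> path e x p -> last x p = c ->
  (forall z, z \in x :: p -> idx v < idx z) ->
  exists z, [/\ z \in x :: p, vis h c z & forall y, y \in x :: p -> h y <= h z].
Proof.
move=> cv; elim: p x => [|y p IH] x /=.
  by move=> _ -> _; exists c; split; [exact: mem_head | exact: vis0 | move=> y; rewrite inE => /eqP->].
move=> /andP[exy hp] lp hz.
have [z [zp vz zmax]] := IH y hp lp (fun w wp => hz w (mem_behead (s := x :: y :: p) wp)).
case: (leqP (h x) (h z)) => le.
  exists z; split=> //; first by rewrite inE zp orbT.
  by move=> w; rewrite inE => /predU1P[->//|/zmax].
exists x; split; first exact: mem_head.
  apply: (walk_vis (p := y :: p) cv) => //=; first by rewrite exy.
    by apply: hz; exact: mem_head.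
  move=> w wp; split; last by apply: hz; rewrite inE wp orbT.
  exact: leq_ltn_trans (zmax _ wp) le.
by move=> w; rewrite inE => /predU1P[->//|/zmax le2]; apply: leq_trans le2 (ltnW le).
Qed.

(** This is what makes the greedy ranks payable: a highest vertex of a walk is above the other end
    by its full size. The induction raises a lower bound [k] on the indices along the walk. The
    vertex [v] of index [k], if met, is nearest to the root; cut at [v], the walk leaves parts below
    children of [v], and [fits] at [v] compares the visible tops of these parts. *)
Lemma greedy_sep m p : path e m p -> m != last m p ->
  (forall z, z \in m :: p -> h z <= h m) -> h (last m p) + Y m <= h m.
Proof.
suff main n k : k + n = (\max_u idx u).+1 -> forall m p, path e m p ->
    (forall z, z \in m :: p -> k <= idx z /\ h z <= h m) ->
    m != last m p -> h (last m p) + Y m <= h m.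
  by move=> hp ne hz; apply: (@main (\max_u idx u).+1 0) => // z zp; split=> //; apply: hz.
elim: n k => [|n IH] k hk {}m {}p hp hz ne.
  have [] := hz m (mem_head _ _); have := leq_bigmax (F := idx) m; lia.
have {}IH := IH k.+1; rewrite addSnnS in IH; have {}IH := IH hk.
set u := last m p in ne *.
have um : u \in m :: p by exact: mem_last.
case: (boolP (has (fun z => idx z == k) (m :: p))) => [/hasP[v vp /eqP iv]|/hasPn no]; last first.
  apply: IH => // z zp; have [h1 h2] := hz _ zp; split=> //.
  by rewrite ltn_neqAle h1 eq_sym no.
have above z : z \in m :: p -> z != v -> idx v < idx z.
  move=> zp nz; have [h1 _] := hz _ zp; rewrite iv ltn_neqAle h1 andbT -iv.
  by apply: contra nz => /eqP/idx_inj->.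
have [hYv _ hfit _] := h_greedy v; have Yv := Y_gt0 v; have Ym := Y_gt0 m.
have [hYm _ _ _] := h_greedy m.
have top x q : path e x q -> v \in q -> x != v -> {subset x :: q <= m :: p} ->
    exists c p1, [/\ child c v, path e x p1, last x p1 = c,
      (forall z, z \in x :: p1 -> z \in m :: p /\ idx v < idx z)
      & exists z, [/\ z \in x :: p1, vis h c z & forall y, y \in x :: p1 -> h y <= h z]].
  move=> hq vq nx sub; have [p1 [h1 h2 h3 h4]] := walk_to hq vq nx.
  have in1 z : z \in x :: p1 -> z \in m :: p /\ idx v < idx z.
    move=> zp; have zm : z \in m :: p.
      apply: sub; move: zp; rewrite !inE => /predU1P[->|/h4 ->]; by rewrite ?eqxx ?orbT.
    split=> //; apply: above => //; by apply: contraNneq h3 => <-.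
  have cv : child (last x p1) v.
    by rewrite /child h2; case: (in1 (last x p1) (mem_last _ _)).
  exists (last x p1), p1; split=> //.
  by apply: (walk_top cv) => // z /in1[].
(* [m] is itself the visible top of its part: another top [z] has [h m <= h z], whereas the
   induction hypothesis puts [h z] at least [Y m] below [h m]. *)
have hmv : m != v -> exists2 c, child c v & vis h c m.
  move=> nm; have vp' : v \in p by move: vp; rewrite inE eq_sym (negbTE nm).
  have [c [p1 [cv h1 h2 h3 [z [zp vz zmax]]]]] := top m p hp vp' nm (fun _ => id).
  exists c => //; suff -> : m = z by [].
  apply/eqP; apply: contraT => nz.
  have [p2 [g1 g2 g3]] := sub_walk h1 zp.
  have : h (last m p2) + Y m <= h m.
    apply: IH => //; last by rewrite g2.
    move=> w wp; have : w \in m :: p1.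
      by move: wp; rewrite !inE => /predU1P[->|/g3->]; rewrite ?eqxx ?orbT.
    by case/h3 => wm; rewrite iv => lw; split=> //; case: (hz _ wm).
  rewrite g2; have := zmax m (mem_head _ _); clear -Ym; lia.
have [p' [r1 r2 r3]] := rev_walk hp; rewrite -/u in r1 r2 r3.
have huv : u != v -> exists c p1, [/\ child c v, path e u p1, last u p1 = c,
      (forall z, z \in u :: p1 -> z \in m :: p /\ idx v < idx z)
      & exists z, [/\ z \in u :: p1, vis h c z & forall y, y \in u :: p1 -> h y <= h z]].
  move=> nu; apply: (top u p') => //; last by move=> z; rewrite r3.
  by move: vp; rewrite -r3 inE eq_sym (negbTE nu).
case: (eqVneq m v) => [emv|nmv].
  have nuv : u != v by rewrite -emv eq_sym.
  have [c [p1 [cv _ _ h3 [z [zp vz zmax]]]]] := huv nuv.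
  have hzm : h z <= h m by case: (h3 _ zp) => zm _; case: (hz _ zm).
  have huz := zmax u (mem_head _ _).
  have := hfit z; case: (ltnP (h v - Y v) (h z)) => [lt|le _]; last by rewrite emv; clear -le huz hYv; lia.
  case=> [|//|hB _]; first by exists c.
  by rewrite emv in hzm; have := Y_gt0 z; clear -hB hzm hYv Yv; lia.
have bm : visible_below h v m by case: (hmv nmv) => c; exists c.
have hvm : h v <= h m by case: (hz _ vp).
have [|hB hD] := hfit m bm; first by clear -hvm hYv Yv; lia.
have hv2 : h v + Y m <= h m by clear -hB hYv hYm; lia.
case: (eqVneq u v) => [->//|nuv].
have [c [p1 [cv q1 q2 h3 [z [zp vz zmax]]]]] := huv nuv.
have hzm : h z <= h m by case: (h3 _ zp) => zm _; case: (hz _ zm).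
have huz := zmax u (mem_head _ _).
case: (leqP (h z) (h v)) => le; first by clear -le huz hv2; lia.
(* The walk need not be simple, so the part of [u] may also have [m] as its top. The induction
   hypothesis then applies to the way from [m] to [u] inside this part, which avoids [v]. *)
case: (eqVneq z m) => [ezm|nzm].
  have [p2 [g1 g2 g3]] := sub_walk q1 zp.
  have [p3 [k1 k2 k3]] := rev_walk g1; rewrite g2 ezm in k1 k2 k3.
  rewrite -k2; apply: IH => //; last by rewrite k2.
  move=> w; rewrite k3 => wp; have : w \in u :: p1.
    by move: wp; rewrite !inE => /predU1P[->|/g3->]; rewrite ?eqxx ?orbT.
  by case/h3 => wm; rewrite iv => lw; split=> //; case: (hz _ wm).
have := hD z; rewrite /disj => /(_ _ nzm) hd.
have := hd (ex_intro2 _ _ c cv vz).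
have := Y_gt0 z; clear -hzm huz; lia.
Qed.
End Optimal.
End Ranking.

Local Open Scope ring_scope.

(** * Decision trees, rankings and surrogate costs *)

Section Cost.
Variables (R : realType) (V : Type).
Implicit Types (w : V -> R) (ch : seq (dtree V)).

Definition maxcost w ch : R := foldr (fun c m => Num.max (dcost w c) m) 0 ch.

Lemma dcostE w q ch : dcost w (DNode q ch) = w q + maxcost w ch.
Proof. by rewrite /=; congr (_ + _); elim: ch => //= c l ->. Qed.

Lemma maxcost_ub w ch x0 i : (i < size ch)%N -> dcost w (nth x0 ch i) <= maxcost w ch.
Proof.
elim: ch i => [//|c l IH] [|i] /= hi; first by rewrite le_max lexx.
by rewrite le_max IH ?orbT.
Qed.

Lemma maxcost_ge0 w ch : 0 <= maxcost w ch.
Proof. by elim: ch => //= c l IH; rewrite le_max IH orbT. Qed.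

Lemma maxcost_cases w ch x0 : maxcost w ch = 0 \/
  exists2 i, (i < size ch)%N & maxcost w ch = dcost w (nth x0 ch i).
Proof.
elim: ch => [|c l IH]; first by left.
rewrite /=; case: (leP (dcost w c) (maxcost w l)) => h.
  case: IH => [|[i hi e]]; [by left | right].
  by exists i.+1.
by right; exists 0%N.
Qed.
End Cost.

Section Comps.
Variables (V : finType) (e : rel V).
Hypothesis e_sym : symmetric e.

Definition component (P : {set V}) x : {set V} := [set y in P | connect (restrict e P) x y].

Lemma restrict_sym (P : {set V}) : symmetric (restrict e P).
Proof. by move=> x y; rewrite /restrict /= e_sym andbCA. Qed.

Lemma connect_restrict_sym (P : {set V}) x y :
  connect (restrict e P) x y = connect (restrict e P) y x.
Proof. exact/sym_connect_sym/restrict_sym. Qed.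

Lemma walk_restrict (P : {set V}) x p : x \in P ->
  path (restrict e P) x p = path e x p && all (mem P) p.
Proof.
elim: p x => //= y p IH x xP; rewrite {1}/restrict /= xP /=.
by case yP: (y \in P) => /=; rewrite ?andbF // IH // andbA.
Qed.

Lemma comp_eq (P : {set V}) x y : y \in component P x -> component P y = component P x.
Proof.
rewrite inE => /andP[yP cxy]; apply/setP => z; rewrite !inE; congr (_ && _).
apply/idP/idP => h; first exact: connect_trans cxy h.
by apply: connect_trans h; rewrite connect_restrict_sym.
Qed.

Lemma comp_refl (P : {set V}) x : x \in P -> x \in component P x.
Proof. by move=> xP; rewrite inE xP connect0. Qed.

Lemma mem_comps (P : {set V}) x : x \in P -> component P x \in comps e P.
Proof. by move=> xP; apply: imset_f. Qed.

Lemma is_dtree_mem S D : is_dtree e S D -> droot D \in S.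
Proof. by case. Qed.

Lemma is_dtree_walk_index (S : {set V}) q (Cs : seq {set V}) :
  perm_eq Cs (enum (comps e (S :\ q))) ->
  exists ix : V -> nat,
    (forall v, v \in S -> v != q ->
       (ix v < size Cs)%N /\ nth set0 Cs (ix v) = component (S :\ q) v) /\
    (forall u p, path e u p -> all (fun z => (z \in S) && (z != q)) (u :: p) ->
       forall z, z \in u :: p -> ix z = ix u /\ z \in nth set0 Cs (ix u)).
Proof.
move=> hp; pose ix v := index (component (S :\ q) v) Cs; exists ix.
have h1 v : v \in S -> v != q -> (ix v < size Cs)%N /\ nth set0 Cs (ix v) = component (S :\ q) v.
  move=> vS nq; have hC : component (S :\ q) v \in Cs.
    by rewrite (perm_mem hp) mem_enum mem_comps // !inE nq.
  by rewrite /ix index_mem nth_index.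
split=> // u p hw ha z zp.
have hin w : w \in u :: p -> w \in S :\ q by move=> /(allP ha); rewrite !inE andbC.
have uS := hin u (mem_head _ _).
have zc : z \in component (S :\ q) u.
  rewrite inE hin //=.
  have : path (restrict e (S :\ q)) u p.
    by rewrite walk_restrict // hw /=; apply/allP => w wp; apply: hin; rewrite inE wp orbT.
  by move=> hpr; apply: (path_connect hpr).
rewrite /ix (comp_eq zc); split=> //.
by have [] := h1 u; rewrite ?inE in uS; case/andP: uS => // _ _ _ ->.
Qed.

End Comps.

(** * From decision trees to rankings and heaviest paths *)

Section Label.
Variables (V : finType) (e : rel V) (Y : V -> nat).
Hypothesis e_sym : symmetric e.

(** Rank [v] by the [Y]-cost of the subtree of [D] rooted at [v]. Among the vertices of a walk, the
    one queried first is above all others, because they lie in subtrees below it. *)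
Lemma dtree_ranking (R : realType) S D : is_dtree e S D ->
  exists (g : V -> nat) (C : nat), [/\ dcost (fun v => (Y v)%:R : R) D = C%:R,
    (forall v, v \in S -> (Y v <= g v <= C)%N) & ranking e Y (mem S) g].
Proof.
elim=> {S D} S q ch Cs qS hsz hp _ IH.
have /choice[gc hgc] : forall i, exists gc : (V -> nat) * nat, (i < size ch)%N ->
    [/\ dcost (fun v => (Y v)%:R : R) (nth (DNode q [::]) ch i) = (gc.2)%:R,
    (forall v, v \in nth set0 Cs i -> (Y v <= gc.1 v <= gc.2)%N)
    & ranking e Y (mem (nth set0 Cs i)) gc.1].
  move=> i; case: (ltnP i (size ch)) => hi; last by exists (Y, 0%N).
  by have [g [C h]] := IH i hi; exists (g, C).
have [M [hM1 hM2]] : exists M : nat, maxcost (fun v => (Y v)%:R : R) ch = M%:R /\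
    forall i, (i < size ch)%N -> ((gc i).2 <= M)%N.
  have [M eM] : exists M : nat, maxcost (fun v => (Y v)%:R : R) ch = M%:R.
    case: (maxcost_cases (fun v => (Y v)%:R : R) ch (DNode q [::])) => [->|[i hi ->]].
      by exists 0%N.
    by have [-> _ _] := hgc i hi; exists (gc i).2.
  exists M; split=> // i hi; have [eC _ _] := hgc i hi.
  by have := maxcost_ub (fun v => (Y v)%:R : R) (DNode q [::]) hi; rewrite eC eM ler_nat.
have [ix [h1 h2]] := is_dtree_walk_index e_sym hp.
pose g v := if v == q then (Y q + M)%N else (gc (ix v)).1 v.
have gq : g q = (Y q + M)%N by rewrite /g eqxx.
have gn v : v != q -> g v = (gc (ix v)).1 v by move=> nq; rewrite /g (negbTE nq).
have gM v : v \in S -> v != q -> (Y v <= g v <= M)%N.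
  move=> vS nq; have [lt eC] := h1 v vS nq; rewrite gn //; rewrite -hsz in lt.
  have [_ hv _] := hgc _ lt.
  have /hv/andP[-> le] : v \in nth set0 Cs (ix v) by rewrite eC comp_refl // !inE nq.
  exact: leq_trans le (hM2 _ lt).
exists g, (Y q + M)%N; split.
- by rewrite dcostE hM1 natrD.
- move=> v vS; case: (eqVneq v q) => [->|nq]; first by rewrite gq leq_addr leqnn.
  by have /andP[-> le] := gM v vS nq; rewrite (leq_trans le) ?leq_addl.
- move=> u p hw ha ne.
  have inS z : z \in u :: p -> z \in S by move=> /(allP ha).
  case: (boolP (q \in u :: p)) => [qp|qp].
    have below z : z \in u :: p -> q = z \/ (g z + Y q <= g q)%N.
      move=> zp; case: (eqVneq z q) => [->|nq]; [by left | right].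
      have := gM z (inS _ zp) nq; rewrite gq; lia.
    exists q; split=> //; apply: below; [exact: mem_head | exact: mem_last].
  have nq z : z \in u :: p -> z != q by apply: contraTneq => ->.
  have ha' : all (fun z => (z \in S) && (z != q)) (u :: p).
    by apply/allP => z zp; rewrite inS // nq.
  have hix := h2 u p hw ha'.
  have ui := inS u (mem_head _ _); have [lt _] := h1 u ui (nq u (mem_head _ _)).
  rewrite -hsz in lt; have [_ _ rk] := hgc _ lt.
  have geq z : z \in u :: p -> g z = (gc (ix u)).1 z.
    by move=> zp; rewrite gn ?nq //; case: (hix z zp) => ->.
  have [|z [zp hz1 hz2]] := rk u p hw _ ne.
    by apply/allP => z zp; case: (hix z zp).
  by exists z; rewrite !geq ?mem_head ?mem_last.
Qed.

(** [A] is a heaviest path of [D] for [w], cut short where the subtrees contribute 0. Measured by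
    any other nonnegative cost it still bounds the cost of [D] from below, so it transfers estimates
    between [w] and [Y]. *)
Lemma dcost_path (R : realType) S D : is_dtree e S D -> forall w : V -> R,
  exists2 A : {set V}, A \subset S /\ dcost w D = \sum_(v in A) w v &
    forall w' : V -> R, (forall v, 0 <= w' v) -> \sum_(v in A) w' v <= dcost w' D.
Proof.
elim=> {S D} S q ch Cs qS hsz hp _ IH w.
case: (maxcost_cases w ch (DNode q [::])) => [e0|[i hi ei]].
  exists [set q]; first by rewrite sub1set dcostE e0 addr0 big_set1.
  by move=> w' w0; rewrite big_set1 dcostE lerDl maxcost_ge0.
have [A [sA eA] hA] := IH i hi w.
have qA : q \notin A.
  apply/negP => /(subsetP sA).
  have : nth set0 Cs i \in comps e (S :\ q).
    by rewrite -mem_enum -(perm_mem hp) mem_nth // -hsz.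
  by case/imsetP => x _ ->; rewrite !inE eqxx.
exists (q |: A); first split.
- apply/subsetP => z; rewrite !inE => /predU1P[->//|/(subsetP sA)].
  have : nth set0 Cs i \in comps e (S :\ q).
    by rewrite -mem_enum -(perm_mem hp) mem_nth // -hsz.
  by case/imsetP => x _ ->; rewrite !inE => /andP[/andP[_ ->]].
- by rewrite dcostE big_setU1 // ei eA.
move=> w' w0; rewrite dcostE big_setU1 // lerD2l.
exact: le_trans (hA w' w0) (maxcost_ub _ _ hi).
Qed.

End Label.

(** * Joining components into one decision tree *)

Section Edges.
Variables (V : finType).

Lemma dedgesE (q : V) ch x0 a c : (a, c) \in dedges (DNode q ch) <->
  exists2 i, (i < size ch)%N &
    (a, c) = (q, droot (nth x0 ch i)) \/ (a, c) \in dedges (nth x0 ch i).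
Proof.
rewrite /=; elim: ch => [|d l IH]; first by split=> // -[].
rewrite inE mem_cat; split.
  case/or3P => [/eqP->|h|/IH[i hi h]].
  - by exists 0%N => //; left.
  - by exists 0%N => //; right.
  - by exists i.+1.
case=> -[|i] /= hi h; last by apply/or3P; apply: Or33; apply/IH; exists i.
by case: h => [->|h]; rewrite ?eqxx ?h ?orbT.
Qed.

Lemma dedges_mem (e : rel V) S D a c : is_dtree e S D -> (a, c) \in dedges D ->
  c \in S /\ c != droot D.
Proof.
elim=> {S D} S q ch Cs qS hsz hp hd IH.
move/(dedgesE _ _ (DNode q [::])) => [i hi h].
have : nth set0 Cs i \in comps e (S :\ q).
  by rewrite -mem_enum -(perm_mem hp) mem_nth // -hsz.
case/imsetP => x _ eA.
have : c \in nth set0 Cs i.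
  case: h => [[_ ->]|h]; last by case: (IH i hi h).
  exact: is_dtree_mem (hd i hi).
by rewrite eA !inE => /andP[/andP[-> ->]].
Qed.
End Edges.

Section Elim.
Variables (R : realType) (n : nat) (e : rel 'I_n) (Y h : 'I_n -> nat).
Hypothesis e_sym : symmetric e.
Notation V := 'I_n.
Implicit Types (P Q S : {set V}) (rt : V -> V) (par : V -> nat).

Definition tree_at P rt par x D :=
  [/\ is_dtree e (component e P x) D, droot D = rt x,
     (forall a c, (a, c) \in dedges D -> par c = a.+1)
   & dcost (fun v => (Y v)%:R : R) D <= (h (rt x))%:R].

(* P is the set of vertices already joined; each component of P carries a
   decision tree rooted at rt x and recorded in the parent array. *)
Definition elim_inv P rt par : Prop :=
  [/\ (forall x, x \in P -> exists D, tree_at P rt par x D),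
      (forall x y, x \in P -> y \in component e P x -> rt y = rt x)
    & (forall c, c \notin P \/ (exists2 x, x \in P & rt x = c) -> par c = 0%N)].

Lemma comp_mono P Q x : P \subset Q -> component e P x \subset component e Q x.
Proof.
move=> /subsetP sPQ; apply/subsetP => y; rewrite !inE => /andP[/sPQ-> hc] /=.
apply: connect_sub hc => u v /and3P[uP vP uv]; apply: connect1.
by rewrite /restrict /= !sPQ.
Qed.

Lemma compC P x y : x \in P -> y \in component e P x -> x \in component e P y.
Proof. by move=> xP; rewrite !inE xP connect_restrict_sym // => /andP[]. Qed.

Lemma walk_comp P x p : x \in P -> path e x p -> all (mem P) p -> last x p \in component e P x.
Proof.
move=> xP hp ap; have hr : path (restrict e P) x p by rewrite walk_restrict // hp.
rewrite inE; apply/andP; split; last by apply/connectP; exists p.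
by move: (mem_last x p); rewrite inE => /predU1P[->//|/(allP ap)].
Qed.

Lemma comp_walk P x y : x \in P -> y \in component e P x ->
  exists p, [/\ path e x p, last x p = y, uniq (x :: p) & all (mem (component e P x)) p].
Proof.
move=> xP; rewrite inE => /andP[yP /connectP[p hp ->]].
case/shortenP: hp => p' hp' up _; exists p'; split=> //.
  by move: hp'; rewrite walk_restrict // => /andP[].
apply/allP => z zp; rewrite /= inE.
have: path (restrict e P) x p' by [].
rewrite walk_restrict // => /andP[_ /allP/(_ z zp)] /= ->.
by apply: (path_connect hp'); rewrite inE zp orbT.
Qed.

(** Without [q], the component of [q] in [q |: P] splits into exactly the components of [P] adjacent
    to [q], whose trees become the children of [q]; all other components are unchanged. A child
    costs at most [h (rt u) <= h q - Y q], which leaves room for the query of [q]. *)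
Lemma elim_step P q rt par rt' par' :
  elim_inv P rt par -> q \notin P -> (Y q <= h q)%N ->
  (forall u, u \in P -> e q u -> (h (rt u) + Y q <= h q)%N) ->
  (forall c, par' c = if [exists u, [&& u \in P, e q u & rt u == c]] then q.+1 else par c) ->
  rt' q = q ->
  (forall x, x \in P ->
    rt' x = if [exists u, [&& u \in P, e q u & rt u == rt x]] then q else rt x) ->
  elim_inv (q |: P) rt' par'.
Proof.
move=> [htree hrt hpar] qP hYq hsep ep' rq ex'.
pose adj c := [exists u, [&& u \in P, e q u & rt u == c]].
set Q := q |: P; set S := component e Q q.
have qQ : q \in Q by rewrite !inE eqxx.
have sPQ : P \subset Q by apply: subsetUr.
have rtc x : x \in P -> rt x \in component e P x.
  by move=> /htree[D [hD <- _ _]]; apply: is_dtree_mem hD.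
have rtP x : x \in P -> rt x \in P by move/rtc; rewrite inE => /andP[].
have same x y : x \in P -> y \in P -> rt x = rt y -> component e P x = component e P y.
  by move=> xP yP E; rewrite -(comp_eq e_sym (rtc _ xP)) E (comp_eq e_sym (rtc _ yP)).
have adjS x : x \in P -> (x \in S) = adj (rt x).
  move=> xP; apply/idP/existsP => [xS|[u /and3P[uP equ /eqP E]]].
    have [[|y p] [hp lp up ap]] := comp_walk qQ xS; first by rewrite -lp (negbTE qP) in xP.
    move: hp up => /= /andP[eqy hp] /andP[qyp _].
    have yP z : z \in y :: p -> z \in P.
      move=> zp; have := allP ap z zp; rewrite /= inE => /andP[+ _].
      by rewrite !inE => /predU1P[E|//]; rewrite -E zp in qyp.
    exists y; rewrite yP ?mem_head // eqy; apply/eqP/esym/hrt; first exact/yP/mem_head.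
    rewrite -lp /=; apply: walk_comp => //; first exact/yP/mem_head.
    by apply/allP => z zp; apply: yP; rewrite inE zp orbT.
  have uS : u \in S.
    by apply: (@walk_comp Q q [:: u]) => //=; rewrite ?andbT; [exact: equ | exact: (subsetP sPQ)].
  have xu : x \in component e P u by rewrite (same u x) // comp_refl.
  by have := subsetP (comp_mono u sPQ) x xu; rewrite (comp_eq e_sym uS).
have compN x : x \in P -> ~~ adj (rt x) -> component e Q x = component e P x.
  move=> xP na; have xQ := subsetP sPQ _ xP.
  apply/eqP; rewrite eqEsubset (comp_mono x sPQ) andbT; apply/subsetP => y yc.
  have [p [hp <- _ ap]] := comp_walk xQ yc.
  apply: walk_comp => //; apply/allP => z zp; have zc := allP ap z zp.
  have := zc; rewrite /= inE => /andP[+ _]; rewrite !inE => /predU1P[ezq|//].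
  rewrite ezq in zc.
  by have := compC xQ zc; rewrite -/S adjS // (negbTE na).
have SP x : x \in S :\ q -> x \in P.
  by rewrite !inE => /andP[/negbTE->] /andP[/orP[//|]].
have sSP : S :\ q \subset P by apply/subsetP.
have compD x : x \in S :\ q -> component e (S :\ q) x = component e P x.
  move=> xS; have xP := SP _ xS; have xS' : x \in S by move: xS; rewrite inE => /andP[].
  apply/eqP; rewrite eqEsubset comp_mono //=; apply/subsetP => y yc.
  have [p [hp <- _ ap]] := comp_walk xP yc.
  apply: walk_comp => //; apply/allP => z zp; have zc := allP ap z zp.
  rewrite /= in_setD1; apply/andP; split.
    by apply: contraNneq qP => <-; move: zc; rewrite /= inE => /andP[].
  by rewrite /S -(comp_eq e_sym xS'); apply: (subsetP (comp_mono x sPQ)).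
(* Only roots of adjacent components receive a new parent entry. This excludes that a non-root
   vertex of an existing tree is such a root, so its entry survives. *)
have sameadj c u : u \in P -> adj (rt u) -> forall x, x \in P -> c \in component e P x ->
   c = rt u -> adj (rt x) /\ c = rt x.
  move=> uP au x xP cx E.
  have : component e P u = component e P x.
    by rewrite -(comp_eq e_sym (rtc _ uP)) -E (comp_eq e_sym cx).
  move=> Ec; have := hrt u x uP; rewrite Ec comp_refl // => /(_ isT) ->.
  by rewrite au E.
have inSrt x : x \in S -> rt' x = q.
  move=> xS; have := xS; rewrite inE => /andP[+ _]; rewrite !inE => /predU1P[->//|xP].
  by rewrite ex' // -/(adj _) -adjS // xS.
have adjP c : adj c -> exists2 u, u \in P & rt u = c /\ e q u.
  by case/existsP => u /and3P[uP equ /eqP E]; exists u.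
split.
- move=> x xQ; case: (boolP (x \in S)) => xS; last first.
    have nxq : x != q by apply: contraNneq xS => ->; apply: comp_refl.
    have xP : x \in P by move: xQ; rewrite !inE (negbTE nxq).
    have na : ~~ adj (rt x) by rewrite -adjS.
    have [D [h1 h2 h3 h4]] := htree x xP.
    exists D; split; rewrite ?compN // ?ex' // -?/(adj _) ?(negbTE na) //.
    move=> a c ac; rewrite ep' -/(adj c) -(h3 _ _ ac); case: ifP => // /adjP[u uP [E equ]].
    have [cS _] := dedges_mem h1 ac.
    have au : adj (rt u) by apply/existsP; exists u; rewrite uP equ eqxx.
    have [ax _] := sameadj c u uP au x xP cS (esym E).
    by rewrite ax in na.
  have eS : component e Q x = S by rewrite (comp_eq e_sym xS).
  have /choice[DD hDD] : forall A, exists D, A \in comps e (S :\ q) ->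
     exists2 x, x \in S :\ q & A = component e P x /\ tree_at P rt par x D.
    move=> A; case: (boolP (A \in comps e (S :\ q))) => [/imsetP[y yS ->]|]; last first.
      by exists (DNode q [::]).
    have [D hD] := htree y (SP _ yS).
    by exists D => _; exists y => //; split=> //; apply: compD.
  set Cs := enum (comps e (S :\ q)).
  have hCs i : (i < size Cs)%N -> nth set0 Cs i \in comps e (S :\ q).
    by move=> hi; rewrite -mem_enum mem_nth.
  exists (DNode q [seq DD A | A <- Cs]); split.
  + rewrite eS; apply: (@IsDT _ _ _ _ _ Cs) => //; first exact: comp_refl.
      by rewrite size_map.
    move=> i; rewrite size_map => hi; rewrite (nth_map set0) //.
    have [y yS [-> [h1 _ _ _]]] := hDD _ (hCs _ hi); exact: h1.
  + by rewrite inSrt.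
  + move=> a c /(dedgesE _ _ (DNode q [::]))[i]; rewrite size_map => hi.
    rewrite (nth_map set0) // ; have [y yS [eA [h1 h2 h3 _]]] := hDD _ (hCs _ hi).
    have yP := SP _ yS; have yS' : y \in S by move: yS; rewrite inE => /andP[].
    rewrite ep' -/(adj c) => -[[-> ->]|ac]; first by rewrite h2 -adjS // yS'.
    case: ifP => [/adjP[u uP [E equ]]|_]; last exact: h3.
    have [cS cr] := dedges_mem h1 ac.
    have au : adj (rt u) by apply/existsP; exists u; rewrite uP equ eqxx.
    have [_ E2] := sameadj c u uP au y yP cS (esym E).
    by rewrite h2 E2 eqxx in cr.
  + rewrite inSrt // dcostE.
    have hb : maxcost (fun v => (Y v)%:R : R) [seq DD A | A <- Cs] <= (h q - Y q)%:R.
      case: (maxcost_cases (fun v => (Y v)%:R : R) [seq DD A | A <- Cs] (DNode q [::])) => [->//|[i]].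
      rewrite size_map => hi ->; rewrite (nth_map set0) //.
      have [y yS [eA [h1 h2 h3 h4]]] := hDD _ (hCs _ hi).
      have yP := SP _ yS; have yS' : y \in S by move: yS; rewrite inE => /andP[].
      apply: le_trans h4 _; rewrite ler_nat.
      have : adj (rt y) by rewrite -adjS.
      by case/adjP => u uP [<- equ]; have := hsep u uP equ; clear; lia.
    by rewrite -lerBrDl -natrB.
- move=> x y xQ; case: (boolP (x \in S)) => xS.
    by rewrite (comp_eq e_sym xS) => yS; rewrite !inSrt.
  have nxq : x != q by apply: contraNneq xS => ->; apply: comp_refl.
  have xP : x \in P by move: xQ; rewrite !inE (negbTE nxq).
  have na : ~~ adj (rt x) by rewrite -adjS.
  rewrite compN // => yc; have yP : y \in P by move: yc; rewrite inE => /andP[].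
  by rewrite !ex' // (hrt x y).
- move=> c hc; rewrite ep' -/(adj c).
  case: hc => [|[x xQ E]].
    rewrite !inE negb_or => /andP[nq cP].
    case: ifP => [/adjP[u uP [E _]]|_]; last by apply: hpar; left.
    by rewrite -E rtP in cP.
  case: (boolP (x \in S)) => xS.
    rewrite inSrt // in E; rewrite -E.
    case: ifP => [/adjP[u uP [E' _]]|_]; last by apply: hpar; left.
    by rewrite -E' rtP in qP.
  have nxq : x != q by apply: contraNneq xS => ->; apply: comp_refl.
  have xP : x \in P by move: xQ; rewrite !inE (negbTE nxq).
  have na : adj (rt x) = false by rewrite -adjS // (negbTE xS).
  rewrite ex' // -/(adj _) na in E; rewrite -E na.
  by apply: hpar; right; exists x.
Qed.
End Elim.

(** * From [Y]-sums to [x]-sums *)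

Section Surrogate.
Variables (R : realType) (n : nat) (Y : nat -> nat) (x : nat -> R).
Hypothesis Y_gt0 : forall i, (i < n)%N -> (0 < Y i)%N.
Hypothesis x_ge0 : forall i, (i < n)%N -> 0 <= x i.
Hypothesis chain : forall i, (i.+1 < n)%N ->
  (exists c, [/\ (0 < c)%N, Y i.+1 = (c * Y i)%N & x i.+1 = c%:R * x i]) \/
  (Y i.+1 = (n.+1 * Y i)%N /\ n.+1%:R * x i <= x i.+1).

(** The differences [D k] of [Y]-sums and [r k] of [x]-sums are taken over the indices from [k] on.
    Either [D k / Y k] is at most [r k / x k], or [D k] is so negative that the members of [b] below
    [k], of size at most [Y k] each, cannot lift it to 0; the hypothesis excludes the latter at
    [k = 0]. At a fresh start with [D k.+1] negative, divisibility makes it at most [- n.+1 * Y k],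
    and at most [n] members cannot make up for that. *)
Lemma surrogate_le (a b : nat -> bool) :
  (\sum_(0 <= i < n) a i * Y i <= \sum_(0 <= i < n) b i * Y i)%N ->
  \sum_(0 <= i < n) (a i)%:R * x i <= \sum_(0 <= i < n) (b i)%:R * x i.
Proof.
case: n Y_gt0 x_ge0 chain => [|n'] Y0 x0 ch; first by rewrite !big_geq.
set N := n'.+1 in Y0 x0 ch *.
pose d i : int := (b i : nat)%:Z - (a i : nat)%:Z.
pose D k : int := \sum_(k <= i < N) d i * (Y i)%:Z.
pose r k : R := \sum_(k <= i < N) (d i)%:~R * x i.
pose B k : nat := (\sum_(0 <= i < k) b i)%N.
have BN k : (k <= N)%N -> (B k <= N)%N.
  move=> hk; apply: leq_trans hk; elim: k => [|k IH]; first by rewrite /B big_geq.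
  by rewrite /B big_nat_recr //= -addn1 leq_add // leq_b1.
(* The comparison of ratios is cross-multiplied because [x k] may be 0. *)
suff main k : (k < N)%N ->
   (exists z : int, D k = z * (Y k)%:Z) /\
   ((D k)%:~R * x k <= r k * (Y k)%:R \/ D k + (B k)%:Z * (Y k)%:Z < 0).
  move=> hle; have D0 : 0 <= D 0%N.
    rewrite /D (eq_bigr (fun i => (b i * Y i)%N%:Z - (a i * Y i)%N%:Z)); last first.
      by move=> i _; rewrite /d mulrBl !PoszM.
    rewrite sumrB subr_ge0 -!(big_morph _ PoszD (erefl _)) lez_nat //.
  have [_ [h|h]] := main 0%N isT; last first.
    by move: h; rewrite /B big_geq // mul0r addr0 ltNge D0.
  have r0 : 0 <= r 0%N.
    have : 0 <= r 0%N * (Y 0%N)%:R.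
      by apply: le_trans h; rewrite mulr_ge0 ?ler0z ?x0.
    by rewrite pmulr_lge0 // ltr0n Y0.
  rewrite -subr_ge0 -sumrB; apply: le_trans r0 _; rewrite le_eqVlt; apply/orP; left; apply/eqP.
  by apply: eq_bigr => i _; rewrite /d intrD rmorphN /= mulrDl mulNr.
have [j] : exists j, (k + j)%N = n' \/ (N <= k)%N.
  by case: (leqP k n') => h; [exists (n' - k)%N; left; lia | exists 0%N; right].
elim: j k => [|j IH] k [] hk hkN; try lia.
  have -> : k = n' by lia.
  rewrite /D /r !big_nat1; split; first by exists (d n').
  by left; rewrite intrM -mulrA [(Y n')%:~R * _]mulrC mulrA.
have hk1 : (k.+1 < N)%N by lia.
have [[z ez] hor] := IH k.+1 (or_introl (etrans (addSnnS _ _) hk)) hk1.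
have eD : D k = d k * (Y k)%:Z + D k.+1 by rewrite /D big_ltn.
have er : r k = (d k)%:~R * x k + r k.+1 by rewrite /r big_ltn.
have eB : B k.+1 = (B k + b k)%N by rewrite /B big_nat_recr.
have db : d k <= (b k : nat)%:Z by rewrite /d; lia.
have Yk := Y0 k hkN; have xk := x0 k hkN.
have Bk := BN k.+1 hkN.
have x1 := x0 _ hk1.
set yk := Y k in Yk eD *; set y1 := Y k.+1 in ez hor.
have [c [c0 ey]] : exists c, (0 < c)%N /\ y1 = (c * yk)%N.
  by case: (ch k hk1) => [[c [c0 ec _]]|[ec _]]; [exists c | exists N.+1].
split; first by exists (d k + z * c%:Z); rewrite eD ez ey PoszM; ring.
have fail : D k.+1 + (B k.+1)%:Z * yk%:Z < 0 -> D k + (B k)%:Z * yk%:Z < 0.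
  move=> h; apply: le_lt_trans h; rewrite eD eB PoszD.
  have : d k * yk%:Z <= (b k : nat)%:Z * yk%:Z by rewrite ler_wpM2r.
  lia.
have goodstep : (D k.+1)%:~R * x k <= r k.+1 * yk%:R -> (D k)%:~R * x k <= r k * yk%:R.
  move=> h; rewrite eD er intrD intrM !mulrDl; apply: lerD => //.
  by rewrite -!mulrA [yk%:~R * _]mulrC.
have fail2 : D k.+1 + (B k.+1)%:Z * y1%:Z < 0 -> D k.+1 + (B k.+1)%:Z * yk%:Z < 0.
  move=> h; apply: le_lt_trans h; rewrite lerD2l ler_wpM2l // lez_nat ey.
  by rewrite leq_pmull.
case: hor => hor; last by right; apply/fail/fail2.
case: (ch k hk1) => [[c' [c'0 ey' ex']]|[ey' ex']].
  left; apply: goodstep; move: hor; rewrite ex' /y1 ey' natrM.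
  have c1 : 0 < c'%:R :> R by rewrite ltr0n.
  rewrite -/yk => hor; rewrite -(ler_pM2l c1).
  by move: hor; rewrite mulrCA [r _ * _]mulrCA.
(* When the difference so far is nonnegative, [x k.+1] may be lowered to [N.+1 * x k], and the
   argument for a multiple applies. *)
case: (lerP 0 (D k.+1)) => D1.
  left; apply: goodstep.
  have c1 : 0 < N.+1%:R :> R by rewrite ltr0n.
  rewrite -(ler_pM2l c1).
  have : (D k.+1)%:~R * (N.+1%:R * x k) <= (D k.+1)%:~R * x k.+1.
    by rewrite ler_wpM2l // ler0z.
  move: hor; rewrite /y1 ey' natrM -/yk => h1 h2.
  by have := le_trans h2 h1; rewrite mulrCA [r _ * _]mulrCA.
right; apply: fail.
have zneg : z <= -1.
  have : z < 0.
    rewrite ltNge; apply/negP => z0; move: D1; rewrite ez ltNge mulr_ge0 //.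
  lia.
have : D k.+1 <= - (N.+1%:Z * yk%:Z).
  rewrite ez /y1 ey' PoszM -/yk -mulN1r; apply: ler_wpM2r => //.
have : (B k.+1)%:Z * yk%:Z <= N%:Z * yk%:Z by rewrite ler_wpM2r // lez_nat.
have : 0 < yk%:Z by [].
have : N.+1%:Z * yk%:Z = N%:Z * yk%:Z + yk%:Z by rewrite -addn1 PoszD mulrDl mul1r.
move: (_ * yk%:Z) (_ * yk%:Z) (_ * yk%:Z) => t1 t2 t3; lia.
Qed.
End Surrogate.

(** * Prim orders of a tree with down-monotonic costs *)

Lemma walk_change (T : eqType) (e : rel T) (P : pred T) x p :
  path e x p -> P x -> ~~ P (last x p) ->
  exists y z, [/\ y \in x :: p, z \in x :: p, P y, ~~ P z & e y z].
Proof.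
elim: p x => [|y p IH] x /=; first by move=> _ ->.
move=> /andP[exy hp] Px nP; case Py: (P y).
  have [a [b [h1 h2 h3 h4 h5]]] := IH y hp Py nP.
  by exists a, b; rewrite !(inE, h1, h2, orbT); split; rewrite ?orbT //;
    [move: h1 | move: h2]; rewrite inE => ->; rewrite orbT.
by exists x, y; rewrite !inE !eqxx orbT Px Py.
Qed.

Section Frontier.
Variables (R : realType) (V : finType) (e : rel V) (w : V -> R).
Hypothesis tree : is_tree e.

Lemma uniq_walk x y : exists p, [/\ path e x p, last x p = y & uniq (x :: p)].
Proof.
have [_ _ _ con _] := tree; have /connectP[p hp ->] := con x y.
by case/shortenP: hp => p' hp' up _; exists p'.
Qed.

(** The vertex [r] is not given to the algorithm, which starts from a lightest vertex [o0]. If [r]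
    is in [S], the path from [r] to [v] leaves [S] at a vertex no heavier than [v]. Otherwise the
    path from [r] to [o0] enters [S] from a vertex no heavier than [o0], hence no heavier than
    [v]. *)
Lemma frontier_low (S : pred V) o0 v : down_monotonic e w -> S o0 ->
  (forall u, w o0 <= w u) -> ~~ S v ->
  exists s f, [/\ S s, ~~ S f, e s f & w f <= w v].
Proof.
move=> [r mono] So wo nv; have [_ e_sym _ _ _] := tree.
case Sr: (S r).
  have [p [hp lp up]] := uniq_walk r v.
  have [||s [f [h1 h2 h3 h4 h5]]] := walk_change hp (P := S) => //; first by rewrite lp.
  by exists s, f; split=> //; apply: mono; exists p.
have [p [hp lp up]] := uniq_walk r o0.
have [||f [s [h1 h2 h3 h4 h5]]] := walk_change hp (P := predC S).
- by rewrite /= Sr.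
- by rewrite /= lp So.
exists s, f; split=> //; first by move: h4; rewrite /= negbK.
  by rewrite e_sym.
by apply: le_trans (wo v); apply: mono; exists p.
Qed.

Variable o : seq V.
Hypothesis o_all : forall v, v \in o.
Hypothesis o_uniq : uniq o.
Hypothesis o_conn : forall k, (0 < k < size o)%N ->
  exists2 j, (j < k)%N & forall v0, e (nth v0 o j) (nth v0 o k).

Let idx v := index v o.

Lemma idx_inj_o : injective idx.
Proof. by move=> x y E; rewrite -(nth_index x (o_all x)) -/(idx x) E nth_index. Qed.

Lemma lower_nbr v : (0 < idx v)%N -> exists u, child e idx v u.
Proof.
move=> h; have hs : (idx v < size o)%N by rewrite index_mem.
have [|j hj he] := @o_conn (idx v); first by rewrite h.
exists (nth v o j); rewrite /child; have [_ e_sym _ _ _] := tree.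
rewrite e_sym; have := he v; rewrite /idx nth_index // => ->.
by rewrite index_uniq //; apply: ltn_trans hj hs.
Qed.

Lemma descend v : exists p, [/\ path e v p, idx (last v p) = 0%N
  & forall z, z \in v :: p -> (idx z <= idx v)%N].
Proof.
have [k] := ubnP (idx v); elim: k v => // k IH v hk.
case: (posnP (idx v)) => [h0|h].
  by exists [::]; split=> // z; rewrite inE => /eqP->.
have [u /andP[evu lt]] := lower_nbr h.
have [|p [h1 h2 h3]] := IH u; first by lia.
exists (u :: p); split=> //=; first by rewrite evu.
move=> z; rewrite inE => /predU1P[->//|/h3]; lia.
Qed.

(** Two parents of [c] descend to the common vertex of index 0 through indices below that of [c]; a
    path between them avoiding [c] would close a cycle with [c]. *)
Lemma child_uniq_tree c z1 z2 : child e idx c z1 -> child e idx c z2 -> z1 = z2.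
Proof.
move=> /andP[e1 l1] /andP[e2 l2]; apply/eqP; apply: contraT => ne.
have [_ e_sym _ _ acy] := tree.
have [p1 [h1 t1 a1]] := descend z1; have [p2 [h2 t2 a2]] := descend z2.
have [p3 [h3 t3 a3]] := rev_walk e_sym h2.
have lst : last z1 p1 = last z2 p2 by apply: idx_inj_o; rewrite t1 t2.
have hp : path e z1 (p1 ++ p3) by rewrite cat_path h1 lst.
have lp : last z1 (p1 ++ p3) = z2 by rewrite last_cat lst.
have cN : c \notin z1 :: p1 ++ p3.
  apply/negP; rewrite -cat_cons mem_cat => /orP[/a1|h]; first by lia.
  have : c \in z2 :: p2 by rewrite -a3 inE h orbT.
  by move/a2; lia.
move: cN; case/shortenP: hp lp => p hp up sub lp cN.
have := acy (c :: z1 :: p); rewrite cons_uniq up andbT.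
have -> : c \notin z1 :: p.
  apply: contra cN; rewrite !inE => /predU1P[->|/sub ->]; by rewrite ?eqxx ?orbT.
case: p hp up sub lp => [|y p] hp up sub lp; first by rewrite -lp eqxx in ne.
move=> /(_ isT isT); rewrite /= rcons_path e1 /=.
move: hp lp => /= /andP[-> ->] /= ->; by rewrite e_sym e2.
Qed.
End Frontier.

Local Close Scope ring_scope.

Arguments upd_arr : simpl never.
Arguments den : simpl never.
Arguments eval : simpl never.

(** * The algorithm *)

Notation "a ;; b" := (Seq a b) (at level 60, right associativity).
(** An equality test by truncated subtraction: the sum is 0 exactly when both differences are. *)
Definition eqx a b := EAdd (ESub a b) (ESub b a).
Definition vi := 2. Definition vj := 3. Definition vq := 4. Definition vu := 5.
Definition vz := 6. Definition vp := 7. Definition va := 8. Definition vb := 9.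
Definition vbest := 10. Definition vbad := 11. Definition vround := 12. Definition vy := 13.
Definition vyacc := 14. Definition vjj := 15. Definition vacc := 16.
Definition Amul := 0. Definition Aadj := 1. Definition Aord := 2. Definition Ain := 3.
Definition Acand := 4. Definition AY := 5. Definition Ah := 6. Definition Alab := 7.
Definition Art := 8. Definition Apar := 9.
(** Entry of a matrix stored by rows; [Amul] tabulates the multiples of [n], as the machine cannot
    multiply indices. *)
Definition adjx a b := EArr Aadj (EAdd (EArr Amul a) b).

Section Rules.
Variables (R : realType) (lim : nat) (W : nat -> R).
Notation den := (den lim W).
Implicit Types s : astate R.

Definition same (c : cmd) (i : nat) s s' :=
  [/\ forall r, r != i -> ~~ writes_var c r -> vars s' r = vars s r,
      forall k x, ~~ writes_arr c k -> arrs s' k x = arrs s k x,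
      ~~ writes_tape c -> forall x, tape s' x = tape s x
    & forall r, ~~ writes_xreg c r -> xregs s' r = xregs s r].

(** [same] hands the body everything that the loop does not write, so invariants need to mention
    only what changes. The last premise covers the final assignment of the counter. *)
Lemma For_rule (Inv : nat -> astate R -> Prop) i c s n :
  vars s 0 = n -> Inv 0 s ->
  (forall j s', j < n -> same c i s s' -> Inv j s' -> Inv j.+1 (den c (setv i j s'))) ->
  (forall s', Inv n s' -> Inv n (setv i n s')) ->
  Inv n (den (For i c) s).
Proof.
move=> hn h0 hS he.
suff [] : Inv n (den (For i c) s) /\ same c i s (den (For i c) s) by [].
apply: (@For_inv _ _ _ (fun j s' => Inv j s' /\ same c i s s')) => //.
- move=> j s' hj [hI [h1 h2 h3 h4]]; split; first exact: hS.
  split.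
  + by move=> r hr hc; rewrite frame_v //= /upd (negbTE hr) h1.
  + by move=> k x hc; rewrite frame_a //= h2.
  + by move=> hc x; rewrite frame_t //= h3.
  + by move=> r hc; rewrite frame_x //= h4.
- move=> s' [hI [h1 h2 h3 h4]]; split; first exact: he.
  by split=> // r hr hc; rewrite /= /upd (negbTE hr) h1.
Qed.

Definition seta k x v s := AState (vars s) (upd_arr (arrs s) k x v) (tape s) (xregs s).
Definition sett x v s := AState (vars s) (arrs s) (upd (tape s) x v) (xregs s).
Definition setx d v s := AState (vars s) (arrs s) (tape s) (upd (xregs s) d v).

Lemma den_Seq a b s : den (a ;; b) s = den b (den a s). Proof. by []. Qed.
Lemma den_Assign d e s : den (Assign d e) s = setv d (eval s e) s. Proof. by []. Qed.
Lemma den_StoreArr k a b s : den (StoreArr k a b) s = seta k (eval s a) (eval s b) s. Proof. by []. Qed.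
Lemma den_StoreTape a b s : den (StoreTape a b) s = sett (minn (eval s a) lim.-1) (eval s b) s. Proof. by []. Qed.
Lemma den_IfZero e a b s : den (IfZero e a b) s = if eval s e == 0 then den a s else den b s. Proof. by []. Qed.
Lemma den_IfLe x y a b s : den (IfLe x y a b) s = if (xregs s x <= xregs s y)%R then den a s else den b s.
Proof. by []. Qed.
Lemma denE : (
  (forall a b s, den (a ;; b) s = den b (den a s)) *
  (forall d e s, den (Assign d e) s = setv d (eval s e) s) *
  (forall k a b s, den (StoreArr k a b) s = seta k (eval s a) (eval s b) s) *
  (forall d e s, den (LoadTape d e) s = setv d (tape s (minn (eval s e) lim.-1)) s) *
  (forall a b s, den (StoreTape a b) s = sett (minn (eval s a) lim.-1) (eval s b) s) *
  (forall d e s, den (LoadReal d e) s = setx d (W (eval s e)) s) *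
  (forall d s, den (ZeroReal d) s = setx d 0%R s) *
  (forall d a b s, den (AddReal d a b) s = setx d (xregs s a + xregs s b)%R s) *
  (forall s, den Skip s = s))%type.
Proof. by []. Qed.

Lemma stE s : (
  ((forall d v r, vars (setv d v s) r = if r == d then v else vars s r) *
   (forall k x v, vars (seta k x v s) = vars s) * (forall x v, vars (sett x v s) = vars s) *
   (forall d v, vars (setx d v s) = vars s)) *
  ((forall d v, arrs (setv d v s) = arrs s) *
   (forall k x v k' x', arrs (seta k x v s) k' x' = if (k' == k) && (x' == x) then v else arrs s k' x') *
   (forall x v, arrs (sett x v s) = arrs s) * (forall d v, arrs (setx d v s) = arrs s)) *
  ((forall d v, tape (setv d v s) = tape s) * (forall k x v, tape (seta k x v s) = tape s) *
   (forall y v x, tape (sett y v s) x = if x == y then v else tape s x) *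
   (forall d v, tape (setx d v s) = tape s)) *
  ((forall d v, xregs (setv d v s) = xregs s) * (forall k x v, xregs (seta k x v s) = xregs s) *
   (forall x v, xregs (sett x v s) = xregs s) *
   (forall d v x, xregs (setx d v s) x = if x == d then v else xregs s x)))%type.
Proof. by []. Qed.

Opaque setv seta sett setx.

Lemma evalE s : ((forall r, eval s (Var r) = vars s r) * (forall k, eval s (Cst k) = k) *
  (forall a b, eval s (EAdd a b) = (eval s a + eval s b)%N) * (forall a b, eval s (ESub a b) = (eval s a - eval s b)%N) *
  (forall k a, eval s (EArr k a) = arrs s k (eval s a)))%type.
Proof. by []. Qed.
Lemma eval_eqx s a b : (eval s (eqx a b) == 0) = (eval s a == eval s b).
Proof. by rewrite /eqx !evalE addn_eq0 !subn_eq0 eqn_leq. Qed.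

(** * Reading the input tree *)

Definition read_edge : cmd :=
  LoadTape va (Var vjj) ;; LoadTape vb (EAdd (Var vjj) (Cst 1)) ;;
  StoreArr Aadj (EAdd (EArr Amul (Var va)) (Var vb)) (Cst 1) ;;
  StoreArr Aadj (EAdd (EArr Amul (Var vb)) (Var va)) (Cst 1) ;;
  Assign vjj (EAdd (Var vjj) (Cst 2)).
Definition mul_table : cmd :=
  Assign vacc (Cst 0) ;;
  For vi (StoreArr Amul (Var vi) (Var vacc) ;; Assign vacc (EAdd (Var vacc) (Var 0))).
(** Two nested loops offer [n * n] passes, enough for all edges. The test skips the passes that
    remain once [vjj] has reached the end of the input at [2 * m + 2]. *)
Definition adj_table : cmd :=
  Assign vjj (Cst 2) ;;
  For vi (For vj (IfZero (ESub (EAdd (Var 1) (Cst 2)) (Var vjj)) Skip read_edge)).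

Lemma mul_table_spec s n : vars s 0 = n ->
  forall u, u < n -> arrs (den mul_table s) Amul u = u * n.
Proof.
move=> hn; rewrite /mul_table !denE evalE.
pose Q j s' := vars s' vacc = j * n /\ forall u, u < j -> arrs s' Amul u = u * n.
set c := For vi _; suff [] : Q n (den c (setv vacc 0 s)) by [].
apply: For_rule => // j s' hj [hv _ _ _] [h1 h2].
rewrite !denE !evalE; split; first by rewrite !stE /= h1 (hv 0) // stE /= hn mulSn addnC.
move=> u; rewrite ltnS leq_eqVlt => /predU1P[->|lt]; rewrite !stE /= ?eqxx ?(ltn_eqF lt) ?h2 //.
Qed.

Definition edge_at (E : seq (nat * nat)) k u v :=
  [exists t : 'I_(size E), (t < k) && ((nth (0, 0) E t == (u, v)) || (nth (0, 0) E t == (v, u)))].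

Lemma adj_table_spec s n (E : seq (nat * nat)) : vars s 0 = n -> vars s 1 = 2 * size E ->
  2 * size E + 2 <= lim -> size E <= n * n ->
  (forall k, k < size E -> tape s (2 + 2 * k) = (nth (0, 0) E k).1
     /\ tape s (3 + 2 * k) = (nth (0, 0) E k).2) ->
  all (fun p => (p.1 < n) && (p.2 < n)) E ->
  (forall u, u < n -> arrs s Amul u = u * n) -> (forall x, arrs s Aadj x = 0) ->
  forall u v, u < n -> v < n -> (arrs (den adj_table s) Aadj (u * n + v) != 0) = edge_at E (size E) u v.
Proof.
move=> hn hM hlim hE ht hb hmul hz.
rewrite /adj_table !denE evalE; set s0 := setv vjj 2 s.
set B := IfZero _ _ _.
pose Q t s' := vars s' vjj = 2 + 2 * minn t (size E) /\
  forall u v, u < n -> v < n -> (arrs s' Aadj (u * n + v) != 0) = edge_at E t u v.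
suff [_ h] : Q (n * n) (den (For vi (For vj B)) s0).
  move=> u v hu hv; rewrite h //; apply/existsP/existsP => -[t /andP[h1 h2]]; exists t; rewrite h2 andbT //.
  exact: leq_trans (ltn_ord t) hE.
apply: (@For_rule (fun i s' => Q (i * n) s') _ _ _ n) => //.
- split; first by rewrite mul0n min0n.
  by move=> u v _ _; rewrite stE hz; apply/esym/existsP => -[t].
move=> i s1 hi [hv hA hT _] q1.
rewrite mulSn addnC.
apply: (@For_rule (fun j s' => Q (i * n + j) s') _ _ _ n) => //.
- by rewrite !stE /= hv.
- by rewrite addn0; case: q1 => g2 g3; split.
move=> j s2 hj [hv2 hA2 hT2 _] [g2 g3].
have hadd x y x' y' : x < n -> y < n -> x' < n -> y' < n -> (x * n + y == x' * n + y') = (x == x') && (y == y').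
  move=> hx hy hx' hy'; apply/eqP/andP => [E1|[/eqP-> /eqP->]//].
  have n0 : 0 < n by apply: leq_ltn_trans hx.
  have : (x * n + y) %/ n = (x' * n + y') %/ n by rewrite E1.
  rewrite !divnMDl // !divn_small // !addn0 => exx; split; first exact/eqP.
  by move/eqP: E1; rewrite exx eqn_add2l.
have e1 : vars s2 1 = 2 * size E by rewrite hv2 ?stE //= hv.
rewrite addnS /B den_IfZero !evalE !stE /= e1 g2.
have [le|le] : size E <= i * n + j \/ i * n + j < size E by clear; lia.
  rewrite (minn_idPr le) ifT; last by apply/eqP; lia.
  rewrite denE; split; first by rewrite (minn_idPr (leqW le)) stE /= g2 (minn_idPr le).
  move=> u v hu hv'; rewrite stE g3 //; apply/existsP/existsP => -[t /andP[h1 h2]]; exists t; rewrite h2 andbT;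
    have := ltn_ord t; lia.
rewrite (minn_idPl (ltnW le)) ifF; last by apply/eqP; lia.
set k := i * n + j in le g2 g3 *.
have [c1 c2] := ht k le.
have /andP[b1 b2] := all_nthP (0, 0) hb k le.
set a := (nth (0, 0) E k).1 in c1 b1 *; set b := (nth (0, 0) E k).2 in c2 b2 *.
have {}c1 : tape s2 (2 + 2 * k) = a by rewrite hT2 // stE hT.
have {}c2 : tape s2 (3 + 2 * k) = b by rewrite hT2 // stE hT.
have m1 x : x < n -> arrs s2 Amul x = x * n by move=> hx; rewrite hA2 // stE hA // stE hmul.
have i1 : minn (2 + 2 * k) lim.-1 = 2 + 2 * k by clear -hlim le; lia.
have i2 : minn (2 + 2 * k + 1) lim.-1 = 3 + 2 * k by clear -hlim le; lia.
rewrite /read_edge !denE !evalE !stE /=.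
rewrite (minn_idPl (ltnW le)) in g2; rewrite g2 i1 i2 c1 c2 !m1 //.
split; first by rewrite stE /= (minn_idPl le); clear; lia.
move=> u v hu hv'; rewrite !stE /= !hadd //.
have eS : edge_at E k.+1 u v = edge_at E k u v || ((nth (0, 0) E k == (u, v)) || (nth (0, 0) E k == (v, u))).
  apply/existsP/orP => [[t]|].
    rewrite ltnS leq_eqVlt => /andP[/predU1P[->|lt] h]; [by right | left].
    by apply/existsP; exists t; rewrite lt.
  case=> [/existsP[t /andP[h1 h2]]|h]; first by exists t; rewrite h2 andbT leqW.
  by exists (Ordinal le); rewrite /= leqnn.
rewrite eS -g3 // [nth _ _ _]surjective_pairing -/a -/b !xpair_eqE.
rewrite [a == u]eq_sym [b == v]eq_sym [a == v]eq_sym [b == u]eq_sym.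
by case: (u == a); case: (v == b); case: (u == b); case: (v == a); rewrite ?orbT ?orbF.
Qed.

(** * Computing the Prim order and the surrogates *)

Section Phases.
Variables (n : nat) (e : rel 'I_n) (w : 'I_n -> R) (v0 : 'I_n).
Hypothesis Ww : forall v : 'I_n, W v = w v.
Hypothesis w_ge0 : forall v, (0 <= w v)%R.

Definition adj_ok s := vars s 0 = n /\ forall u v : 'I_n, arrs s Amul u = u * n /\
  (arrs s Aadj (u * n + v) != 0) = e u v.

Lemma adj_okE s (u v : 'I_n) a b : adj_ok s -> eval s a = u -> eval s b = v ->
  (eval s (adjx a b) == 0) = ~~ e u v.
Proof.
move=> [_ h] ea eb; have [h1 <-] := h u v.
by rewrite /adjx !evalE ea eb h1 negbK.
Qed.

(* Every vertex is a candidate in round 0, since then 1 - vi = 1. *)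
Definition select_frontier : cmd :=
  Assign vbest (Cst 0) ;;
  For vu (IfZero (EArr Ain (Var vu))
    (IfZero (EAdd (EArr Acand (Var vu)) (ESub (Cst 1) (Var vi))) Skip
      (LoadReal 3 (Var vu) ;;
       IfZero (Var vbest) (Assign vbest (EAdd (Var vu) (Cst 1)) ;; LoadReal 2 (Var vu))
         (IfLe 3 2 (Assign vbest (EAdd (Var vu) (Cst 1)) ;; LoadReal 2 (Var vu)) Skip))) Skip).

Lemma select_frontier_spec s (F : pred 'I_n) : vars s 0 = n ->
  (forall v : 'I_n, F v = (arrs s Ain v == 0) && (arrs s Acand v + (1 - vars s vi) != 0)) ->
  (exists v, F v) ->
  exists q : 'I_n, [/\ vars (den select_frontier s) vbest = q.+1, F q & forall v, F v -> (w q <= w v)%R].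
Proof.
move=> hn hF [f Ff].
rewrite /select_frontier den_Seq denE evalE.
set c := IfZero _ _ _; set s0 := setv _ _ s.
pose Q j s' := (vars s' vbest = 0 /\ forall v : 'I_n, v < j -> ~~ F v) \/
  exists q : 'I_n, [/\ vars s' vbest = q.+1, F q, xregs s' 2 = w q
    & forall v : 'I_n, v < j -> F v -> (w q <= w v)%R].
have : Q n (den (For vu c) s0).
  apply: For_rule; first by rewrite !stE.
    by left; rewrite !stE; split.
    move=> j s1 hj [hv hA _ _] hQ.
    pose u := Ordinal hj.
    have uj (v : 'I_n) : v < j.+1 -> v = u \/ v < j.
      by rewrite ltnS leq_eqVlt => /predU1P[evu|]; [left; apply: val_inj | right].
    have eF : F u = (arrs s1 Ain j == 0) && (arrs s1 Acand j + (1 - vars s1 vi) != 0).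
      by rewrite hF hv // !hA // !stE.
    have skip : ~~ F u -> Q j.+1 (setv vu j s1).
      move=> nF; case: hQ => [[h1 h2]|[q [h1 h2 h3 h4]]].
        by left; rewrite !stE; split=> // v /uj[->|/h2].
      right; exists q; rewrite !stE; split=> // v /uj[->|/h4//]; by rewrite (negbTE nF).
    have take1 : F u -> (forall v : 'I_n, v < j -> F v -> (w u <= w v)%R) ->
        Q j.+1 (setx 2 (W j) (setv vbest (j + 1) (setx 3 (W j) (setv vu j s1)))).
      move=> Fu hmin; right; exists u; rewrite !stE /= -[j]/(val u) Ww addn1; split=> //.
      by move=> v /uj[->//|]; apply: hmin.
    rewrite /c den_IfZero !evalE !stE /= den_IfZero !evalE !stE /=.
    case: ifP => c1; last by rewrite denE; apply: skip; rewrite eF c1.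
    case: ifP => c2; first by rewrite denE; apply: skip; rewrite eF c1 c2.
    have Fu : F u by rewrite eF c1 c2.
    rewrite !denE !evalE den_IfZero !evalE !stE /= den_IfLe !stE /= !denE !evalE !stE /=.
    case: hQ => [[h1 h2]|[q [h1 h2 h3 h4]]].
      by rewrite h1 eqxx; apply: take1 => // v /h2/negbTE->.
    rewrite h1 /= h3 -[j in W j]/(val u) Ww.
    case: (lerP (w u) (w q)) => le.
      rewrite -Ww; apply: take1 => // v vj Fv; exact: le_trans le (h4 v vj Fv).
    right; exists q; rewrite !stE; split=> // v /uj[->|]; [by rewrite ltW | exact: h4].
  by move=> s1; rewrite /Q !stE.
case=> [[_ h]|[q [h1 h2 h3 h4]]]; first by have := h f (ltn_ord f); rewrite Ff.
by exists q; split=> // v; apply: h4.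
Qed.

Definition mark_frontier : cmd :=
  For vu (IfZero (adjx (Var vq) (Var vu)) Skip (StoreArr Acand (Var vu) (Cst 1))).

Lemma mark_frontier_spec s (q : 'I_n) : adj_ok s -> vars s vq = q ->
  forall v : 'I_n, (arrs (den mark_frontier s) Acand v != 0) = (arrs s Acand v != 0) || e q v.
Proof.
move=> hadj hq.
pose Q j s' := forall v : 'I_n, (arrs s' Acand v != 0) = (arrs s Acand v != 0) || ((v < j) && e q v).
suff h : Q n (den mark_frontier s) by move=> v; rewrite h ltn_ord.
apply: For_rule => //; first by case: hadj.
- by move=> v; rewrite orbF.
- move=> j s1 hj [hv hA _ _] hQ v; pose u := Ordinal hj.
  have hadj1 : adj_ok (setv vu j s1).
    by case: hadj => h1 h2; split; [rewrite !stE /= hv | move=> x y; rewrite !stE !hA].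
  rewrite den_IfZero (adj_okE (u := q) (v := u) hadj1); last 2 first.
  + by rewrite evalE !stE /= hv.
  + by rewrite evalE !stE eqxx.
  have vj : (v < j.+1) = (v == u) || (v < j) by rewrite ltnS leq_eqVlt.
  rewrite vj; case: ifP => qu.
    rewrite denE !stE hQ; case: (eqVneq v u) => [->|//].
    by rewrite (negbTE qu) !andbF.
  rewrite !denE !evalE !stE /= /= -[(v : nat) == j]/(v == u).
  by case: (eqVneq v u) => [->|_]; [move/negbFE: qu => ->; rewrite orbT | exact: hQ].
Qed.

(** Register 0 is the previous surrogate [x], register 1 runs through its multiples, register 2 is
    the cost of [vq]. The machine has no division, so the least multiple is found by at most [n]
    additions; if [n.+1] times [x] is still too small, the surrogate restarts at the cost, and
    [vyacc] has become [n.+1] times [vy]. *)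
Definition update_surrogate : cmd :=
  ZeroReal 1 ;; AddReal 1 1 0 ;; Assign vyacc (Var vy) ;; LoadReal 2 (Var vq) ;;
  For vu (IfLe 2 1 Skip (AddReal 1 1 0 ;; Assign vyacc (EAdd (Var vyacc) (Var vy)))) ;;
  IfLe 2 1 Skip (LoadReal 1 (Var vq)) ;;
  ZeroReal 0 ;; AddReal 0 0 1 ;; Assign vy (Var vyacc) ;; StoreArr AY (Var vq) (Var vy).

Lemma update_surrogate_spec s (q : 'I_n) (x := xregs s 0) (y := vars s vy) (s' := den update_surrogate s) :
  vars s 0 = n -> vars s vq = q -> (0 <= x)%R -> (x <= 2 * w q)%R ->
  [/\ arrs s' AY q = vars s' vy, (forall v : 'I_n, v != q -> arrs s' AY v = arrs s AY v),
      (w q <= xregs s' 0 <= 2 * w q)%R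
    & (exists c, [/\ 0 < c, vars s' vy = c * y & xregs s' 0 = (c%:R * x)%R]) \/
      (vars s' vy = n.+1 * y /\ (n.+1%:R * x <= xregs s' 0)%R)].
Proof.
move=> hn hq hx0 hx2.
rewrite /s' /update_surrogate !denE !evalE !stE /= add0r -/x -/y hq Ww.
set c := IfLe 2 1 Skip (_ ;; _); set s0 := setx 2 _ _.
have xn0 : xregs s0 2 = w q /\ xregs s0 0 = x /\ xregs s0 1 = x /\ vars s0 vyacc = y /\ vars s0 vy = y /\ vars s0 vq = q.
  by rewrite /s0 !stE.
have [x2 [x00 [x1 [ya [yy q0]]]]] := xn0.
(* [k] is the current multiplier. [k <= j] means that some earlier pass already found the multiple
   large enough; the last clause says that it is the least one. *)
pose Q j s' := exists k, [/\ 0 < k <= j.+1, xregs s' 1 = (k%:R * x)%R, vars s' vyacc = k * y,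
  (k <= j -> (w q <= k%:R * x)%R) & (1 < k -> (k.-1%:R * x < w q)%R)].
set s1 := den (For vu c) s0.
have eF r : ~~ writes_var (For vu c) r -> vars s1 r = vars s0 r by move=> h; rewrite /s1 frame_v.
have eX r : ~~ writes_xreg (For vu c) r -> xregs s1 r = xregs s0 r by move=> h; rewrite /s1 frame_x.
have eA k v : arrs s1 k v = arrs s0 k v by rewrite /s1 frame_a.
have [k [k1 k2 k3 k4 k5]] : Q n s1.
  apply: For_rule => //.
  - by exists 1; rewrite x1 ya !mul1n mul1r; split.
  - move=> j s2 hj [hv _ _ hX] [k [k1 k2 k3 k4 k5]].
    rewrite /c den_IfLe !stE k2 hX // x2.
    case: (lerP (w q) (k%:R * x)) => le; rewrite !denE ?evalE ?evalE ?evalE ?evalE.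
      exists k; rewrite !stE; split=> //; by move: k1; clear; lia.
    have kj : k = j.+1.
      by apply/eqP; rewrite eqn_leq; case/andP: k1 => _ ->; rewrite ltnNge; apply/negP => /k4; rewrite leNgt le.
    exists k.+1; rewrite !stE /= ?stE /= k2 k3 hX // x00 hv // yy; split=> //.
    + by clear -kj; lia.
    + by rewrite -addn1 natrD mulrDl mul1r.
    + by rewrite mulSn addnC.
    + by rewrite kj ltnn.
have [c1 c2] : writes_xreg c 2 = false /\ writes_xreg c 0 = false by [].
have q1 : vars s1 vq = q by rewrite eF.
clearbody s1.
rewrite den_IfLe eX // x2 k2.
have ax (z : 'I_n) : ((z : nat) == q) = (z == q) by [].
have other (v : 'I_n) : arrs s0 AY v = arrs s AY v by rewrite /s0 !stE.
case: (lerP (w q) (k%:R * x)) => le; rewrite !denE ?evalE ?stE ?stE ?stE ?stE /= ?q1 ?eqxx /= ?add0r.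
- split=> //.
  + by move=> v nv; rewrite !stE /= ?q1 ax (negbTE nv) eA other.
  (* For [k > 1] the last addition overshoots by less than [x <= k.-1 * x < w q], which gives the
     factor 2. For [k = 1] the bound on the previous surrogate is inherited. *)
  + rewrite k2 le /=; case: (ltnP 1 k) => k1'.
      have := k5 k1'; have kk : k = k.-1.+1 by clear -k1; lia.
      rewrite {2}kk -[in X in _ -> X]addn1 natrD mulrDl mul1r.
      have : (x <= k.-1%:R * x)%R.
        by rewrite -[X in (X <= _)%R]mul1r ler_wpM2r // ler1n; clear -k1'; lia.
      lra.
    have -> : k = 1 by clear -k1 k1'; lia.
    by rewrite mul1r.
  + by left; exists k; rewrite k2 k3; split=> //; case/andP: k1.
- have kn : k = n.+1.
    by apply/eqP; rewrite eqn_leq; case/andP: k1 => _ ->; rewrite ltnNge; apply/negP => /k4; rewrite leNgt le.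
  split=> //.
  + by move=> v nv; rewrite !stE /= ?q1 ax (negbTE nv) eA other.
  + by rewrite Ww lexx /=; have := w_ge0 q; lra.
  + by right; rewrite Ww k3 kn; split=> //; rewrite -kn ltW.
Qed.

Definition record_vertex : cmd :=
  Assign vq (ESub (Var vbest) (Cst 1)) ;; StoreArr Aord (Var vi) (Var vq) ;; StoreArr Ain (Var vq) (Cst 1).
(** Starting from [x = 0], vertices of cost 0 keep surrogate 0, and the first vertex of positive
    cost is a fresh start. *)
Definition prim_order : cmd :=
  ZeroReal 0 ;; Assign vy (Cst 1) ;; For vi (select_frontier ;; record_vertex ;; mark_frontier ;; update_surrogate).

Lemma record_vertexE s q : vars s vbest = q.+1 ->
  den record_vertex s = seta Ain q 1 (seta Aord (vars s vi) q (setv vq q s)).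
Proof. by move=> h; rewrite /record_vertex !denE !evalE !stE /= h subn1. Qed.

Definition prim_seq (o : seq 'I_n) :=
  [/\ uniq o,
     (forall k, 0 < k < size o -> exists2 j, j < k & forall u0, e (nth u0 o j) (nth u0 o k)),
     (forall j k, j <= k < size o -> (w (nth v0 o j) <= w (nth v0 o k))%R)
   & (forall j v, j < size o -> v \notin o -> (w (nth v0 o j) <= w v)%R)].

Definition sur_seq (o : seq 'I_n) (Yf : nat -> nat) (xf : nat -> R) :=
  [/\ (forall k, k < size o -> 0 < Yf k),
      (forall k, k < size o -> (w (nth v0 o k) <= xf k <= 2 * w (nth v0 o k))%R)
    & (forall k, k.+1 < size o ->
        (exists c, [/\ 0 < c, Yf k.+1 = c * Yf k & xf k.+1 = (c%:R * xf k)%R]) \/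
        (Yf k.+1 = n.+1 * Yf k /\ (n.+1%:R * xf k <= xf k.+1)%R))].

Hypothesis tree : is_tree e.
Hypothesis mono : down_monotonic e w.

(** By [frontier_low], a lightest frontier vertex is lightest among all remaining vertices, so the
    order stays ascending. *)
Lemma prim_choice (o : seq 'I_n) q : prim_seq o -> q \notin o ->
  (o != [::] -> exists2 u, u \in o & e u q) ->
  (forall v, v \notin o -> (o == [::]) || [exists u, (u \in o) && e u v] -> (w q <= w v)%R) ->
  prim_seq (rcons o q) /\ (forall v, v \notin o -> (w q <= w v)%R).
Proof.
move=> [h1 h2 h3 h4] qo hq hmin.
have low v : v \notin o -> (w q <= w v)%R.
  move=> vo; case: (eqVneq o [::]) => [eo|no]; first by apply: hmin; rewrite ?eo.
  have o0 : 0 < size o by case: (o) no.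
  have [|||s [f [so fo esf lef]]] := @frontier_low R _ e w tree (mem o) (nth v0 o 0) v mono.
  - exact: mem_nth.
  - move=> u; case: (boolP (u \in o)) => uo; last exact: h4.
    by rewrite -(nth_index v0 uo); apply: h3; rewrite index_mem.
  - exact: vo.
  apply: le_trans lef; apply: hmin => //; apply/orP; right; apply/existsP; exists s.
  by rewrite esf andbT.
split=> //; split.
- by rewrite rcons_uniq qo.
- move=> k; rewrite size_rcons ltnS [k <= _]leq_eqVlt => /andP[k0 /predU1P[ek|lt]].
    have no : o != [::] by case: (o) ek k0 => // ->.
    have [u uo euq] := hq no.
    exists (index u o); first by rewrite ek index_mem.
    by move=> u0; rewrite !nth_rcons index_mem uo nth_index // ek ltnn eqxx.
  have [|j jk hj] := h2 k; first by rewrite k0.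
  by exists j => // u0; rewrite !nth_rcons lt (ltn_trans jk lt).
- move=> j k; rewrite size_rcons ltnS [k <= _]leq_eqVlt => /andP[jk /predU1P[ek|lt]]; rewrite !nth_rcons.
    rewrite ek ltnn eqxx; move: jk; rewrite ek leq_eqVlt => /predU1P[->|lt]; first by rewrite ltnn eqxx.
    by rewrite lt; apply: h4.
  by rewrite lt (leq_ltn_trans jk lt); apply: h3; rewrite jk.
- move=> j v; rewrite size_rcons mem_rcons inE negb_or ltnS leq_eqVlt => /predU1P[ej|lt] /andP[nq vo];
    rewrite nth_rcons; first by rewrite ej ltnn eqxx low.
  by rewrite lt; apply: h4.
Qed.

Definition prim_inv i s := exists (o : seq 'I_n) (Yf : nat -> nat) (xf : nat -> R),
  [/\ size o = i /\ prim_seq o, sur_seq o Yf xf,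
      (forall j, j < i -> arrs s Aord j = nth v0 o j) /\
      (forall v : 'I_n, (arrs s Ain v != 0) = (v \in o)),
      (forall v : 'I_n, (arrs s Acand v != 0) = [exists u, (u \in o) && e u v])
    & [/\ (forall j, j < i -> arrs s AY (nth v0 o j) = Yf j),
      xregs s 0 = (if i == 0 then 0%R else xf i.-1) & vars s vy = (if i == 0 then 1 else Yf i.-1)]].

Lemma prim_order_spec s : adj_ok s ->
  (forall v : 'I_n, arrs s Ain v = 0) -> (forall v : 'I_n, arrs s Acand v = 0) ->
  prim_inv n (den prim_order s).
Proof.
move=> hadj hin hcand; rewrite /prim_order !denE !evalE.
set c := (_ ;; _); set s0 := setv _ _ _.
apply: For_rule.
- by rewrite /s0 !stE; case: hadj.
- exists [::], (fun=> 1), (fun=> 0%R); split=> //.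
  + split=> //; split=> //; by [move=> k /andP[] | move=> j k /andP[]].
  + by split=> // v; rewrite /s0 !stE hin.
  + by move=> v; rewrite /s0 !stE hcand; apply/esym/existsP => -[].
move=> i s1 hi [hv hA _ _] [o [Yf [xf [[so po] [sY sx sch] [hord hIn] hC [hY hx hy]]]]].
have hadj1 : adj_ok (setv vi i s1).
  case: hadj => h1 h2; split; first by rewrite stE /= hv // /s0 !stE.
  by move=> x y; rewrite !stE !hA // /s0 !stE.
have n1 : vars (setv vi i s1) 0 = n by case: hadj1.
pose F v := (v \notin o) && ((o == [::]) || [exists u, (u \in o) && e u v]).
have i0 : (i == 0) = (o == [::]) by rewrite -so; case: (o).
have [v1 v1o] : exists v, v \notin o.
  have : ~~ (size (enum 'I_n) <= size o) by rewrite size_enum_ord so -ltnNge.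
  case: (boolP [exists v, v \notin o]) => [/existsP[v hv1]|/existsPn h]; first by exists v.
  rewrite uniq_leq_size ?enum_uniq // => v _; have := h v; by rewrite negbK.
have [q [hbest Fq qmin]] : exists q : 'I_n, [/\ vars (den select_frontier (setv vi i s1)) vbest = q.+1, F q
    & forall v, F v -> (w q <= w v)%R].
  apply: select_frontier_spec => //.
    move=> v; rewrite !stE /= /F -hIn negbK; congr (_ && _).
    by rewrite addn_eq0 negb_and hC orbC -i0; case: (i) => // k; rewrite subn_eq0.
  case: (eqVneq o [::]) => [eo|no]; first by exists v1; rewrite /F v1o eo.
  have o0 : 0 < size o by case: (o) no.
  case: po => _ _ p3 p4.
  have [|||s' [f [so' fo esf _]]] := @frontier_low R _ e w tree (mem o) (nth v0 o 0) v1 mono.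
  - exact: mem_nth.
  - move=> u; case: (boolP (u \in o)) => uo; last exact: p4.
    by rewrite -(nth_index v0 uo); apply: p3; rewrite index_mem.
  - exact: v1o.
  exists f; rewrite /F fo; apply/orP; right; apply/existsP; exists s'.
  by rewrite esf andbT.
have /andP[qo Fq2] := Fq.
have [pq low] : prim_seq (rcons o q) /\ (forall v, v \notin o -> (w q <= w v)%R).
  apply: prim_choice => //.
    by move=> no; move: Fq2; rewrite (negbTE no) /= => /existsP[u /andP[]]; exists u.
  by move=> v vo h; apply: qmin; rewrite /F vo.
rewrite /c 3!den_Seq.
set s2 := den select_frontier _ in hbest *.
have e2v r : ~~ writes_var select_frontier r -> vars s2 r = vars (setv vi i s1) r by move=> h; rewrite /s2 frame_v.
have e2a k x : arrs s2 k x = arrs s1 k x by rewrite /s2 frame_a // stE.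
have e2x : xregs s2 0 = xregs s1 0 by rewrite /s2 frame_x // stE.
clearbody s2.
rewrite (record_vertexE hbest) e2v // stE /=.
set s3 := seta Ain _ _ _.
have e3v r : ~~ writes_var (select_frontier ;; record_vertex) r -> vars s3 r = vars (setv vi i s1) r.
  by move=> h; rewrite /s3 -e2v; [rewrite !stE; case: eqP h => // -> | move: h; apply: contra => /= ->].
have q3 : vars s3 vq = q by rewrite /s3 !stE.
have x3 : xregs s3 0 = xregs s1 0 by rewrite /s3 !stE.
have y3 : vars s3 vy = vars s1 vy by rewrite e3v // stE.
have a3 k x : k != Ain -> k != Aord -> arrs s3 k x = arrs s1 k x.
  by move=> /negbTE k1 /negbTE k2; rewrite /s3 !stE k1 k2 /= e2a.
have a3in x : arrs s3 Ain x = if x == q then 1 else arrs s1 Ain x by rewrite /s3 !stE /= e2a.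
have a3ord x : arrs s3 Aord x = if x == i then q : nat else arrs s1 Aord x by rewrite /s3 !stE /= e2a.
have adj3 : adj_ok s3.
  case: hadj1 => h1 h2; split; first by rewrite e3v.
  by move=> x y; rewrite !a3 //; have := h2 x y; rewrite !stE.
clearbody s3.
have mk := mark_frontier_spec adj3 q3.
set s4 := den mark_frontier s3 in mk *.
have e4v r : ~~ writes_var mark_frontier r -> vars s4 r = vars s3 r by move=> h; rewrite /s4 frame_v.
have e4a k x : k != Acand -> arrs s4 k x = arrs s3 k x.
  by move=> h; rewrite /s4 frame_a //= eq_sym.
have e4x : xregs s4 0 = xregs s3 0 by rewrite /s4 frame_x.
clearbody s4.
have n4 : vars s4 0 = n by rewrite e4v //; case: adj3.
have q4 : vars s4 vq = q by rewrite e4v.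
have x0 : (0 <= xregs s4 0)%R.
  rewrite e4x x3 hx; case: eqP => // /eqP; rewrite -lt0n => i1.
  have hk : i.-1 < size o by rewrite so prednK.
  by have /andP[h _] := sx _ hk; apply: le_trans h; apply: w_ge0.
have x2 : (xregs s4 0 <= 2 * w q)%R.
  rewrite e4x x3 hx; case: eqP => [_|/eqP]; first by rewrite mulr_ge0.
  rewrite -lt0n => i1; have hk : i.-1 < size o by rewrite so prednK.
  have /andP[_ h] := sx _ hk; apply: le_trans h _; rewrite ler_pM2l //.
  by case: po => _ _ _ p4; apply: p4.
have [g1 g2 g3 g4] := update_surrogate_spec n4 q4 x0 x2.
set s5 := den update_surrogate s4 in g1 g2 g3 g4 *.
have e5a k x : k != AY -> arrs s5 k x = arrs s4 k x.
  by move=> h; rewrite /s5 frame_a //= ?orbF eq_sym.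
clearbody s5.
have eqn (v : 'I_n) : ((v : nat) == q) = (v == q) by [].
exists (rcons o q), (fun k => if k == i then vars s5 vy else Yf k), (fun k => if k == i then xregs s5 0 else xf k).
split.
- by rewrite size_rcons so.
- split.
  + move=> k; rewrite size_rcons ltnS leq_eqVlt => /predU1P[->|lt].
      rewrite so eqxx; case: g4 => [[c' [c0 -> _]]|[-> _]]; rewrite muln_gt0 ?c0 //=;
      rewrite e4v // y3 hy; case: eqP => // /eqP; rewrite -lt0n => i1; apply: sY; by rewrite so prednK.
    by rewrite -so (ltn_eqF lt) sY.
  + move=> k; rewrite size_rcons ltnS leq_eqVlt nth_rcons => /predU1P[->|lt].
      by rewrite ltnn so !eqxx.
    by rewrite -so lt (ltn_eqF lt) sx.
  + move=> k; rewrite size_rcons ltnS leq_eqVlt => /predU1P[ek|lt]; last first.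
      by rewrite -so (ltn_eqF lt) (ltn_eqF (ltnW lt)); apply: sch.
    have ki : k.+1 = i by rewrite -so.
    rewrite -ki eqxx (ltn_eqF (ltnSn k)).
    by move: g4; rewrite e4x x3 hx e4v // y3 hy -ki.
- split.
  + move=> j; rewrite ltnS leq_eqVlt e5a // e4a // a3ord nth_rcons so => /predU1P[->|lt].
      by rewrite ltnn eqxx.
    by rewrite lt (ltn_eqF lt) hord.
  + move=> v; rewrite e5a // e4a // a3in mem_rcons inE eqn; case: (eqVneq v q) => //= _; exact: hIn.
- move=> v; rewrite e5a // mk a3 // hC.
  apply/orP/existsP => [[/existsP[u /andP[uo h]]|h]|[u]].
  + by exists u; rewrite mem_rcons inE uo orbT.
  + by exists q; rewrite mem_rcons mem_head.
  + rewrite mem_rcons inE => /andP[/predU1P[->|uo] h]; [by right | left].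
    by apply/existsP; exists u; rewrite uo.
- split=> //=.
  + move=> j; rewrite ltnS leq_eqVlt nth_rcons so => /predU1P[->|lt].
      by rewrite ltnn !eqxx.
    rewrite lt (ltn_eqF lt) g2; first by rewrite e4a // a3 // hY.
    apply: contraNneq qo => <-; apply: mem_nth; by rewrite so.
  + by rewrite eqxx.
  + by rewrite eqxx.
by move=> s1; rewrite /prim_inv !stE.
Qed.

(** * Computing the greedy ranking *)

Definition merge_labels : cmd :=
  For vu (IfZero (EArr Alab (Var vu)) Skip
    (IfZero (adjx (ESub (EArr Alab (Var vu)) (Cst 1)) (Var vq)) Skip
      (StoreArr Alab (Var vu) (EAdd (Var vq) (Cst 1))))).

(** In the greedy run the labelled vertices come after [q] in the Prim order, so the component roots
    adjacent to [q] are its children, and what is visible from them becomes a candidate below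
    [q]. *)
Lemma merge_labels_spec s (q : 'I_n) : adj_ok s -> vars s vq = q ->
  (forall u : 'I_n, arrs s Alab u <= n) ->
  forall u : 'I_n, arrs (den merge_labels s) Alab u =
    if [exists c : 'I_n, (arrs s Alab u == c.+1) && e c q] then q.+1 else arrs s Alab u.
Proof.
move=> hadj hq hlab.
pose Q j s' := forall u : 'I_n, arrs s' Alab u =
  if (u < j) && [exists c : 'I_n, (arrs s Alab u == c.+1) && e c q] then q.+1 else arrs s Alab u.
suff h : Q n (den merge_labels s) by move=> u; rewrite h ltn_ord.
apply: For_rule => //; first by case: hadj.
move=> j s1 hj [hv hA _ _] hQ; pose u := Ordinal hj.
have hadj1 : adj_ok (setv vu j s1).
  by case: hadj => h1 h2; split; [rewrite !stE /= hv | move=> x y; rewrite !stE !hA].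
have labj : arrs s1 Alab j = arrs s Alab j by rewrite (hQ u) ltnn.
have skip : ~~ [exists c : 'I_n, (arrs s Alab u == c.+1) && e c q] -> Q j.+1 (setv vu j s1).
  move=> no v; rewrite stE hQ ltnS [v <= j]leq_eqVlt; case: (eqVneq (v : nat) j) => [evu|//].
  by rewrite (@val_inj _ _ 'I_n v u evu) (negbTE no) !andbF.
rewrite den_IfZero !evalE !stE /= labj; case: (posnP (arrs s Alab j)) => [l0|l1].
  rewrite denE; apply: skip; apply/existsPn => c; by rewrite /= l0.
have lc : (arrs s Alab j).-1 < n by rewrite prednK // (hlab u).
rewrite den_IfZero (adj_okE (u := Ordinal lc) (v := q) hadj1); last 2 first.
- by rewrite !evalE !stE /= labj subn1.
- by rewrite !evalE !stE /= hv.
have ex : [exists c : 'I_n, (arrs s Alab u == c.+1) && e c q] = e (Ordinal lc) q.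
  apply/existsP/idP => [[c /andP[/eqP h]]|h].
    by congr (e _ _); apply: val_inj; rewrite /= -[j]/(val u) h.
  by exists (Ordinal lc); rewrite h andbT /= prednK.
case: ifP => ecq; first by rewrite denE; apply: skip; rewrite ex ecq.
rewrite !denE !evalE !stE /= hv // hq addn1 => v; rewrite !stE /= ltnS [v <= j]leq_eqVlt.
case: (eqVneq (v : nat) j) => [evu|ne] /=; last exact: hQ.
have -> : v = u by apply: val_inj.
by rewrite ex; move/negbFE: ecq => ->.
Qed.

Definition test_fit : cmd :=
  Assign vbad (ESub (EAdd (Var vp) (EAdd (EArr AY (Var vq)) (EArr AY (Var vu)))) (EArr Ah (Var vu))) ;;
  For vz (IfZero (eqx (EArr Alab (Var vz)) (EAdd (Var vq) (Cst 1)))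
    (IfZero (eqx (Var vu) (Var vz)) Skip
      (IfZero (ESub (EAdd (EArr Ah (Var vu)) (EArr AY (Var vz))) (EArr Ah (Var vz))) Skip
        (IfZero (ESub (EAdd (EArr Ah (Var vz)) (EArr AY (Var vu))) (EArr Ah (Var vu))) Skip
          (Assign vbad (Cst 1))))) Skip).

Section Place.
Variables (q : 'I_n) (U : pred 'I_n) (Y h : 'I_n -> nat).

Definition viol p u := (h u < p + (Y q + Y u)) || [exists z, [&& U z, z != u & ~~ disj Y h u z]].

Definition place_ok s := [/\ vars s 0 = n, vars s vq = q & forall u : 'I_n,
  [/\ (arrs s Alab u == q.+1) = U u, arrs s AY u = Y u & arrs s Ah u = h u]].

Lemma test_fit_spec s (u : 'I_n) : place_ok s -> vars s vu = u ->
  (vars (den test_fit s) vbad != 0) = viol (vars s vp) u.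
Proof.
move=> [hn hq hs] hu; rewrite /test_fit !denE !evalE.
set s0 := setv _ _ s.
pose Q j s' := (vars s' vbad != 0) = (h u < vars s vp + (Y q + Y u)) ||
  [exists z : 'I_n, (z < j) && [&& U z, z != u & ~~ disj Y h u z]].
set c := For vz _; suff : Q n (den c s0).
  rewrite /Q => ->; congr (_ || _); apply: eq_existsb => z; by rewrite ltn_ord.
apply: For_rule.
- by rewrite /s0 !stE.
- rewrite /Q /s0 !stE /= hq hu; have [_ -> ->] := hs u; have [_ -> _] := hs q.
  rewrite subn_eq0 -ltnNge; case: (_ < _) => //=.
  by apply/esym/existsP => -[].
- move=> j s1 hj [hv hA _ _] hQ; pose z := Ordinal hj.
  have [l1 y1 h1] : [/\ (arrs s1 Alab j == q.+1) = U z, arrs s1 AY j = Y z & arrs s1 Ah j = h z].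
    by rewrite !hA // /s0 !stE; apply: (hs z).
  have [_ yu hu1] : [/\ (arrs s1 Alab u == q.+1) = U u, arrs s1 AY u = Y u & arrs s1 Ah u = h u].
    by rewrite !hA // /s0 !stE; apply: (hs u).
  have q1 : vars s1 vq = q by rewrite hv // /s0 stE.
  have u1 : vars s1 vu = u by rewrite hv // /s0 stE.
  have ex : [exists x : 'I_n, (x < j.+1) && [&& U x, x != u & ~~ disj Y h u x]] =
     [exists x : 'I_n, (x < j) && [&& U x, x != u & ~~ disj Y h u x]] || [&& U z, z != u & ~~ disj Y h u z].
    apply/existsP/orP => [[x]|].
      rewrite ltnS leq_eqVlt => /andP[/predU1P[ex|lt] hx]; last by left; apply/existsP; exists x; rewrite lt.
      by right; have -> : z = x by apply: val_inj; rewrite /= ex.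
    case=> [/existsP[x /andP[lt hx]]|hx]; first by exists x; rewrite hx andbT ltnW.
    by exists z; rewrite ltnSn.
  have no : ~~ [&& U z, z != u & ~~ disj Y h u z] -> Q j.+1 (setv vz j s1).
    by move=> /negbTE nz; rewrite /Q ex nz orbF stE /= hQ.
  rewrite den_IfZero eval_eqx !evalE !stE /= q1 addn1 l1.
  case: ifP => Uz; last by rewrite denE; apply: no; rewrite Uz.
  rewrite den_IfZero eval_eqx !evalE !stE /= u1 -[(u : nat) == j]/(u == z) eq_sym.
  case: ifP => zu; first by rewrite denE; apply: no; rewrite zu andbF.
  rewrite den_IfZero !evalE !stE /= u1 hu1 y1 h1 subn_eq0.
  case: ifP => d1; first by rewrite denE; apply: no; rewrite /disj d1 /= !andbF.
  rewrite den_IfZero !evalE !stE /= u1 hu1 yu h1 subn_eq0.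
  case: ifP => d2; first by rewrite denE; apply: no; rewrite /disj d2 orbT /= !andbF.
  rewrite denE evalE /Q ex !stE /= Uz zu /disj d1 d2 /=; by rewrite !orbT.
- by move=> s1; rewrite /Q !stE.
Qed.

Definition fine p := forall u, U u -> p < h u -> ~~ viol p u.

Definition raise_pass : cmd :=
  For vu (IfZero (eqx (EArr Alab (Var vu)) (EAdd (Var vq) (Cst 1)))
    (IfZero (ESub (EArr Ah (Var vu)) (Var vp)) Skip
      (test_fit ;; IfZero (Var vbad) Skip (Assign vp (EArr Ah (Var vu))))) Skip).

Lemma place_frame c s : place_ok s -> ~~ writes_var c 0 -> ~~ writes_var c vq -> ~~ writes_arr c Alab -> ~~ writes_arr c AY ->
  ~~ writes_arr c Ah -> place_ok (den c s).
Proof.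
by move=> [h1 h2 h3] *; split; rewrite ?frame_v // => u; rewrite !frame_a.
Qed.

Lemma place_setv s d v : place_ok s -> d != 0 -> d != vq -> place_ok (setv d v s).
Proof.
move=> [h1 h2 h3] /negbTE d0 /negbTE dq.
by split; rewrite ?stE 1?eq_sym ?d0 1?[_ == d]eq_sym ?dq.
Qed.

(** Raising the slot never cures a violation by [u] except by hiding [u]. Each raise made by
    [raise_pass] is therefore forced. *)
Lemma fine_le p q' u : fine q' -> U u -> p <= q' -> p < h u -> viol p u -> h u <= q'.
Proof.
move=> fq Uu le lt vp'; rewrite leqNgt; apply/negP => lt2.
have := fq u Uu lt2; rewrite /viol negb_or -leqNgt => /andP[h1 h2].
move: vp'; rewrite /viol (negbTE h2) orbF; clear -h1 le; lia.
Qed.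

Lemma raise_pass_spec s : place_ok s -> let p0 := vars s vp in let p1 := vars (den raise_pass s) vp in
  [/\ p0 <= p1, (p1 = p0 -> fine p0), (fine p0 -> p1 = p0),
      p1 = p0 \/ (exists2 u, U u & p1 = h u)
    & forall q', fine q' -> p0 <= q' -> p1 <= q'].
Proof.
move=> hok p0.
pose Q j s' := [/\ place_ok s', p0 <= vars s' vp,
  (vars s' vp = p0 -> forall u : 'I_n, u < j -> U u -> p0 < h u -> ~~ viol p0 u),
  (fine p0 -> vars s' vp = p0) &
  (vars s' vp = p0 \/ (exists2 u, U u & vars s' vp = h u)) /\
  forall q', fine q' -> p0 <= q' -> vars s' vp <= q'].
suff [_ h1 h2 h3 [h4 h5]] : Q n (den raise_pass s).
  by split=> // E u; apply: h2.
apply: For_rule.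
- by case: hok.
- by split=> //; split=> //; left.
- move=> j s1 hj _ [ok1 g1 g2 g3 [g4 g5]]; pose u := Ordinal hj.
  have [n1 q1 hs1] := ok1; have [l1 y1 h1] := hs1 u.
  have ok2 : place_ok (setv vu j s1) by apply: place_setv.
  have keep : (vars s1 vp = p0 -> U u -> p0 < h u -> ~~ viol p0 u) -> Q j.+1 (setv vu j s1).
    move=> hu; split; rewrite ?stE //= => E v; rewrite ltnS leq_eqVlt => /predU1P[evu|]; last exact: g2.
    by rewrite (@val_inj _ _ 'I_n v u evu); apply: hu.
  rewrite den_IfZero eval_eqx !evalE !stE /= q1 addn1 l1.
  case: ifP => Uu; last by rewrite denE; apply: keep; rewrite Uu.
  rewrite den_IfZero !evalE !stE /= h1 subn_eq0.
  case: ifP => le; first by rewrite denE; apply: keep => <- _; rewrite ltnNge le.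
  have lt : vars s1 vp < h u by rewrite ltnNge le.
  rewrite den_Seq den_IfZero evalE.
  have vu2 : vars (setv vu j s1) vu = u by rewrite stE.
  have bad := test_fit_spec ok2 vu2; rewrite stE /= in bad.
  have ok3 : place_ok (den test_fit (setv vu j s1)) by apply: place_frame.
  have p3 : vars (den test_fit (setv vu j s1)) vp = vars s1 vp by rewrite frame_v // stE.
  have u3 : vars (den test_fit (setv vu j s1)) vu = u by rewrite frame_v // stE.
  set s3 := den test_fit _ in bad ok3 p3 u3 *; clearbody s3.
  have [n3 q3 hs3] := ok3; have [_ _ h3] := hs3 u.
  case: ifP => b0.
    rewrite denE; have nv : ~~ viol (vars s1 vp) u by rewrite -bad b0.
    split; rewrite ?p3 // => E v; rewrite ltnS leq_eqVlt => /predU1P[evu|]; last exact: g2.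
    have -> : v = u by apply: val_inj.
    by rewrite -E.
  have vv : viol (vars s1 vp) u by rewrite -bad b0.
  rewrite !denE !evalE u3 h3; split; rewrite ?stE /=.
  + by apply: place_setv.
  + by apply: leq_trans g1 (ltnW lt).
  + by move=> E; move: g1 lt; rewrite E; clear; lia.
  + by move=> f0; have := f0 u Uu; rewrite -(g3 f0) => /(_ lt); rewrite vv.
  + split; first by right; exists u.
    by move=> q' fq le'; apply: fine_le vv => //; apply: g5.
- by move=> s1 [g0 g1 g2 g3 g4]; split; rewrite ?stE //; apply: place_setv.
Qed.

Definition place_query : cmd := Assign vp (Cst 0) ;; For vround raise_pass.

(** A pass that changes [vp] raises it to the rank of a visible vertex, so the number [N] of visible
    vertices above [vp] drops. It is at most [n] at the start, hence [n] passes suffice. *)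
Lemma place_query_spec s : place_ok s -> let p := vars (den place_query s) vp in
  [/\ fine p, (p = 0 \/ exists2 u, U u & p = h u) & forall q', fine q' -> p <= q'].
Proof.
move=> hok; rewrite /place_query !denE evalE.
pose N p := #|[pred u | U u && (p < h u)]|.
pose Q k s' := [/\ place_ok s', (fine (vars s' vp) \/ N (vars s' vp) + k <= n),
  (vars s' vp = 0 \/ exists2 u, U u & vars s' vp = h u) & forall q', fine q' -> vars s' vp <= q'].
suff [_ h1 h2 h3] : Q n (den (For vround raise_pass) (setv vp 0 s)).
  split=> //; case: h1 => // hN u Uu lt.
  suff : 0 < N (vars (den (For vround raise_pass) (setv vp 0 s)) vp) by clear -hN; lia.
  by apply/card_gt0P; exists u; rewrite inE Uu.
apply: For_rule.
- by rewrite stE; case: hok.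
- split; rewrite ?stE /=; [exact: place_setv | right | by left | by []].
  by rewrite addn0 -[X in _ <= X]card_ord max_card.
- move=> k s1 hk _ [ok1 g1 g2 g3].
  have ok2 : place_ok (setv vround k s1) by apply: place_setv.
  have := raise_pass_spec ok2; rewrite stE /=.
  set p1 := vars (den raise_pass _) vp; set p0 := vars s1 vp in g1 g2 g3 *.
  case=> [f1 f2 f3 f4 f5]; split.
  + exact: place_frame.
  + case: (eqVneq p1 p0) => [E|ne]; first by left; rewrite -/p1 E; apply: f2.
    case: g1 => [fp|hN]; first by rewrite (f3 fp) eqxx in ne.
    right; rewrite addnS -addSn; apply: leq_trans hN; rewrite leq_add2r.
    case: f4 => [E|[u Uu E]]; first by rewrite E eqxx in ne.
    have lt : p0 < p1 by rewrite ltn_neqAle eq_sym ne.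
    apply: proper_card; apply/properP; split.
      by apply/subsetP => x; rewrite !inE => /andP[-> h1]; apply: ltn_trans lt h1.
    by exists u; rewrite !inE Uu /=; [rewrite -E | rewrite -/p1 E ltnn].
  + by case: f4 => [E|[u Uu E]]; [rewrite -/p1 E; exact: g2 | right; exists u].
  + by move=> q' fq; apply: f5 => //; apply: g3.
- by move=> s1 [g0 g1 g2 g3]; split; rewrite ?stE //; apply: place_setv.
Qed.

End Place.

Definition hide_below : cmd :=
  StoreArr Ah (Var vq) (EAdd (Var vp) (EArr AY (Var vq))) ;;
  For vu (IfZero (eqx (EArr Alab (Var vu)) (EAdd (Var vq) (Cst 1)))
    (IfZero (ESub (EArr Ah (Var vu)) (EArr Ah (Var vq))) (StoreArr Alab (Var vu) (Cst 0)) Skip) Skip) ;;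
  StoreArr Alab (Var vq) (EAdd (Var vq) (Cst 1)).

Lemma hide_below_spec s (q : 'I_n) (H := vars s vp + arrs s AY q) (s' := den hide_below s) :
  vars s 0 = n -> vars s vq = q ->
  (forall u : 'I_n, arrs s' Ah u = if u == q then H else arrs s Ah u) /\
  (forall u : 'I_n, arrs s' Alab u = if u == q then q.+1 else
     if (arrs s Alab u == q.+1) && (arrs s Ah u <= H) then 0 else arrs s Alab u).
Proof.
move=> hn hq; rewrite /s' /hide_below 2!den_Seq [den (StoreArr Ah _ _) _]den_StoreArr !evalE hq.
set c := IfZero _ _ _; set s0 := seta Ah _ _ s; set s1 := den (For vu c) s0.
have eqn (u : 'I_n) : ((u : nat) == q) = (u == q) by [].
have h0 (u : 'I_n) : arrs s0 Ah u = if u == q then H else arrs s Ah u by rewrite /s0 !stE /= eqn.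
have l0 x : arrs s0 Alab x = arrs s Alab x by rewrite /s0 !stE.
have q1 : vars s1 vq = q by rewrite /s1 frame_v // /s0 stE.
have h1 (u : 'I_n) : arrs s1 Ah u = if u == q then H else arrs s Ah u by rewrite -h0 /s1 frame_a.
pose Q j s' := forall u : 'I_n, arrs s' Alab u =
   if [&& u < j, arrs s Alab u == q.+1 & arrs s0 Ah u <= H] then 0 else arrs s Alab u.
have hQ : Q n s1.
  apply: For_rule; [by rewrite /s0 stE | by move=> u | | by move=> s2; rewrite /Q stE].
  move=> j s2 hj [hv hA _ _] hQ; pose u := Ordinal hj.
  have q2 : vars s2 vq = q by rewrite hv // /s0 stE.
  have lj : arrs s2 Alab j = arrs s Alab j by rewrite (hQ u) ltnn.
  have skip : ~~ ((arrs s Alab j == q.+1) && (arrs s0 Ah j <= H)) -> Q j.+1 (setv vu j s2).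
    move=> no v; rewrite stE hQ ltnS [v <= j]leq_eqVlt; case: (eqVneq (v : nat) j) => [evu|//].
    by rewrite evu ltnn /= (negbTE no).
  rewrite /c den_IfZero eval_eqx !evalE !stE /= q2 addn1 lj.
  case: ifP => e1; last by rewrite denE; apply: skip; rewrite e1.
  rewrite den_IfZero !evalE !stE /= q2 !hA // subn_eq0 h0 eqxx.
  case: ifP => e2; last by rewrite denE; apply: skip; rewrite e1 e2.
  rewrite !denE !evalE !stE /= => v; rewrite !stE /= ltnS [v <= j]leq_eqVlt.
  by case: (eqVneq (v : nat) j) => [evu|ne] /=; [rewrite evu e1 e2 | exact: hQ].
clearbody s1; split=> u; rewrite den_StoreArr !evalE q1 !stE /=; first by rewrite h1.
rewrite eqn addn1.
case: eqVneq => [//|nq]; by rewrite hQ ltn_ord h0 (negbTE nq).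
Qed.

Definition greedy_ranking : cmd :=
  For vi (Assign vq (EArr Aord (ESub (ESub (Var 0) (Cst 1)) (Var vi))) ;; merge_labels ;; place_query ;; hide_below).

Section GreedyRun.
Variable o : seq 'I_n.
Hypothesis o_uniq : uniq o.
Hypothesis o_size : size o = n.
Let idx v := index v o.
Variable Y : 'I_n -> nat.
Hypothesis par_uniq : forall c z1 z2, child e idx c z1 -> child e idx c z2 -> z1 = z2.
Hypothesis Y_dvd : forall c v, child e idx c v -> Y v %| Y c.

(* Alab u = c + 1 when u is visible from c, the root of its processed
   component, and 0 when u is hidden or unprocessed. *)
Definition greedy_inv i s :=
  let h (v : 'I_n) := arrs s Ah v in
  [/\ (forall v, n - i <= idx v -> greedy_at e Y idx h v),
      (forall u : 'I_n, arrs s Alab u <= n)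
    & forall u c : 'I_n, arrs s Alab u = c.+1 <->
       [/\ n - i <= idx c, vis e idx h c u & forall z, child e idx c z -> idx z < n - i]].

Lemma greedy_ranking_spec s : adj_ok s -> (forall j, j < n -> arrs s Aord j = nth v0 o j) ->
  (forall v : 'I_n, arrs s AY v = Y v) -> (forall v : 'I_n, arrs s Alab v = 0) ->
  greedy e Y idx (fun v => arrs (den greedy_ranking s) Ah v).
Proof.
move=> hadj hord hY hlab.
have o_all v : v \in o.
  have := @uniq_min_size _ o (enum 'I_n) o_uniq; rewrite size_enum_ord o_size.
  by case=> // [x _|_ ->]; rewrite mem_enum.
have idx_lt v : idx v < n by rewrite -o_size index_mem.
have idx_inj := idx_inj_o o_all.
suff [h _ _] : greedy_inv n (den greedy_ranking s) by move=> v; apply: h; rewrite subnn.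
apply: For_rule.
- by case: hadj.
- split=> [v|u|u c]; rewrite ?subn0 ?hlab //; first by have := idx_lt v; lia.
  by split=> // -[]; have := idx_lt c; lia.
move=> i s1 hi [hv hA _ _] [g1 g2 g3].
pose k := n - i; have k0 : 0 < k by rewrite subn_gt0.
have kn : k.-1 < n by rewrite prednK // leq_subr.
pose q := nth v0 o k.-1.
have idq : idx q = k.-1 by rewrite /idx index_uniq ?o_size.
have kS : n - i.+1 = k.-1 by rewrite subnS.
have n1 : vars s1 0 = n by rewrite hv //; case: hadj.
rewrite 3!den_Seq den_Assign !evalE !stE /= n1 (_ : n - 1 - i = k.-1); last first.
  by rewrite -subnDA add1n subnS.
rewrite hA // hord // -/q.
set s2 := setv vq q _.
have q2 : vars s2 vq = q by rewrite /s2 stE.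
have n2 : vars s2 0 = n by rewrite /s2 !stE.
have a2 : arrs s2 = arrs s1 by rewrite /s2 !stE.
clearbody s2.
have adj2 : adj_ok s2.
  by case: hadj => h1 h2; split=> // x y; rewrite a2 !hA.
have un := merge_labels_spec adj2 q2; rewrite a2 in un; have {}un := un g2.
set s3 := den merge_labels s2 in un *.
have q3 : vars s3 vq = q by rewrite /s3 frame_v.
have n3 : vars s3 0 = n by rewrite /s3 frame_v.
have h3 x : arrs s3 Ah x = arrs s1 Ah x by rewrite /s3 frame_a // a2.
have y3 x : arrs s3 AY x = arrs s1 AY x by rewrite /s3 frame_a // a2.
clearbody s3.
pose h (v : 'I_n) := arrs s1 Ah v.
pose U (u : 'I_n) := arrs s3 Alab u == q.+1.
have yY (v : 'I_n) : arrs s3 AY v = Y v by rewrite y3 hA.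
have ok3 : place_ok q U Y h s3 by split=> // u; split; rewrite ?yY ?h3.
have hlt c : child e idx c q -> k <= idx c by case/andP => _; rewrite idq prednK.
have noq (u : 'I_n) : arrs s1 Alab u != q.+1.
  apply/eqP => /(g3 u q)[]; rewrite idq -/k; clear -k0; lia.
have UE u : U u <-> visible_below e idx h q u.
  rewrite /U un; split.
    case: ifP => [/existsP[c /andP[/eqP /(g3 u c)[c1 c2 c3] ecq]] _|_]; last by rewrite (negbTE (noq u)).
    by exists c => //; rewrite /child ecq idq; rewrite -/k in c1; clear -c1 k0; lia.
  case=> c ch vu; rewrite ifT //; apply/existsP; exists c.
  case/andP: (ch) => -> _; rewrite andbT; apply/eqP/g3; split=> //; first exact: hlt.
  by move=> z chz; rewrite (par_uniq chz ch) idq -/k; clear -k0; lia.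
have [f1 f2 f3] := place_query_spec ok3.
set s4 := den place_query s3 in f1 f2 f3 *.
have q4 : vars s4 vq = q by rewrite /s4 frame_v.
have n4 : vars s4 0 = n by rewrite /s4 frame_v.
have a4 x y : arrs s4 x y = arrs s3 x y by rewrite /s4 frame_a.
clearbody s4.
have [h5 l5] := hide_below_spec n4 q4; rewrite a4 yY in h5 l5.
set s5 := den hide_below s4 in h5 l5 *; clearbody s5.
set p := vars s4 vp in f1 f2 f3 h5 l5.
pose h' (v : 'I_n) := arrs s5 Ah v.
have hh' v : v != q -> h' v = h v by move=> nq; rewrite /h' h5 (negbTE nq) a4 h3.
have hq' : h' q = p + Y q by rewrite /h' h5 eqxx.
have above c : c != q -> k.-1 <= idx c -> k <= idx c.
  move=> nq; have : idx c != k.-1 by rewrite -idq; apply: contra nq => /eqP/idx_inj->.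
  by clear -k0; lia.
have ext z : idx q < idx z -> h z = h' z.
  by move=> lt; rewrite hh' //; apply: contraTneq lt => ->; rewrite ltnn.
have extS v z : k <= idx v -> idx v <= idx z -> h z = h' z.
  by move=> l1 l2; apply: ext; rewrite idq; clear -l1 l2 k0; lia.
have Yge u : U u -> Y u <= h u /\ Y u %| h u.
  move=> /UE vb; have [] := g1 u; first by have := visible_idx vb; rewrite idq -/k; clear; lia.
  by [].
(* The two notions differ by moving [Y u] across an inequality, which is sound for truncated
   subtraction because [Y u <= h u]. *)
have fits_fine t : fits e Y idx h q t <-> fine q U Y h t.
  split=> ft u Uu lt.
    have /UE vb := Uu; have [t1 t2] := ft u vb lt; have [yu _] := Yge u Uu.
    rewrite /viol negb_or -leqNgt; apply/andP; split; first by clear -t1 yu lt; lia.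
    apply/existsPn => z; apply/negP => /and3P[/UE Uz zu]; by rewrite (t2 z Uz zu).
  have Uu' : U u by apply/UE.
  have [yu _] := Yge u Uu'.
  have := ft u Uu' lt; rewrite /viol negb_or -leqNgt => /andP[t1 /existsPn t2].
  split; first by clear -t1 yu; lia.
  move=> u2 /UE Uu2 ne; have := t2 u2; by rewrite Uu2 ne /= negbK.
have gq : greedy_at e Y idx h' q.
  split; rewrite ?hq' ?addnK ?leq_addl //.
  (* The slot of [q] starts at 0 or at the rank of a visible vertex below [q]; [Y q] divides both,
     which is the alignment required by [greedy_at]. *)
  + rewrite dvdn_addr //; case: f2 => [->|[u Uu ->]]; first exact: dvdn0.
    have [_ d] := Yge u Uu; have /UE[c ch vu] := Uu.
    apply: dvdn_trans d; apply: dvdn_trans (Y_dvd ch) _.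
    exact: (desc_dvd Y_dvd (vis_desc vu)).
  + by apply: (fits_ext ext); apply/fits_fine.
  + move=> t ft; apply: f3; apply/fits_fine; apply: fits_ext ft => z lt; exact/esym/ext.
split; rewrite ?kS.
- move=> v hv'; case: (eqVneq v q) => [->//|nq].
  have vk := above v nq hv'.
  have [t1 t2 t3 t4] := g1 v vk.
  have evu : h' v = h v by apply: hh'.
  have extv z : idx v < idx z -> h z = h' z by move=> lt; apply: (extS v) => //; apply: ltnW.
  split; rewrite -/(h' v) ?evu //.
  + exact: (fits_ext extv).
  + by move=> t ft; apply: t4; apply: fits_ext ft => z lt; exact/esym/extv.
- move=> u; rewrite l5 a4 un; case: ifP => // _; case: ifP => // _; by case: ifP.
move=> u c; rewrite l5 !a4 h3 -/(U u) -/(h u) -hq'.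
have visC c0 x : k <= idx c0 -> vis e idx h' c0 x -> vis e idx h c0 x.
  by move=> lk; apply: vis_ext => z lz; apply/esym/(extS c0).
have Ulab : ~~ U u -> arrs s3 Alab u = arrs s1 Alab u.
  by rewrite /U un; case: ifP; rewrite ?eqxx.
(* A vertex that is visible below [q] was labelled with a child of [q], and such a child is no
   longer the root of a component. *)
have absorbed : U u -> c != q -> k.-1 <= idx c -> vis e idx h' c u ->
    (forall z, child e idx c z -> idx z < k.-1) -> False.
  move=> Uu nq c1 c2 c3; have ck := above c nq c1.
  have c2' : vis e idx h c u by apply: visC c2.
  have lab : arrs s1 Alab u = c.+1.
    apply/g3; split=> // z /c3; rewrite -/k; clear -k0; lia.
  have : [exists c' : 'I_n, (arrs s1 Alab u == c'.+1) && e c' q].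
    by move: Uu; rewrite /U un; case: ifP => // _; rewrite (negbTE (noq u)).
  case/existsP => c' /andP[/eqP E ecq]; move: E; rewrite lab => -[/val_inj E].
  have : child e idx c q by rewrite /child E ecq -E idq; clear -ck k0; lia.
  by move/c3; rewrite idq ltnn.
case: (eqVneq u q) => [->|uq].
  split=> [[/val_inj <-]|[c1 c2 c3]].
    split; [by rewrite idq | exact: vis0 | by move=> z /andP[_]; rewrite idq].
  have := desc_idx (vis_desc c2); rewrite idq => le.
  have eqc : idx q = idx c by rewrite idq; clear -c1 le; lia.
  by rewrite (idx_inj _ _ eqc).
have hu := hh' u uq.
case Uu: (U u) => /=.
  have /UE vb := Uu.
  case: leqP => le.
    split=> // -[c1 c2 c3]; exfalso; case: (eqVneq c q) => [ec|nq].
      move: c2; rewrite ec => /vis_inv[eu|[_ lt]]; first by rewrite eu eqxx in uq.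
      by move: lt; rewrite -/(h' q) -/(h' u) hu; clear -le; lia.
    exact: absorbed Uu nq c1 c2 c3.
  rewrite (eqP Uu); split=> [[/val_inj <-]|[c1 c2 c3]].
    split; [by rewrite idq | | by move=> z /andP[_]; rewrite idq].
    have [d chd vd] := visible_ext ext vb.
    by apply: visS vd chd _; rewrite -/(h' q) -/(h' u) hu.
  case: (eqVneq c q) => [->//|nq]; exfalso.
  exact: absorbed Uu nq c1 c2 c3.
rewrite Ulab ?Uu //.
split=> [/g3[c1 c2 c3]|[c1 c2 c3]].
  have ck : k.-1 <= idx c by apply: leq_trans c1; apply: leq_pred.
  split=> //; first by apply: vis_ext c2 => z lz; apply: (extS c).
  move=> z chz; have := c3 z chz; rewrite -/k => lt.
  have : idx z != k.-1.
    rewrite -idq; apply/eqP => /idx_inj ez; move/negP: Uu; apply; apply/UE.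
    by exists c => //; rewrite -ez.
  by clear -lt; lia.
apply/g3; case: (eqVneq c q) => [ec|nq].
  exfalso; move: c2; rewrite ec => /vis_inv[eu|[vb _]]; first by rewrite eu eqxx in uq.
  by move/negP: Uu; apply; apply/UE; apply: visible_ext vb => z lz; rewrite ext.
have ck := above c nq c1.
split=> //; first by apply: visC c2.
by move=> z /c3; rewrite -/k; clear -k0; lia.
by move=> s1; rewrite /greedy_inv !stE.
Qed.
End GreedyRun.

(** * Building and writing the decision tree *)

Definition select_lowest : cmd :=
  Assign vbest (Cst 0) ;;
  For vu (IfZero (EArr Art (Var vu))
    (IfZero (Var vbest) (Assign vbest (EAdd (Var vu) (Cst 1)))
      (IfZero (ESub (EArr Ah (ESub (Var vbest) (Cst 1))) (EArr Ah (Var vu))) Skip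
        (Assign vbest (EAdd (Var vu) (Cst 1))))) Skip).
Definition link_roots : cmd :=
  For vu (IfZero (EArr Art (Var vu)) Skip (IfZero (adjx (Var vq) (Var vu)) Skip
    (StoreArr Apar (ESub (EArr Art (Var vu)) (Cst 1)) (EAdd (Var vq) (Cst 1))))).
(** Roots have parent entry 0 before [link_roots], so a component has been joined to [vq] exactly
    when the entry of its old root now names [vq]. A separate loop is used so that all of
    [link_roots] sees the old roots. *)
Definition relabel_roots : cmd :=
  For vu (IfZero (EArr Art (Var vu)) Skip
    (IfZero (eqx (EArr Apar (ESub (EArr Art (Var vu)) (Cst 1))) (EAdd (Var vq) (Cst 1)))
      (StoreArr Art (Var vu) (EAdd (Var vq) (Cst 1))) Skip)).
Definition build_tree : cmd :=
  For vi (select_lowest ;; Assign vq (ESub (Var vbest) (Cst 1)) ;; link_roots ;; relabel_roots ;;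
    StoreArr Art (Var vq) (EAdd (Var vq) (Cst 1))).
(** [vq] still holds the vertex joined last, which is the root of the whole tree. *)
Definition write_output : cmd :=
  StoreTape (Cst 0) (Var vq) ;; For vu (StoreTape (EAdd (Var vu) (Cst 1)) (EArr Apar (Var vu))).

Lemma ord_split (v : 'I_n) j (hj : j < n) : v < j.+1 -> v = Ordinal hj \/ v < j.
Proof. by rewrite ltnS leq_eqVlt => /predU1P[evu|]; [left; apply: val_inj | right]. Qed.

Lemma select_lowest_spec s (h : 'I_n -> nat) : vars s 0 = n -> (forall u : 'I_n, arrs s Ah u = h u) ->
  (exists u : 'I_n, arrs s Art u == 0) ->
  exists q : 'I_n, [/\ vars (den select_lowest s) vbest = q.+1, arrs s Art q = 0
    & forall u : 'I_n, arrs s Art u = 0 -> h q <= h u].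
Proof.
move=> hn hh [f /eqP f0]; rewrite /select_lowest den_Seq den_Assign evalE.
set c := IfZero _ _ _; set s0 := setv _ _ s.
pose Q j s' := (vars s' vbest = 0 /\ forall v : 'I_n, v < j -> arrs s Art v != 0) \/
  exists q : 'I_n, [/\ vars s' vbest = q.+1, arrs s Art q = 0
    & forall v : 'I_n, v < j -> arrs s Art v = 0 -> h q <= h v].
have : Q n (den (For vu c) s0).
  apply: For_rule; [by rewrite /s0 stE | by left; rewrite /s0 !stE | | by move=> s1; rewrite /Q !stE].
  move=> j s1 hj [_ hA _ _] hQ; pose u := Ordinal hj.
  have r1 : arrs s1 Art j = arrs s Art u by rewrite hA // /s0 stE.
  have h1 (v : 'I_n) : arrs s1 Ah v = h v by rewrite hA // /s0 stE hh.
  have skip : (arrs s Art u = 0 -> exists2 q : 'I_n, vars s1 vbest = q.+1 & h q <= h u) -> Q j.+1 (setv vu j s1).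
    move=> hu; case: hQ => [[g1 g2]|[q [g1 g2 g3]]].
      left; rewrite !stE; split=> // v /(ord_split hj)[->|/g2//].
      by apply/eqP => /hu[q]; rewrite g1.
    right; exists q; rewrite !stE; split=> // v /(ord_split hj)[->|/g3//] /hu[q' ].
    by rewrite g1 => -[/val_inj->].
  have take1 : arrs s Art u = 0 -> (forall v : 'I_n, v < j -> arrs s Art v = 0 -> h u <= h v) ->
      Q j.+1 (setv vbest (j + 1) (setv vu j s1)).
    move=> u0 hm; right; exists u; rewrite !stE /= addn1; split=> // v /(ord_split hj)[->//|]; exact: hm.
  rewrite /c den_IfZero !evalE !stE /= r1; case: ifP => /eqP u0; last by rewrite denE; apply: skip.
  rewrite den_IfZero !evalE !stE /=.
  case: hQ => [[g1 g2]|[q [g1 g2 g3]]].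
    rewrite g1 eqxx !denE !evalE !stE /=; apply: take1 => // v /g2 h2 h3; by rewrite h3 in h2.
  rewrite g1 /= den_IfZero !evalE !stE /= g1 subn1 /= h1 -[j in arrs s1 Ah j]/(nat_of_ord u) h1 subn_eq0.
  case: leqP => le; first by rewrite denE; apply: skip => _; exists q.
  rewrite !denE !evalE !stE /=; apply: take1 => // v vj v0'; apply: leq_trans (ltnW le) (g3 v vj v0').
case=> [[_ g]|[q [g1 g2 g3]]]; first by have := g f (ltn_ord f); rewrite f0.
by exists q; split=> // u; apply: g3.
Qed.

Section ElimStep.
Variables (P : {set 'I_n}) (rt : 'I_n -> 'I_n) (q : 'I_n).
Hypothesis rtP : forall u, u \in P -> rt u \in P.

Lemma link_roots_spec s : adj_ok s -> vars s vq = q ->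
  (forall u : 'I_n, arrs s Art u = if u \in P then (rt u).+1 else 0) ->
  forall c : 'I_n, arrs (den link_roots s) Apar c =
    if [exists u, [&& u \in P, e q u & rt u == c]] then q.+1 else arrs s Apar c.
Proof.
move=> hadj hq hrt.
pose Q j s' := forall c : 'I_n, arrs s' Apar c =
    if [exists u : 'I_n, (u < j) && [&& u \in P, e q u & rt u == c]] then q.+1 else arrs s Apar c.
suff h : Q n (den link_roots s).
  move=> c; rewrite h; congr (if _ then _ else _); apply: eq_existsb => u; by rewrite ltn_ord.
apply: For_rule; [by case: hadj | | | by move=> s1; rewrite /Q !stE].
  by move=> c; case: ifP => // /existsP[u].
move=> j s1 hj [hv hA _ _] hQ; pose u := Ordinal hj.
have r1 : arrs s1 Art j = if u \in P then (rt u).+1 else 0 by rewrite hA // (hrt u).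
have ex c : [exists x : 'I_n, (x < j.+1) && [&& x \in P, e q x & rt x == c]] =
   [exists x : 'I_n, (x < j) && [&& x \in P, e q x & rt x == c]] || [&& u \in P, e q u & rt u == c].
  apply/existsP/orP => [[x /andP[/(ord_split hj)[->|lt] hx]]|]; [by right | |].
    by left; apply/existsP; exists x; rewrite lt.
  case=> [/existsP[x /andP[lt hx]]|hx]; first by exists x; rewrite hx andbT ltnW.
  by exists u; rewrite ltnSn.
have no : ~~ ((u \in P) && e q u) -> Q j.+1 (setv vu j s1).
  by move=> /negbTE nu c; rewrite stE hQ ex andbA nu orbF.
have hadj1 : adj_ok (setv vu j s1).
  by case: hadj => h1 h2; split; [rewrite !stE /= hv | move=> x y; rewrite !stE !hA].
rewrite den_IfZero !evalE !stE /= r1; case: ifP => uP0.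
  by rewrite denE; apply: no; move: uP0; case: (u \in P).
have uP : u \in P by move: uP0; case: (u \in P).
rewrite den_IfZero (adj_okE (u := q) (v := u) hadj1); last 2 first.
- by rewrite !evalE !stE /= hv.
- by rewrite !evalE !stE.
case: ifP => qu; first by rewrite denE; apply: no; rewrite (negbTE qu) andbF.
rewrite den_StoreArr !evalE !stE /= r1 uP hv // hq subn1 addn1 /= => c; rewrite !stE /= ex uP.
move/negbFE: qu => -> /=; rewrite -[(c : nat) == rt u]/(c == rt u) eq_sym.
by case: eqP => _; rewrite ?orbT // orbF.
Qed.

Lemma relabel_roots_spec s : vars s 0 = n -> vars s vq = q ->
  (forall u : 'I_n, arrs s Art u = if u \in P then (rt u).+1 else 0) ->
  forall u : 'I_n, arrs (den relabel_roots s) Art u =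
    if (u \in P) && (arrs s Apar (rt u) == q.+1) then q.+1 else arrs s Art u.
Proof.
move=> hn hq hrt.
pose Q j s' := forall u : 'I_n, arrs s' Art u =
    if [&& u < j, u \in P & arrs s Apar (rt u) == q.+1] then q.+1 else arrs s Art u.
suff h : Q n (den relabel_roots s) by move=> u; rewrite h ltn_ord.
apply: For_rule; [by [] | by move=> u; rewrite ltn0 | | by move=> s1; rewrite /Q !stE].
move=> j s1 hj [hv hA _ _] hQ; pose u := Ordinal hj.
have r1 : arrs s1 Art j = if u \in P then (rt u).+1 else 0 by rewrite (hQ u) ltnn (hrt u).
have no : ~~ ((u \in P) && (arrs s Apar (rt u) == q.+1)) -> Q j.+1 (setv vu j s1).
  move=> /negbTE nu v; rewrite stE hQ ltnS [v <= j]leq_eqVlt.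
  case: (eqVneq (v : nat) j) => [evu|//].
  by rewrite (@val_inj _ _ 'I_n v u evu) nu !andbF.
rewrite den_IfZero !evalE !stE /= r1; case: ifP => uP0.
  by rewrite denE; apply: no; move: uP0; case: (u \in P).
have uP : u \in P by move: uP0; case: (u \in P).
rewrite den_IfZero eval_eqx !evalE !stE /= r1 uP subn1 /= hv // hq addn1 hA //.
case: ifP => pq; last by rewrite denE; apply: no; rewrite pq andbF.
rewrite den_StoreArr !evalE !stE /= hv // hq addn1 => v; rewrite !stE /= ltnS [v <= j]leq_eqVlt.
case: (eqVneq (v : nat) j) => [evu|ne] /=; last exact: hQ.
by rewrite (@val_inj _ _ 'I_n v u evu) uP pq.
Qed.
End ElimStep.

Section ElimRun.
Variables Y h : 'I_n -> nat.
Hypothesis h_sep : forall m p, path e m p -> m != last m p ->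
  (forall z, z \in m :: p -> h z <= h m) -> h (last m p) + Y m <= h m.
Hypothesis h_ge : forall v, Y v <= h v.

Definition elim_run i s := exists (P : {set 'I_n}) (rt : 'I_n -> 'I_n) (par : 'I_n -> nat),
  [/\ #|P| = i, (forall u : 'I_n, arrs s Art u = if u \in P then (rt u).+1 else 0),
      (forall c : 'I_n, arrs s Apar c = par c), elim_inv R e Y h P rt par
    & (forall u v, u \in P -> v \notin P -> h u <= h v) /\
      (0 < i -> exists q : 'I_n, [/\ vars s vq = q, q \in P & rt q = q])].

Lemma build_tree_spec s : adj_ok s -> (forall v : 'I_n, arrs s Ah v = h v) ->
  (forall v : 'I_n, arrs s Art v = 0) -> (forall v : 'I_n, arrs s Apar v = 0) ->
  elim_run n (den build_tree s).
Proof.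
move=> hadj hh hr hp; have [_ e_sym _ _ _] := tree.
apply: For_rule; [by case: hadj | | | by move=> s1; rewrite /elim_run !stE].
  exists set0, id, (fun=> 0); rewrite cards0; split=> //; first by move=> u; rewrite inE hr.
    by split=> [x|x y|c]; rewrite ?inE.
  by split=> // u v; rewrite inE.
move=> i s1 hi [hv hA _ _] [P [rt [par [cP hrt hpar [tP1 tP2 tP3] [hord _]]]]].
have adj2 : adj_ok (setv vi i s1).
  by case: hadj => h1 h2; split; [rewrite !stE /= hv | move=> x y; rewrite !stE !hA].
rewrite 4!den_Seq den_StoreArr.
have rtc x : x \in P -> rt x \in component e P x.
  by move=> /tP1[D [hD <- _ _]]; apply: is_dtree_mem hD.
have rtP x : x \in P -> rt x \in P by move/rtc; rewrite inE => /andP[].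
have [f fP] : exists f, f \notin P.
  apply/existsP; rewrite -negb_forall; apply/negP => /forallP all.
  have : P = setT by apply/setP => x; rewrite inE all.
  by move=> PT; move: cP hi; rewrite PT cardsT card_ord => ->; rewrite ltnn.
have [q [hb q0 qmin]] : exists q : 'I_n, [/\ vars (den select_lowest (setv vi i s1)) vbest = q.+1, arrs s1 Art q = 0
    & forall u : 'I_n, arrs s1 Art u = 0 -> h q <= h u].
  have := @select_lowest_spec (setv vi i s1) h; rewrite !stE; apply.
  - by case: adj2; rewrite stE.
  - by move=> u; rewrite hA.
  - by exists f; rewrite hrt (negbTE fP).
have qP : q \notin P by move: q0; rewrite hrt; case: (q \in P).
set s2 := den select_lowest _ in hb *.
have a2 k x : arrs s2 k x = arrs s1 k x by rewrite /s2 frame_a // stE.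
have n2 : vars s2 0 = n by rewrite /s2 frame_v //; case: adj2.
clearbody s2.
rewrite den_Assign !evalE hb subn1 /=.
set s3 := setv vq q s2.
have q3 : vars s3 vq = q by rewrite /s3 stE.
have a3 : forall k x, arrs s3 k x = arrs s1 k x by move=> k x; rewrite /s3 stE a2.
have adj3 : adj_ok s3.
  by case: adj2 => h1 h2; split; [rewrite /s3 stE | move=> x y; rewrite !a3; have := h2 x y; rewrite !stE].
clearbody s3.
have rt3 (u : 'I_n) : arrs s3 Art u = if u \in P then (rt u).+1 else 0 by rewrite a3.
have pr := link_roots_spec adj3 q3 rt3.
set s4 := den link_roots s3 in pr *.
have q4 : vars s4 vq = q by rewrite /s4 frame_v.
have n4 : vars s4 0 = n by rewrite /s4 frame_v //; case: adj3.
have rt4 (u : 'I_n) : arrs s4 Art u = if u \in P then (rt u).+1 else 0 by rewrite /s4 frame_a.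
clearbody s4.
have rr := relabel_roots_spec n4 q4 rt4.
set s5 := den relabel_roots s4 in rr *.
have q5 : vars s5 vq = q by rewrite /s5 frame_v.
have p5 x : arrs s5 Apar x = arrs s4 Apar x by rewrite /s5 frame_a.
clearbody s5.
rewrite q5 addn1.
pose adj c := [exists u, [&& u \in P, e q u & rt u == c]].
pose par' (c : 'I_n) := if adj c then q.+1 else par c.
pose rt' x := if x == q then q else if adj (rt x) then q else rt x.
have p4 (c : 'I_n) : arrs s4 Apar c = par' c by rewrite pr a3 hpar.
have pq (u : 'I_n) : u \in P -> (arrs s4 Apar (rt u) == q.+1) = adj (rt u).
  move=> uP; rewrite p4 /par'; case: ifP => _; first by rewrite eqxx.
  by rewrite tP3 //; right; exists u.
exists (q |: P), rt', par'; split.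
- by rewrite cardsU1 qP cP.
- move=> u; rewrite stE /= -[(u : nat) == q]/(u == q) !inE /rt'.
  case: (eqVneq u q) => [//|nq] /=; rewrite rr rt4.
  by case uP: (u \in P) => //=; rewrite pq //; case: ifP.
- by move=> c; rewrite stE /= p5 p4.
- apply: (@elim_step R n e Y h e_sym P q rt par) => //.
  (* The walk from [q] to [u] and on to the root of its component stays in [P] after [q]. Ranks in
     [P] are at most [h q], so [h_sep] applies. *)
  + move=> u uP equ; have [p [hw lw _ aw]] := comp_walk uP (rtc u uP).
    have := h_sep (m := q) (p := u :: p); rewrite /= equ lw; apply=> //.
      by apply: contraNneq qP => ->; apply: rtP.
    move=> z; rewrite inE => /predU1P[->//|]; rewrite inE => zp.
    apply: hord => //; case/predU1P: zp => [->//|/(allP aw)]; by rewrite /= inE => /andP[].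
  + by rewrite /rt' eqxx.
  + move=> x xP; rewrite /rt'; case: eqP => [xq|_ //]; by rewrite -xq xP in qP.
- split.
  + move=> u v; rewrite !inE negb_or => /predU1P[->|uP] /andP[nq vP]; last exact: hord.
    by apply: qmin; rewrite hrt (negbTE vP).
  + by move=> _; exists q; rewrite !stE /rt' eqxx !inE eqxx.
Qed.
End ElimRun.

Lemma write_output_spec s : vars s 0 = n -> n.+2 <= lim ->
  tape (den write_output s) 0 = vars s vq /\ forall c : 'I_n, tape (den write_output s) c.+1 = arrs s Apar c.
Proof.
move=> hn hlim; rewrite /write_output den_Seq den_StoreTape !evalE min0n.
pose Q j s' := tape s' 0 = vars s vq /\ forall c : 'I_n, c < j -> tape s' c.+1 = arrs s Apar c.
set l := For vu _; suff [h1 h2] : Q n (den l (sett 0 (vars s vq) s)).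
  by split=> // c; apply: h2.
apply: For_rule; [by rewrite stE | by split; rewrite ?stE | | by move=> s1; rewrite /Q !stE].
move=> j s1 hj [_ hA _ _] [g1 g2].
rewrite den_StoreTape !evalE !stE /= (minn_idPl _); last by clear -hj hlim; lia.
rewrite addn1 hA // stE; split; first by rewrite !stE.
move=> c; rewrite ltnS leq_eqVlt => /predU1P[->|lt]; rewrite !stE ?eqxx //.
by rewrite eqSS (ltn_eqF lt) g2.
Qed.

End Phases.
End Rules.

Local Open Scope ring_scope.

Definition two_approx : cmd := (mul_table ;; adj_table ;; prim_order ;; greedy_ranking ;; build_tree ;; write_output).

(** * Input encoding and the approximation bound *)

Section Input.
Variables (R : realType) (n : nat) (e : rel 'I_n) (w : 'I_n -> R).
Hypothesis tree : is_tree e.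
Let E := edge_list e.

Lemma edge_list_size : (size E <= n * n)%N.
Proof.
rewrite /E /edge_list size_map -cardE; apply: leq_trans (max_card _) _.
by rewrite card_prod card_ord.
Qed.

Lemma edge_list_bound : all (fun p => (p.1 < n) && (p.2 < n))%N E.
Proof. by apply/allP => p /mapP[[x y] _ ->] /=; rewrite !ltn_ord. Qed.

Lemma edge_atE (u v : 'I_n) : edge_at E (size E) u v = e u v.
Proof.
have [_ e_sym e_irr _ _] := tree.
have mem (x y : 'I_n) : ((x : nat, y : nat) \in E) = (x < y)%N && e x y.
  apply/mapP/idP => [[[a b]]|h]; last by exists (x, y); rewrite ?mem_enum.
  by rewrite mem_enum => h [/val_inj-> /val_inj->].
have at_ (p : nat * nat) : p \in E -> (p = (u : nat, v : nat)) \/ p = (v : nat, u : nat) ->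
    edge_at E (size E) u v.
  move=> pE hp; have hi : (index p E < size E)%N by rewrite index_mem.
  apply/existsP; exists (Ordinal hi); rewrite hi /= nth_index //.
  by case: hp => ->; rewrite eqxx ?orbT.
apply/existsP/idP => [[t /andP[_ /orP[/eqP ht|/eqP ht]]]|euv].
- by have := mem u v; rewrite -ht mem_nth // => /esym/andP[].
- by have := mem v u; rewrite -ht mem_nth // e_sym => /esym/andP[].
apply/existsP.
case: (ltngtP u v) => [lt|lt|/val_inj eq].
- by apply: (at_ (u : nat, v : nat)); [rewrite mem lt | left].
- by apply: (at_ (v : nat, u : nat)); [rewrite mem lt e_sym | right].
- by rewrite eq e_irr in euv.
Qed.
End Input.

Section Bound.
Variables (R : realType) (n : nat) (e : rel 'I_n) (w : 'I_n -> R) (v0 : 'I_n).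
Hypothesis tree : is_tree e.
Hypothesis w_ge0 : forall v, 0 <= w v.
Variables (o : seq 'I_n) (Yf : nat -> nat) (xf : nat -> R) (Y h : 'I_n -> nat).
Hypothesis o_size : size o = n.
Hypothesis po : prim_seq e w v0 o.
Hypothesis so : sur_seq w v0 o Yf xf.
Hypothesis YE : forall j, (j < n)%N -> Y (nth v0 o j) = Yf j.
Let idx v := index v o.

Lemma prim_all v : v \in o.
Proof.
have [o_uniq _ _ _] := po.
have := @uniq_min_size _ o (enum 'I_n) o_uniq; rewrite size_enum_ord o_size.
by case=> // [x _|_ ->]; rewrite mem_enum.
Qed.

Lemma idx_lt v : (idx v < n)%N. Proof. by rewrite -o_size index_mem prim_all. Qed.

Lemma YfE v : Y v = Yf (idx v).
Proof. by rewrite -YE ?idx_lt // /idx nth_index // prim_all. Qed.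

Lemma sur_gt0 v : (0 < Y v)%N.
Proof. by have [h1 _ _] := so; rewrite YfE h1 // o_size idx_lt. Qed.

Lemma sur_dvd c v : child e idx c v -> (Y v %| Y c)%N.
Proof.
case/andP => _ lt; rewrite !YfE; have := idx_lt c.
move: (idx v) (idx c) lt => i j; elim: j => // j IH; rewrite ltnS leq_eqVlt => hij hj.
have eS : (Yf j %| Yf j.+1)%N.
  by have [_ _ /(_ j)] := so; rewrite o_size hj => -[//|[k [_ -> _]]|[-> _]]; apply: dvdn_mull.
case/predU1P: hij => [->//|lt]; apply: dvdn_trans eS; apply: IH => //; exact: ltnW.
Qed.

Lemma prim_par_uniq c z1 z2 : child e idx c z1 -> child e idx c z2 -> z1 = z2.
Proof.
have [_ h2 _ _] := po.
by apply: child_uniq_tree => //; [exact: prim_all | by case: po].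
Qed.

Lemma prim_par c : c != nth v0 o 0 -> exists v, child e idx c v.
Proof.
have [o_uniq h2 _ _] := po; move=> ne.
apply: lower_nbr => //; first exact: prim_all.
rewrite lt0n; apply: contra ne => /eqP h0; by rewrite -h0 /idx nth_index // prim_all.
Qed.

Lemma sum_prim (T : nmodType) (A : {set 'I_n}) (F : 'I_n -> T) :
  \sum_(v in A) F v = \sum_(0 <= i < n) (if nth v0 o i \in A then F (nth v0 o i) else 0).
Proof.
have [o_uniq _ _ _] := po.
rewrite big_mkcond /= -big_enum /= (perm_big o) /=; last first.
  apply: uniq_perm; rewrite ?enum_uniq // => v; by rewrite mem_enum prim_all.
by rewrite (big_nth v0) o_size.
Qed.

(** With [A] a heaviest path of [D] for [w] and [B] one of [D'] for [Y], the chain is w(A) <= x(A)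
    <= x(B) <= 2 w(B), and w(B) is at most the cost of [D']. The middle inequality comes from Y(A)
    <= Y(B): the [Y]-cost of [D] is at most a greedy rank, and [greedy_opt] bounds greedy ranks by
    the [Y]-cost of [D']. *)
Lemma greedy_two_approx D D' : greedy e Y idx h ->
  is_dtree e setT D -> is_dtree e setT D' ->
  (exists q, dcost (fun v => (Y v)%:R : R) D <= (h q)%:R) ->
  dcost w D <= 2 * dcost w D'.
Proof.
move=> hg hD hD' [q hq]; have [_ e_sym _ _ _] := tree.
have [g [C [eC hgC rk]]] := dtree_ranking Y e_sym R hD'.
have hC : (h q <= C)%N.
  apply: (@greedy_opt _ e Y idx e_sym prim_par_uniq sur_gt0 sur_dvd h g hg _ _ (nth v0 o 0) C prim_par).
  - move=> u p hp _ ne; apply: rk => //; apply/allP => z _; by rewrite inE.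
  - by move=> v; case/andP: (hgC v (in_setT _)).
  - by move=> v; case/andP: (hgC v (in_setT _)).
have [A [_ eA] hA] := dcost_path hD w.
have [B [_ eB] hB] := dcost_path hD' (fun v => (Y v)%:R : R).
have le : (\sum_(v in A) Y v <= \sum_(v in B) Y v)%N.
  rewrite -(ler_nat R) !natr_sum -eB.
  apply: le_trans (hA _ (fun v => ler0n _ _)) _.
  by apply: le_trans hq _; rewrite eC ler_nat.
have [s1 s2 s3] := so; rewrite o_size in s1 s2 s3.
pose x v := xf (idx v).
have xE i : (i < n)%N -> x (nth v0 o i) = xf i.
  by move=> hi; rewrite /x /idx index_uniq ?o_size //; case: po.
have xw v : w v <= x v <= 2 * w v.
  by have := s2 _ (idx_lt v); rewrite /idx nth_index // prim_all.
have sur : \sum_(v in A) x v <= \sum_(v in B) x v.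
  rewrite !sum_prim.
  have := @surrogate_le R n Yf xf s1 _ s3 (fun i => nth v0 o i \in A) (fun i => nth v0 o i \in B).
  have fold (F : {set 'I_n}) : \sum_(0 <= i < n) (if nth v0 o i \in F then x (nth v0 o i) else 0) =
      \sum_(0 <= i < n) (nth v0 o i \in F)%:R * xf i.
    by apply: eq_big_nat => i /andP[_ hi]; rewrite xE //; case: ifP => _; rewrite ?mul1r ?mul0r.
  have foldN (F : {set 'I_n}) : (\sum_(v in F) Y v = \sum_(0 <= i < n) (nth v0 o i \in F) * Yf i)%N.
    rewrite [LHS](sum_prim (T := nat)); apply: eq_big_nat => i /andP[_ hi]; rewrite YE //.
    by case: ifP => _; rewrite ?mul1n ?mul0n.
  rewrite !fold; apply; last by rewrite -!foldN.
  by move=> i hi; case/andP: (s2 i hi) => h1 _; apply: le_trans h1.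
have wA : dcost w D <= \sum_(v in A) x v.
  by rewrite eA; apply: ler_sum => v _; case/andP: (xw v).
apply: le_trans wA _; apply: le_trans sur _.
apply: le_trans (_ : 2 * \sum_(v in B) w v <= _); last first.
  by rewrite ler_pM2l //; apply: hB.
by rewrite mulr_sumr; apply: ler_sum => v _; case/andP: (xw v).
Qed.
End Bound.

Theorem theorem2 :
  exists (P : program) (c k : nat),
  forall (R : realType) (n : nat) (e : rel 'I_n) (w : 'I_n -> R),
    is_tree e ->
    (forall v, 0 <= w v) ->
    down_monotonic e w ->
    exists s : rstate R,
      exec P (c * n.+1 ^ k)%N (init_state e w) = Some s /\
      exists D : dtree 'I_n,
        [/\ is_dtree e setT D, encodes (nmem s) D & dcost w D <= 2 * OPT e w].
Proof.
have [K [d correct]] := @prog_of_correct two_approx isT isT.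
exists (prog_of two_approx), K, d => R n e w tree w_ge0 mono.
have [n0 e_sym _ con _] := tree; rewrite card_ord in n0.
pose v0 := Ordinal n0.
set E := edge_list e.
pose N0 := nmem (init_state e w); pose X0 := rmem (init_state e w).
have N0z x : (2 * size E + 2 <= x)%N -> N0 x = 0%N.
  move=> hx; rewrite /N0 /= !ifF //; apply/negbTE; rewrite -/E; lia.
have [b [W [s [hb [hs0 hs1 hsA hsT] hW [s' [hex hout]]]]]] :=
  correct R n (size E) N0 X0 erefl erefl n0 N0z.
exists s'; split; first exact: hex.
have Ww (v : 'I_n) : W v = w v.
  by rewrite hW // /X0 /= insubT //= => hv; congr w; apply: val_inj.
have tape_in k : (k < size E)%N -> tape s (2 + 2 * k)%N = (nth (0, 0)%N E k).1 /\
     tape s (3 + 2 * k)%N = (nth (0, 0)%N E k).2.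
  have N0E a : N0 a.+2 = (if (a < 2 * size E)%N then
      if odd a then (nth (0, 0) E a./2).2 else (nth (0, 0) E a./2).1 else 0)%N.
    by rewrite /N0 /= subn2.
  move=> hk; rewrite !hsT; [|clear -hk; lia|clear -hk; lia].
  rewrite -[(2 + 2 * k)%N]/((2 * k).+2) -[(3 + 2 * k)%N]/((2 * k).+3) !N0E.
  have l1 : (2 * k < 2 * size E)%N by clear -hk; lia.
  have l2 : ((2 * k).+1 < 2 * size E)%N by clear -hk; lia.
  by rewrite l1 l2 /= mul2n odd_double doubleK uphalf_double.
rewrite /two_approx 5!den_Seq in hout.
set s1 := den _ _ mul_table s in hout.
have mul1 : forall u, (u < n)%N -> arrs s1 Amul u = (u * n)%N by apply: mul_table_spec.
have v1 r : ~~ writes_var mul_table r -> vars s1 r = vars s r by move=> hr; rewrite /s1 frame_v.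
have a1 k x : k != Amul -> (k < 16)%N -> arrs s1 k x = 0%N.
  by move=> hk hk2; rewrite /s1 frame_a ?hsA //= orbF eq_sym.
have t1 x : tape s1 x = tape s x by rewrite /s1 frame_t.
clearbody s1.
set s2 := den _ _ adj_table s1 in hout.
have n2 : vars s2 0 = n by rewrite /s2 frame_v // v1.
have adj2 : adj_ok e s2.
  split=> // u v; split; first by rewrite /s2 frame_a // mul1.
  rewrite -(edge_atE tree) -/E /s2; apply: adj_table_spec => //.
  - by rewrite v1.
  - by rewrite v1.
  - by lia.
  - exact: edge_list_size.
  - by move=> k hk; rewrite !t1; apply: tape_in.
  - exact: edge_list_bound.
  - by move=> x; rewrite a1.
have a2 k x : k != Amul -> k != Aadj -> (k < 16)%N -> arrs s2 k x = 0%N.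
  by move=> h1 h2 h3; rewrite /s2 frame_a ?a1 //=; move: h2; rewrite eq_sym => /negbTE ->.
clearbody s2.
set s3 := den _ _ prim_order s2 in hout.
have [o [Yf [xf [[o_size po] so [hord _] _ [hY _ _]]]]] : prim_inv e w v0 n s3.
  by apply: prim_order_spec => // v; rewrite a2.
have adj3 : adj_ok e s3.
  by case: adj2 => h1 h2; split; [rewrite /s3 frame_v | move=> u v; rewrite /s3 !frame_a].
have a3 k x : ~~ writes_arr prim_order k -> k != Amul -> k != Aadj -> (k < 16)%N -> arrs s3 k x = 0%N.
  by move=> h0 h1 h2 h3; rewrite /s3 frame_a ?a2.
clearbody s3.
pose Y (v : 'I_n) := arrs s3 AY v.
have YE j : (j < n)%N -> Y (nth v0 o j) = Yf j by apply: hY.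
have o_uniq : uniq o by case: po.
have par_uniq := prim_par_uniq tree o_size po.
have Y_dvd := sur_dvd o_size po so YE.
set s4 := den _ _ greedy_ranking s3 in hout.
pose h (v : 'I_n) := arrs s4 Ah v.
have gr : greedy e Y (index^~ o) h.
  by apply: (@greedy_ranking_spec R b W n e v0) => // v; rewrite a3.
have adj4 : adj_ok e s4.
  by case: adj3 => h1 h2; split; [rewrite /s4 frame_v | move=> u v; rewrite /s4 !frame_a].
have a4 k x : ~~ writes_arr greedy_ranking k -> ~~ writes_arr prim_order k -> k != Amul -> k != Aadj -> (k < 16)%N -> arrs s4 k x = 0%N.
  by move=> h0 h1 h2 h3 h4; rewrite /s4 frame_a ?a3.
have hE (v : 'I_n) : arrs s4 Ah v = h v by [].
clearbody h; clearbody s4.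
set s5 := den _ _ build_tree s4 in hout.
have sep := greedy_sep e_sym par_uniq (sur_gt0 o_size po so YE) gr (idx_inj_o (prim_all o_size po)).
have [P [rt [par [cP _ hpar [tP _ rP] [_ /(_ n0)[q [hq qP rq]]]]]]] : elim_run e Y h n s5.
  apply: build_tree_spec => //.
  - by move=> v; have [] := gr v.
  - by move=> v; rewrite a4.
  - by move=> v; rewrite a4.
have n5 : vars s5 0 = n by rewrite /s5 frame_v //; case: adj4.
clearbody s5.
(* After [n] rounds every vertex has been joined, and since the tree is connected there is one
   component, the whole vertex set. *)
have PT : P = setT.
  by apply/eqP; rewrite eqEcard subsetT cardsT card_ord cP leqnn.
have [D [hD rD eD cD]] := tP q qP.
have cT : component e P q = setT.
  rewrite PT; apply/setP => x; rewrite !inE /=; have /connectP[p hp ->] := con q x.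
  by apply/connectP; exists p => //; rewrite walk_restrict ?inE // hp; apply/allP => z _; rewrite /= inE.
rewrite cT in hD; rewrite rq in rD cD.
have [|o0 oS] := @write_output_spec R b W n s5 n5; first by clear -hb; lia.
exists D; split=> //.
- split.
  + by rewrite hout ?o0 ?rD //; lia.
  + rewrite rD hout ?oS ?hpar //; last by have := ltn_ord q; rewrite /=; clear -hb; lia.
    by apply: rP; right; exists q.
  + move=> a c ac; rewrite hout ?oS ?hpar //; [exact: eD | by have := ltn_ord c; rewrite /=; clear -hb; lia].
have key D' : is_dtree e setT D' -> dcost w D <= 2 * dcost w D'.
  by move=> hD'; apply: (greedy_two_approx tree w_ge0 o_size po so YE gr) => //; exists q.
(* [OPT] is an infimum: [D] itself shows that the set of costs is nonempty, and [key] bounds each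
   member. *)
rewrite -ler_pdivrMl //; apply: lb_le_inf.
- by exists (dcost w D), D.
- by move=> y [D' [hD' ->]]; rewrite ler_pdivrMl //; apply: key.
Qed.
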